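(* Let $\gamma,\varepsilon>0$ and $u_0\in H^2(\Omega)\cap H_0^1(\Omega)$. For $\alpha\in(0,1)$ let $u$ (depending on $\alpha$) be a global bounded solution of the time-fractional Allen--Cahn problem $\partial_t^\alpha u=\gamma(\varepsilon^2\Delta u-f(u))$ for $t>0$, $u(0,\cdot)=u_0$, with homogeneous Dirichlet boundary condition, where $f(u)=u^3-u$. Define $$E(t)=\int_\Omega\Big(\frac{\varepsilon^2}{2}|\nabla u(t)|^2+\frac14(u(t)^2-1)^2\Big)dx,\qquad \tilde E(t)=E(t)+\frac{1}{\gamma\Gamma(1-\alpha)}\left(\frac{\|u(t)-u(0)\|^2}{2t^\alpha}+\frac{\alpha}{2}\int_0^t\frac{\|u(t)-u(\tau)\|^2}{(t-\tau)^{\alpha+1}}\,d\tau\right).$$ Then: (1) for every $\alpha\in(0,1)$, $\tilde E(0)=E(0)$; (2) for every $\alpha\in(0,1)$, if $u(t)$ converges strongly in $L^2(\Omega)$ to some steady state $u_\infty$ as $t\to+\infty$, then $\tilde E(t)-E(t)\to0$ as $t\to+\infty$; (3) for every fixed $t\in(0,\infty)$, $\tilde E(t)-E(t)\to0$ as $\alpha\to1^-$.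
   Context: $\Omega\subset\mathbb{R}^d$ is a bounded domain with sufficiently regular boundary; $\|\cdot\|$ is the norm of $L^2(\Omega)$; $u(t)=u(t,\cdot)$. $\tilde E(0)$ is understood as the limit of $\tilde E(t)$ for $t\to0^+$. ''Global bounded solution'' means that $u$ solves the problem on $(0,T)$ for every $T>0$ and $u\in L^\infty((0,\infty)\times\Omega)$. The Caputo derivative of order $\alpha\in(0,1)$ is $\partial_t^\alpha u(t)=\frac{1}{\Gamma(1-\alpha)}\int_0^t\frac{\partial_\tau u(\tau)}{(t-\tau)^\alpha}\,d\tau$, $t>0$. On each $(0,T)$ the solution is the unique solution with the following (known) regularity: $u\in H^\alpha(0,T;L^2(\Omega))\cap L^2(0,T;H^2(\Omega)\cap H_0^1(\Omega))$, $u\in L^\infty((0,T)\times\Omega)$, $u\in C^\alpha([0,T];L^2(\Omega))\cap C([0,T];H^2(\Omega)\cap H_0^1(\Omega))$, $\partial_t^\alpha u\in C([0,T];L^2(\Omega))$, $\partial_t u\in C((0,T];L^2(\Omega))$, and $\|\partial_t u(t)\|\le Ct^{\alpha-1}$ for $t\in(0,T]$, with a constant $C$ depending on $u_0$ and $T$. *)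

(* Defs.v *)
From HB Require Import structures.
From mathcomp Require Import all_boot all_order all_algebra.
From mathcomp Require Import all_classical all_reals all_analysis.

Set Implicit Arguments.
Unset Strict Implicit.
Unset Printing Implicit Defensive.
Import Order.TTheory GRing.Theory Num.Theory.
Import numFieldNormedType.Exports.

Local Open Scope classical_set_scope.
Local Open Scope ring_scope.

(* The product sigma-algebra on row vectors, i.e. the Borel one when T = R. *)
Definition rV_display : measure_display -> measure_display.
Proof. exact. Qed.

Section measurable_rV.
Context {d} {T : measurableType d} (n : nat).

Let coord : 'I_n -> 'rV[T]_n -> T := fun i x => x ord0 i.

HB.instance Definition _ := @isMeasurable.Build (rV_display d) 'rV[T]_n
  (g_sigma_preimage coord) (@sigma_algebra0 _ _ _) (@sigma_algebraC _ _)
  (@sigma_algebra_bigcup _ _ _).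

Lemma measurable_coord (i : 'I_n) :
  measurable_fun setT (fun x : 'rV[T]_n => x ord0 i).
Proof.
move=> _ Y mY; rewrite setTI; apply: sub_sigma_algebra => /=.
rewrite -bigcup_seq/=; exists i => /=; first by rewrite mem_index_enum.
by exists Y => //; rewrite setTI.
Qed.

Lemma measurable_fun_rV d' (U : measurableType d') (f : U -> 'rV[T]_n) :
  (forall i, measurable_fun setT (fun x => f x ord0 i)) -> measurable_fun setT f.
Proof.
move=> mf _ A mA; rewrite setTI; move: A mA.
suff : g_sigma_preimage coord `<=` [set A | measurable (f @^-1` A)] by [].
apply: smallest_sub.
  split; first by rewrite /= preimage_set0.
    by move=> A /= mA; rewrite setTD preimage_setC; exact: measurableC.
  by move=> F /= mF; rewrite preimage_bigcup; exact: bigcup_measurable.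
rewrite -bigcup_seq/=; apply: bigcup_sub => i _ _ [B mB <-].
by rewrite setTI /= -[X in measurable X]setTI; exact: mf.
Qed.

End measurable_rV.

Section lebesgue_rV_succ.
Variables (R : realType) (n : nat).
Variable mu : {sigma_finite_measure set 'rV[R]_n -> \bar R}.

Definition rV_cons (p : measurableTypeR R * 'rV[R]_n) : 'rV[R]_n.+1 :=
  row_mx (const_mx p.1 : 'rV_1) p.2.

Let rV_consl p (j : 'I_1) : rV_cons p ord0 (lshift n j) = p.1.
Proof. exact: etrans (row_mxEl _ _ _ _) (mxE _ _ _ _). Qed.

Let rV_consr p (j : 'I_n) : rV_cons p ord0 (rshift 1 j) = p.2 ord0 j.
Proof. exact: row_mxEr. Qed.

Let measurable_rV_cons : measurable_fun setT rV_cons.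
Proof.
apply: measurable_fun_rV => i.
case: (@splitP 1 n i) => j ij.
  rewrite (_ : (fun _ => _) = fst) //; apply/funext => p.
  have -> : i = lshift n j by apply/val_inj.
  exact: rV_consl.
rewrite (_ : (fun _ => _) = (fun x : 'rV[R]_n => x ord0 j) \o snd).
  by apply: measurableT_comp => //; exact: measurable_coord.
apply/funext => p /=.
have -> : i = rshift 1 j by apply/val_inj.
exact: rV_consr.
Qed.

Definition lebesgue_succ : set 'rV[R]_n.+1 -> \bar R :=
  pushforward (lebesgue_measure \x mu)%E rV_cons.

Let lebesgue_succ0 : lebesgue_succ set0 = 0%E.
Proof. by rewrite /lebesgue_succ /pushforward preimage_set0 measure0. Qed.

Let lebesgue_succ_ge0 A : (0 <= lebesgue_succ A)%E.
Proof. exact: measure_ge0. Qed.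

Let lebesgue_succ_sigma_additive : semi_sigma_additive lebesgue_succ.
Proof.
pose m := measure_function_pushforward__canonical__measure_function_Measure
  (lebesgue_measure \x mu)%E measurable_rV_cons.
exact: (@measure_semi_sigma_additive _ _ _ m).
Qed.

HB.instance Definition _ := isMeasure.Build _ _ _ lebesgue_succ
  lebesgue_succ0 lebesgue_succ_ge0 lebesgue_succ_sigma_additive.

Let lebesgue_succ_sigma_finite : sigma_finite setT lebesgue_succ.
Proof.
have /sigma_finiteP[F [TF ndF Foo]] := sigma_finiteT (@lebesgue_measure R).
have /sigma_finiteP[G [TG ndG Goo]] := sigma_finiteT mu.
pose g (y : 'rV[R]_n.+1) : measurableTypeR R * 'rV[R]_n :=
  (y ord0 ord0, \row_j y ord0 (rshift 1 j)).
have mg : measurable_fun setT g.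
  apply/measurable_fun_pairP; split.
    exact: measurable_coord.
  apply: measurable_fun_rV => i /=.
  rewrite (_ : (fun _ => _) = (fun x : 'rV[R]_n.+1 => x ord0 (rshift 1 i))).
    exact: measurable_coord.
  by apply/funext => x; rewrite mxE.
have gK : cancel rV_cons g.
  move=> [a y]; rewrite /g; congr pair.
    have -> : ord0 = lshift n (ord0 : 'I_1) by apply/val_inj.
    exact: rV_consl.
  by apply/rowP => j; rewrite mxE rV_consr.
have mFG k : measurable (F k `*` G k).
  by apply: measurableX; [case: (Foo k)|case: (Goo k)].
exists (fun k => g @^-1` (F k `*` G k)).
  rewrite -preimage_bigcup; apply/esym/seteqP; split=> // y _ /=.
  have : [set: measurableTypeR R] (g y).1 by [].
  rewrite TF => -[k _ Fk].
  have : [set: 'rV[R]_n] (g y).2 by [].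
  rewrite TG => -[l _ Gl].
  exists (maxn k l) => //; split.
    by move: Fk; exact/subsetPset/ndF/leq_maxl.
  by move: Gl; exact/subsetPset/ndG/leq_maxr.
move=> k; split; first by rewrite -[X in measurable X]setTI; exact: mg.
rewrite /lebesgue_succ /pushforward -comp_preimage.
rewrite (_ : g \o rV_cons = id); last exact/funext.
have [? ?] := Foo k; have [? ?] := Goo k.
by rewrite preimage_id product_measure1E// lte_mul_pinfty// ge0_fin_numE.
Qed.

HB.instance Definition _ := Measure_isSigmaFinite.Build _ _ _ lebesgue_succ
  lebesgue_succ_sigma_finite.

End lebesgue_rV_succ.

Fixpoint lebesgue_rV (R : realType) (n : nat) :
    {sigma_finite_measure set 'rV[R]_n -> \bar R} :=
  match n with
  | 0%N => \d_(0 : 'rV[R]_0)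
  | m.+1 => lebesgue_succ (lebesgue_rV R m)
  end.

Definition Gamma {R : realType} (s : R) : R :=
  \int[lebesgue_measure]_(x in `]0, +oo[) (x `^ (s - 1) * expR (- x)).

(* The boundary is described near each of its points x by a C^1 defining
   function rho with Lipschitz gradient that does not vanish at x; this is the
   C^{1,1} regularity under which the Dirichlet problem is H^2-regular. *)
Definition C11_boundary {R : realType} {d : nat} (Om : set 'rV[R]_d) : Prop :=
  forall x, closure Om x -> ~ Om° x ->
  exists U : set 'rV[R]_d, exists rho : 'rV[R]_d -> R,
    [/\ open U /\ U x,
        forall y, U y -> differentiable rho y,
        exists L : R, forall v y z, U y -> U z ->
          `|'D_v rho y - 'D_v rho z| <= L * `|v| * `|y - z|,
        exists v, 'D_v rho x != 0 &
        Om `&` U = [set y | rho y < 0] `&` U].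

Section sobolev.
Context {R : realType} {d : nat}.
Variable Om : set 'rV[R]_d.
Implicit Types (f g phi : 'rV[R]_d -> R) (i j : 'I_d).

Local Notation vol := (lebesgue_rV R d).

(* Elements of function spaces over Om are represented by functions on the whole
   space whose values outside Om, or on a null set, are irrelevant. *)
Definition L2 : set ('rV[R]_d -> R) := [set f | f \_ Om \in Lfun vol 2%:E].

Definition L2norm f : R := fine 'N[vol]_(2%:E)[EFin \o (f \_ Om)].

Definition L2dist f g : R := L2norm (f - g).

Definition pderiv i f : 'rV[R]_d -> R := 'D_(delta_mx ord0 i) f.

Definition test_function phi : Prop :=
  [/\ forall (s : seq 'I_d) x, differentiable (foldr pderiv phi s) x,
      compact (closure [set x | phi x != 0]) &
      closure [set x | phi x != 0] `<=` Om].

Definition is_weak_pderiv i f g : Prop :=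
  L2 g /\ forall phi, test_function phi ->
    \int[vol]_(x in Om) (f x * pderiv i phi x)
    = - \int[vol]_(x in Om) (g x * phi x).

(* A representative of the weak partial derivative, which is a.e. unique. *)
Definition wpderiv i f : 'rV[R]_d -> R :=
  xget (cst 0) [set g | is_weak_pderiv i f g].

Definition H1 : set ('rV[R]_d -> R) :=
  [set f | L2 f /\ forall i, exists g, is_weak_pderiv i f g].

Definition H2 : set ('rV[R]_d -> R) :=
  [set f | H1 f /\ forall i, H1 (wpderiv i f)].

Definition H10 : set ('rV[R]_d -> R) :=
  [set f | H1 f /\ forall e : R, 0 < e -> exists phi,
    [/\ test_function phi, L2dist f phi < e &
        forall i, L2dist (wpderiv i f) (pderiv i phi) < e]].

(* The H^2 norm of f - g: weak derivatives are linear up to null sets. *)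
Definition H2dist f g : R :=
  Num.sqrt (L2dist f g ^+ 2
    + \sum_i L2dist (wpderiv i f) (wpderiv i g) ^+ 2
    + \sum_i \sum_j
        L2dist (wpderiv j (wpderiv i f)) (wpderiv j (wpderiv i g)) ^+ 2).

Definition laplacian f : 'rV[R]_d -> R :=
  fun x => \sum_i wpderiv i (wpderiv i f) x.

End sobolev.

Section curves.
Context {R : realType} {d : nat}.
Variable Om : set 'rV[R]_d.

Local Notation mu := (@lebesgue_measure R).
Local Notation vol := (lebesgue_rV R d).
Local Notation fct := ('rV[R]_d -> R).

Record simple_curve := SimpleCurve {
  sc_size : nat ;
  sc_set : 'I_sc_size -> set (measurableTypeR R) ;
  sc_val : 'I_sc_size -> fct }.

Arguments sc_set : clear implicits.
Arguments sc_val : clear implicits.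

Definition simple_curve_in (X : set fct) (s : simple_curve) : Prop :=
  forall k, measurable (sc_set s k) /\ X (sc_val s k).

Definition sc_fun (s : simple_curve) (t : R) : fct :=
  \sum_k \1_(sc_set s k) t *: sc_val s k.

Definition sc_integral (D : set R) (s : simple_curve) : fct :=
  \sum_k fine (mu (D `&` sc_set s k)) *: sc_val s k.

Definition approximates (X : set fct) (dist : fct -> fct -> R) (D : set R)
    (s : nat -> simple_curve) (F : R -> fct) : Prop :=
  (forall n, simple_curve_in X (s n)) /\
  {ae mu, forall t, D t -> dist (sc_fun (s n) t) (F t) @[n --> \oo] --> 0}.

Definition is_bochner_integral (D : set R) (F : R -> fct) (G : fct) : Prop :=
  L2 Om G /\ exists s : nat -> simple_curve,
    [/\ approximates (L2 Om) (L2dist Om) D s F,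
        (\int[mu]_(t in D) (L2dist Om (sc_fun (s n) t) (F t))%:E)%E
          @[n --> \oo] --> 0%E &
        L2dist Om (sc_integral D (s n)) G @[n --> \oo] --> 0].

(* L^2(D; X), where X is normed by dist _ 0. *)
Definition square_integrable (X : set fct) (dist : fct -> fct -> R)
    (D : set R) (F : R -> fct) : Prop :=
  [/\ {ae mu, forall t, D t -> X (F t)},
      exists s, approximates X dist D s F &
      (\int[mu]_(t in D) (dist (F t) 0 ^+ 2)%:E < +oo)%E].

(* H^alpha(D; L^2(Om)), with the Sobolev-Slobodeckij seminorm. *)
Definition frac_sobolev (alpha : R) (D : set R) (F : R -> fct) : Prop :=
  square_integrable (L2 Om) (L2dist Om) D F /\
  (\int[mu]_(t in D) \int[mu]_(s in D)
     (L2dist Om (F t) (F s) ^+ 2 / `|t - s| `^ (1 + 2 * alpha))%:E < +oo)%E.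

Definition continuous_curve (X : set fct) (dist : fct -> fct -> R)
    (D : set R) (F : R -> fct) : Prop :=
  forall t, D t ->
    X (F t) /\ dist (F s) (F t) @[s --> within D (nbhs t)] --> 0.

Definition holder_curve (alpha : R) (D : set R) (F : R -> fct) : Prop :=
  (forall t, D t -> L2 Om (F t)) /\
  exists K : R, forall s t, D s -> D t ->
    L2dist Om (F t) (F s) <= K * `|t - s| `^ alpha.

Definition is_time_derivative (D : set R) (F V : R -> fct) : Prop :=
  forall t, D t ->
    L2dist Om ((s - t)^-1 *: (F s - F t)) (V t) @[s --> within D t^'] --> 0.

(* G is the Caputo derivative of order alpha at time t of a curve whose time
   derivative is V. *)
Definition is_caputo (alpha : R) (V : R -> fct) (t : R) (G : fct) : Prop :=
  exists2 I,
    is_bochner_integral `]0, t[ (fun tau => (t - tau) `^ (- alpha) *: V tau) I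
    & G = (Gamma (1 - alpha))^-1 *: I.

Definition essentially_bounded (D : set R) (F : R -> fct) : Prop :=
  (fun p : measurableTypeR R * 'rV[R]_d => F p.1 p.2) \_ (D `*` Om)
    \in Lfun (mu \x vol)%E +oo%E.

End curves.

Section allen_cahn.
Context {R : realType} {d : nat}.
Variables (Om : set 'rV[R]_d) (gamma eps : R).

Local Notation mu := (@lebesgue_measure R).
Local Notation vol := (lebesgue_rV R d).
Local Notation fct := ('rV[R]_d -> R).

Definition reaction (s : R) : R := s ^+ 3 - s.

(* V is the time derivative of u and G its Caputo derivative; G 0 is the limit
   of the Caputo derivative at 0. *)
Record solves (u0 : fct) (alpha T : R) (u V G : R -> fct) : Prop := {
  solves_init : {ae vol, forall x, Om x -> u 0 x = u0 x} ;
  solves_time_derivative : is_time_derivative Om `]0, T] u V ;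
  solves_caputo : forall t, 0 < t <= T -> is_caputo Om alpha V t (G t) ;
  solves_eq : forall t, 0 < t <= T -> {ae vol, forall x, Om x ->
    G t x = gamma * (eps ^+ 2 * laplacian Om (u t) x - reaction (u t x))} ;
  solves_frac_sobolev : frac_sobolev Om alpha `]0, T[ u ;
  solves_square_integrable :
    square_integrable (H2 Om `&` H10 Om) (H2dist Om) `]0, T[ u ;
  solves_bounded : essentially_bounded Om `]0, T[ u ;
  solves_holder : holder_curve Om alpha `[0, T] u ;
  solves_continuous :
    continuous_curve (H2 Om `&` H10 Om) (H2dist Om) `[0, T] u ;
  solves_continuous_caputo :
    continuous_curve (L2 Om) (L2dist Om) `[0, T] G ;
  solves_continuous_derivative :
    continuous_curve (L2 Om) (L2dist Om) `]0, T] V ;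
  solves_derivative_bound : exists C : R, forall t, 0 < t <= T ->
    L2norm Om (V t) <= C * t `^ (alpha - 1) }.

Definition global_bounded_solution (u0 : fct) (alpha : R) (u : R -> fct) :
    Prop :=
  (forall T : R, 0 < T -> exists V G, solves u0 alpha T u V G) /\
  essentially_bounded Om `]0, +oo[ u.

Definition steady_state (w : fct) : Prop :=
  [/\ H2 Om w, H10 Om w &
      {ae vol, forall x, Om x ->
        gamma * (eps ^+ 2 * laplacian Om w x - reaction (w x)) = 0}].

Definition energy (u : R -> fct) (t : R) : R :=
  \int[vol]_(x in Om)
    (eps ^+ 2 / 2 * (\sum_i wpderiv Om i (u t) x ^+ 2)
     + 4^-1 * (u t x ^+ 2 - 1) ^+ 2).

Definition modified_energy (alpha : R) (u : R -> fct) (t : R) : R :=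
  energy u t + (gamma * Gamma (1 - alpha))^-1 *
    (L2dist Om (u t) (u 0) ^+ 2 / (2 * t `^ alpha)
     + alpha / 2 * \int[mu]_(tau in `]0, t[)
         (L2dist Om (u t) (u tau) ^+ 2 / (t - tau) `^ (alpha + 1))).

End allen_cahn.

(* Main.v *)
From HB Require Import structures.
Require Import Defs.
From mathcomp Require Import all_boot all_order all_algebra.
From mathcomp Require Import all_classical all_reals all_analysis.
From mathcomp Require Import measurable_realfun ess_sup_inf.
From mathcomp Require Import ring lra.
Import Order.TTheory GRing.Theory Num.Theory.
Import numFieldNormedType.Exports.

Local Open Scope classical_set_scope.
Local Open Scope ring_scope.

(** Let A(u) = - eps^2 Lap u + f(u) be the L2 gradient of the free energy E, let
    K(r) = r^(- a - 1) for an order a in (0, 1), and let a solution u keep its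
    initial value at negative times. Integration by parts in time turns the
    Caputo derivative into a Marchaud derivative: for t > 0 and every v in L2,

      - gamma (A(u(t)), v) = a / Gamma(1 - a) * int_0^oo (u(t) - u(t - r), v) K(r) dr.

    The two memory terms of the modified energy are, in the same way, the two
    parts, r < t and r > t, of a single integral:

      gamma (Emod - E)(t) = D(t) := a / (2 Gamma(1 - a)) * int_0^oo |u(t) - u(t - r)|^2 K(r) dr.

    This is the content of [solution_evolution] and [modified_energyE]. The three
    claims thus say that the dissipation D is small in three regimes, and that E
    is continuous at time 0. Of the energy they use one property, the
    semiconvexity [free_energy_semiconvex]: as f' >= -1,

      E(w) - E(u) >= (A(u), w - u) - |w - u|^2 / 2.

    Initial time. Hölder continuity of exponent a gives D(t) = O(t^a), and
    semiconvexity from u(0) to u(t) and back gives E(t) - E(0) = O(t^a), because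
    A(u(t)) stays bounded in L2 near time 0.

    Long time. Testing the equation with u(t) - u(s) shows that the modified energy
    is nonincreasing ([modified_energy_nonincreasing]); testing it with u(t) - w
    gives, for y(t) = |u(t) - w|^2 and the Marchaud integral M of order a, the
    evolution variational inequality

      D + gamma (E - E(w)) <= gamma / 2 * y - a / (2 Gamma(1 - a)) * M y.

    Let w be the steady state that u approaches, so that y tends to 0. As y is
    bounded, every long time interval contains a time s at which M y is almost
    nonnegative: a maximum of y plus a gentle ramp ([sloped_argmax]). At s the
    modified energy is hardly above E(w), and by monotonicity it stays so. Since w
    is critical, E(t) >= E(w) - y(t) / 2, and D(t) is what remains.

    Order tending to 1. If u is Hölder continuous of exponent a on [0, t] with
    constant C, then D(t) <= C^2 t^a / Gamma(1 - a), and 1 / Gamma(1 - a) is of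
    order 1 - a; so it suffices to bound C independently of a. The norms z of
    u - u(0) and of the increments u - u(. - h) satisfy M z <= g (z + b) with
    (1 - a) g bounded, by semiconvexity and the Cauchy-Schwarz inequality
    ([marchaud_norm_le]). The maximum principle for M provides barriers: an
    exponential bound for z ([exp_barrier]) and a bound by a multiple of t^a
    ([power_barrier]). They give |u(t) - u(0)| <= C t^a first, then
    |u(t) - u(t - h)| <= C h^a, with constants that depend on gamma, t and the norm of
    A(u(0)) only ([increment_holder]). *)

(** * Integrals of powers on half-lines *)

Section reflection.
Context {R : realType}.
Local Notation mu := (@lebesgue_measure R).
Implicit Types (t : R) (D : set R).

Definition reflect_at t : measurableTypeR R -> measurableTypeR R :=
  fun r => t - r.

Lemma measurable_reflect_at t : measurable_fun setT (reflect_at t).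
Proof.
have : measurable_fun [set: R] (fun r : R => t - r).
  by apply: measurable_realfun.measurable_funB; [exact: measurable_cst|exact: measurable_id].
exact.
Qed.

HB.instance Definition _ t :=
  isMeasurableFun.Build _ _ _ _ _ (measurable_reflect_at t).

Lemma lebesgue_measure_reflect t (A : set R) : measurable A ->
  pushforward mu (reflect_at t) A = mu A.
Proof.
move=> mA; apply/esym/lebesgue_measure_unique => //= _ [[a b]] _ <-.
rewrite /pushforward.
rewrite (_ : reflect_at t @^-1` _ = `[t - b, t - a[%classic); last first.
  by apply/seteqP; split => x /=; rewrite !in_itv/= /reflect_at; lra.
rewrite !lebesgue_measure_itv/= !lte_fin ltrD2l ltrN2 -!EFinB.
by case: ifPn => // _; congr (_%:E); lra.
Qed.

(** The change of variables r = t - x, which exchanges the time x and the time r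
    elapsed since x. *)
Lemma integral_reflect t D (f : R -> \bar R) : measurable D ->
  measurable_fun D f ->
  (\int[mu]_(x in D) f x = \int[mu]_(r in [set r | D (t - r)%R]) f (t - r)%R)%E.
Proof.
move=> mD mf.
have ge0E (g : R -> \bar R) : measurable_fun D g -> (forall x, (0 <= g x)%E) ->
    (\int[mu]_(x in D) g x = \int[mu]_(r in [set r | D (t - r)%R]) g (t - r)%R)%E.
  move=> mg g0.
  rewrite -(@ge0_integral_pushforward _ _ _ _ _ _ (measurable_reflect_at t) mu D g)//.
  by apply: eq_measure_integral => A mA _; exact/esym/lebesgue_measure_reflect.
rewrite integralE [RHS]integralE; congr (_ - _)%E.
- by rewrite (ge0E _ (measurable_funepos mf))//; apply: eq_integral => r _; rewrite !funeposE.
- by rewrite (ge0E _ (measurable_funeneg mf))//; apply: eq_integral => r _; rewrite !funenegE.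
Qed.

End reflection.

Section open_interval_FTC.
Context {R : realType}.
Local Notation mu := (@lebesgue_measure R).
Variables (f F : R -> R) (a b la lb : R).
Hypotheses (ab : a < b)
  (cf : forall x, a < x < b -> {for x, continuous f})
  (dF : forall x, a < x < b -> is_derive x 1 F (f x))
  (Fa : F x @[x --> a^'+] --> la) (Fb : F x @[x --> b^'-] --> lb).

(* at most a third of b - a, so that I n is not empty *)
Let h n : R := (b - a) / n.+3%:R.
Let I n : set R := `[a + h n, b - h n].

Let h_gt0 n : 0 < h n.
Proof. by rewrite divr_gt0// subr_gt0. Qed.

Let h_lt n : a + h n < b - h n.
Proof.
have : h n * n.+3%:R = b - a by rewrite /h divfK// pnatr_eq0.
have := h_gt0 n; rewrite -natr1 -natr1 -natr1; have : 0 <= n%:R :> R by [].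
nra.
Qed.

Let h_nincr n m : (n <= m)%N -> h m <= h n.
Proof.
move=> nm; rewrite /h ler_wpM2l ?subr_ge0 ?(ltW ab)// lef_pV2 ?posrE//.
by rewrite ler_nat.
Qed.

Let h_cvg : h n @[n --> \oo] --> (0 : R).
Proof.
rewrite -(mulr0 (b - a)); apply: cvgM; first exact: cvg_cst.
have := @cvg_harmonic R; rewrite -(cvg_shiftn 2)/=.
by apply: cvg_trans; apply: near_eq_cvg; near=> n; rewrite /= addn2.
Unshelve. all: by end_near. Qed.

Let I_sub n : I n `<=` `]a, b[.
Proof.
move=> x; rewrite /I/= !in_itv/= => /andP[ax xb].
by have := h_gt0 n; lra.
Qed.

Let I_cover : \bigcup_n I n = `]a, b[%classic.
Proof.
apply/seteqP; split=> [x [n _]|x]; first exact: I_sub.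
rewrite /= in_itv/= => /andP[ax xb].
have e0 : 0 < Num.min (x - a) (b - x) by rewrite lt_min !subr_gt0 ax.
have /cvgrPdist_lt/(_ _ e0)[n _ /(_ n (leqnn n))] := h_cvg.
rewrite sub0r normrN gtr0_norm// lt_min => /andP[h1 h2].
by exists n => //; rewrite /I/= in_itv/=; lra.
Qed.

Let I_incr : {homo I : n m / (n <= m)%N >-> (n <= m)%O}.
Proof.
move=> n m /h_nincr hnm; rewrite subsetEset => x; rewrite /I/= !in_itv/=.
lra.
Qed.

Let I_FTC n : (\int[mu]_(x in I n) (f x)%:E = (F (b - h n) - F (a + h n))%:E)%E.
Proof.
have sub x : x \in `[a + h n, b - h n] -> a < x < b.
  by move=> /I_sub; rewrite /= in_itv.
have ends : a < a + h n < b /\ a < b - h n < b.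
  by have := h_gt0 n; have := h_lt n; lra.
have cF x : a < x < b -> {for x, continuous F}.
  move=> xab; apply: differentiable_continuous.
  by apply/derivable1_diffP; apply: ex_derive; exact: dF.
rewrite (@continuous_FTC2 R f F)//.
- by apply: continuous_in_subspaceT => x /set_mem /sub; exact: cf.
- split.
  + move=> x /subset_itv_oo_cc /sub xab; exact: (ex_derive (is_derive := dF _ xab)).
  + by apply: cvg_at_right_filter; apply: cF; case: ends.
  + by apply: cvg_at_left_filter; apply: cF; case: ends.
- move=> x /subset_itv_oo_cc /sub xab; rewrite derive1E.
  exact: (derive_val (is_derive := dF _ xab)).
Qed.

Let I_lim : (F (b - h n) - F (a + h n)) @[n --> \oo] --> lb - la.
Proof.
apply: cvgB.
- move/cvg_at_leftP : Fb; apply; split=> [n|]; first by have := h_gt0 n; lra.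
  by rewrite -[X in _ --> X]subr0; apply: cvgB => //; exact: cvg_cst.
- move/cvg_at_rightP : Fa; apply; split=> [n|]; first by have := h_gt0 n; lra.
  by rewrite -[X in _ --> X]addr0; apply: cvgD => //; exact: cvg_cst.
Qed.

Let mf : measurable_fun `]a, b[ f.
Proof.
apply: open_continuous_measurable_fun; first exact: interval_open.
by move=> x /set_mem; rewrite /= in_itv/=; exact: cf.
Qed.

(** The compact intervals [I n] exhaust the open one, so the integrand may be
    singular at both ends, as powers of exponent in (-1, 0) are at 0. *)
Lemma ge0_FTC_oo : (forall x, a < x < b -> 0 <= f x) ->
  (\int[mu]_(x in `]a, b[) (f x)%:E = (lb - la)%:E)%E.
Proof.
move=> f0.
have : (\int[mu]_(x in I i) (f x)%:E)%E @[i --> \oo] -->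
    (\int[mu]_(x in \bigcup_i I i) (f x)%:E)%E.
  apply: ge0_nondecreasing_set_cvg_integral => //.
  - by move=> i; exact: measurable_itv.
  - by move=> i; apply/measurable_EFinP; apply: measurable_funS mf => //; exact: I_sub.
  - by move=> i x /I_sub; rewrite /= in_itv/= lee_fin; exact: f0.
rewrite I_cover; under eq_fun do rewrite I_FTC.
move=> h1; apply: (cvg_unique _ h1); [exact: ereal_hausdorff|apply: cvg_EFin; [exact: nearW|exact: I_lim]].
Qed.

(** Same exhaustion for an integrand without sign, by dominated convergence. *)
Lemma FTC_oo : mu.-integrable `]a, b[ (EFin \o f) ->
  \int[mu]_(x in `]a, b[) f x = lb - la.
Proof.
move=> intf.
have mI n : measurable (I n) by exact: measurable_itv.
pose f_ n := ((EFin \o f) \_ (I n)).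
have mf_ n : measurable_fun `]a, b[ (f_ n).
  apply: measurable_funTS; apply/(measurable_restrictT _ (mI n)).
  by apply/measurable_EFinP; apply: measurable_funS mf => //; exact: I_sub.
have mfE : measurable_fun `]a, b[ (EFin \o f) by exact/measurable_EFinP.
have f_f : {ae mu, forall x, `]a, b[%classic x ->
    f_ n x @[n --> \oo] --> (EFin \o f) x}.
  apply: aeW => x; rewrite -I_cover => -[N _ IN].
  apply: cvg_near_cst; near=> n; rewrite /f_ patchE mem_set//.
  have /subsetPset IE : (I N <= I n)%O.
    by apply: I_incr; near: n; exact: nbhs_infty_ge.
  exact: IE.
have f_g : {ae mu, forall x n, `]a, b[%classic x ->
    (`|f_ n x| <= (abse \o (EFin \o f)) x)%E}.
  apply: aeW => x n _; rewrite /f_ patchE; case: ifPn => //= _.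
  by rewrite normr0 lee_fin normr_ge0.
have [_ _] := @dominated_convergence _ (measurableTypeR R) R mu _ (measurable_itv _) f_
  (EFin \o f) (abse \o (EFin \o f)) mf_ mfE f_f
  (integrable_abse intf) f_g.
rewrite /f_ /=; under eq_fun do rewrite -integral_mkcondr.
have IE n : `]a, b[ `&` I n = I n by rewrite setIidr//; exact: I_sub.
under eq_fun do rewrite IE I_FTC.
move=> h1; rewrite /Rintegral.
have h2 : ((F (b - h n) - F (a + h n))%:E)%E @[n --> \oo] --> (lb - la)%:E.
  by apply: cvg_EFin; [exact: nearW|exact: I_lim].
by rewrite (cvg_unique _ h1 h2).
Unshelve. all: by end_near. Qed.

End open_interval_FTC.

Section power_integrals.
Context {R : realType}.
Local Notation mu := (@lebesgue_measure R).
Implicit Types (a b x p : R).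

Lemma continuous_powR p x : 0 < x -> {for x, continuous (fun y : R => y `^ p)}.
Proof.
move=> x0; apply: differentiable_continuous; apply/derivable1_diffP.
exact: (ex_derive (is_derive := is_derive1_powR _ x0)).
Qed.

Lemma powR_anti p x y : p <= 0 -> 0 < x -> x <= y -> y `^ p <= x `^ p.
Proof.
move=> p0 x0 xy; have y0 := lt_le_trans x0 xy.
rewrite -[p]opprK !(powRN _ (- p)) lef_pV2 ?posrE ?powR_gt0//.
by rewrite ge0_ler_powR ?nnegrE ?oppr_ge0 ?(ltW x0) ?(ltW y0).
Qed.

Lemma is_derive_powR_div p x : p != 0 -> 0 < x ->
  is_derive x 1 (fun y : R => y `^ p / p) (x `^ (p - 1)).
Proof.
move=> p0 x0; have dp := is_derive1_powR p x0.
rewrite (_ : (fun y => _) = p^-1 *: (fun y : R => y `^ p)); last first.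
  by apply/funext => y; rewrite /= mulrC.
by apply: is_derive_eq; rewrite /= /GRing.scale/= mulKf.
Qed.

Lemma integral_powR_0 a b : 0 < a -> 0 < b ->
  (\int[mu]_(r in `]0%R, b[) (r `^ (a - 1))%:E = (b `^ a / a)%:E)%E.
Proof.
move=> a0 b0.
have dF x : 0 < x < b -> is_derive x 1 (fun y : R => y `^ a / a) (x `^ (a - 1)).
  by move=> /andP[x0 _]; apply: is_derive_powR_div => //; rewrite gt_eqF.
rewrite -[in RHS](subr0 (b `^ a / a)); apply: (ge0_FTC_oo _ _ _ _ _ _ b0 _ dF).
- by move=> x /andP[x0 _]; exact: continuous_powR.
- rewrite -[X in _ --> X](mul0r a^-1); apply: cvgM; last exact: cvg_cst.
  exact: (powR_cvg0 a0).
- apply: cvgM; last exact: cvg_cst.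
  by apply: cvg_at_left_filter; exact: continuous_powR.
- by move=> x _; exact: powR_ge0.
Qed.

Lemma integral_powR_y a b : 0 < a -> 0 < b ->
  (\int[mu]_(r in `]b, +oo[) (r `^ (- (a + 1)))%:E = (b `^ (- a) / a)%:E)%E.
Proof.
move=> a0 b0.
have c x : 0 < x -> {for x, continuous (fun r : R => r `^ (- (a + 1)))}.
  exact: continuous_powR.
rewrite integral_itv_obnd_cbnd; last first.
  apply/measurable_EFinP; apply: open_continuous_measurable_fun => //.
  by move=> x /set_mem; rewrite /= in_itv/= andbT => bx; apply: c; exact: lt_trans bx.
have dF x : b <= x -> is_derive x 1 (fun y : R => y `^ (- a) / - a) (x `^ (- (a + 1))).
  move=> bx; rewrite opprD; apply: is_derive_powR_div; last exact: lt_le_trans bx.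
  by rewrite oppr_eq0 gt_eqF.
rewrite (@ge0_continuous_FTC2y R _ (fun y : R => y `^ (- a) / - a) b 0)//.
- by rewrite -EFinB sub0r invrN mulrN opprK.
- by move=> x _; exact: powR_ge0.
- apply: continuous_in_subspaceT => x /set_mem; rewrite /= in_itv/= andbT => bx.
  by apply: c; exact: lt_le_trans bx.
- rewrite -[X in _ --> X](mul0r (- a)^-1); apply: cvgM; last exact: cvg_cst.
  under eq_fun do rewrite powRN.
  apply/cvgrPdist_lt => e e0; near=> x.
  have x0 : 0 < x by near: x; exact: nbhs_pinfty_gt.
  rewrite sub0r normrN gtr0_norm ?invr_gt0 ?powR_gt0// invf_plt ?posrE ?powR_gt0//.
  have E : (e^-1 `^ a^-1) `^ a = e^-1.
    by rewrite -powRrM mulVf ?gt_eqF// powRr1// invr_ge0 ltW.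
  have xE : e^-1 `^ a^-1 < x.
    by near: x; apply: nbhs_pinfty_gt; exact: num_real.
  by rewrite -E gt0_ltr_powR// ?nnegrE ?powR_ge0 ?ltW.
- by move=> x bx; apply: ex_derive; apply: dF; exact: ltW.
- apply: cvg_at_right_filter; apply: cvgM; last exact: cvg_cst.
  exact: continuous_powR.
- move=> x; rewrite in_itv/= andbT => bx; rewrite derive1E.
  by apply: derive_val; apply: dF; exact: ltW.
Unshelve. all: by end_near. Qed.

End power_integrals.

(** * The Gamma function near 0 *)

Lemma measurable_powR_EFin {R : realType} (p : R) (D : set R) :
  measurable_fun D (fun r : R => (r `^ p)%:E).
Proof.
by apply/measurable_EFinP; apply: measurable_funTS; exact: measurable_powR.
Qed.

Section Gamma_near_0.
Context {R : realType}.
Local Notation mu := (@lebesgue_measure R).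
Variable s : R.
Hypothesis s01 : 0 < s < 1.

Let g (x : R) := x `^ (s - 1) * expR (- x).

Let g_ge0 x : 0 <= g x.
Proof. by rewrite mulr_ge0 ?powR_ge0 ?expR_ge0. Qed.

Let mg (D : set R) : measurable_fun D g.
Proof.
apply: measurable_funTS; apply: measurable_funM; first exact: measurable_powR.
by apply: measurableT_comp => //; exact: measurable_funN.
Qed.

Let mE (D : set R) : measurable_fun D (fun x => (g x)%:E).
Proof. by apply/measurable_EFinP; exact: mg. Qed.

Let g_split : (\int[mu]_(x in `]0%R, +oo[) (g x)%:E =
  \int[mu]_(x in `]0%R, 1%R[) (g x)%:E + \int[mu]_(x in `]1%R, +oo[) (g x)%:E)%E.
Proof.
rewrite (@itv_bndbnd_setU _ _ _ (BLeft 1%R)) ?bnd_simp//.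
rewrite ge0_integral_setU//=.
- by congr (_ + _)%E; rewrite -integral_itv_obnd_cbnd.
- exact: mE.
- by move=> x _; rewrite lee_fin.
- apply/disj_setPS => x []/=; rewrite !in_itv/= => /andP[_ x1].
  by rewrite andbT leNgt x1.
Qed.

Let pow01 : (\int[mu]_(r in `]0%R, 1%R[) (r `^ (s - 1))%:E = (s^-1)%:E)%E.
Proof. by rewrite integral_powR_0 ?powR1 ?div1r//; case/andP: s01. Qed.

Let g_le0 : (\int[mu]_(x in `]0%R, 1%R[) (g x)%:E <= (s^-1)%:E)%E.
Proof.
rewrite -pow01.
apply: ge0_le_integral => //.
- by move=> x _; rewrite lee_fin.
- exact: mE.
- exact: measurable_powR_EFin.
- move=> x; rewrite /= in_itv/= lee_fin => /andP[x0 _].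
  by rewrite /g ler_piMr ?powR_ge0// expR_le1; lra.
Qed.

Let g_ge : ((expR (-1) / s)%:E <= \int[mu]_(x in `]0%R, 1%R[) (g x)%:E)%E.
Proof.
rewrite EFinM -pow01.
rewrite -ge0_integralZl ?lee_fin ?expR_ge0//; last 2 first.
- exact: measurable_powR_EFin.
- by move=> x _; rewrite lee_fin powR_ge0.
apply: ge0_le_integral => //.
- by move=> x _; rewrite -EFinM lee_fin mulr_ge0 ?expR_ge0 ?powR_ge0.
- by apply: measurable_funeM; exact: measurable_powR_EFin.
- exact: mE.
- move=> x; rewrite /= in_itv/= -EFinM lee_fin => /andP[x0 x1].
  by rewrite /g mulrC ler_wpM2l ?powR_ge0// ler_expR; lra.
Qed.

Let g_ley : (\int[mu]_(x in `]1%R, +oo[) (g x)%:E <= 4%:E)%E.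
Proof.
have h4 : (4%:E * \int[mu]_(r in `]1%R, +oo[) (r `^ (- (1 + 1)))%:E = 4%:E)%E.
  by rewrite integral_powR_y// powR1 divr1 mule1.
rewrite -h4 -ge0_integralZl//; last 2 first.
- exact: measurable_powR_EFin.
- by move=> x _; rewrite lee_fin powR_ge0.
apply: ge0_le_integral => //.
- by move=> x _; rewrite lee_fin.
- exact: mE.
- by apply: measurable_funeM; exact: measurable_powR_EFin.
- move=> x; rewrite /= in_itv/= andbT -EFinM lee_fin => x1.
  have x0 : 0 < x by lra.
  have p1 : x `^ (s - 1) <= 1.
    rewrite -[leRHS](@powRr0 R x); apply: ler_powR; first exact: ltW.
    by case/andP: s01; lra.
  apply: (le_trans (ler_wpM2r (expR_ge0 _) p1)); rewrite mul1r.
  have -> : x `^ (- (1 + 1)) = (x ^+ 2)^-1.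
    by rewrite powRN (_ : 1 + 1 = 2%:R) ?powR_mulrn ?ltW.
  have e2 : expR x = expR (x / 2) ^+ 2.
    by rewrite expr2 -expRD; congr expR; lra.
  have e1 := expR_ge1Dx (x / 2).
  rewrite expRN -invf_div lef_pV2 ?posrE ?expR_gt0 ?divr_gt0 ?exprn_gt0//.
  by rewrite e2; nra.
Qed.

Let g_fin : (\int[mu]_(x in `]0%R, +oo[) (g x)%:E \is a fin_num)%E.
Proof.
rewrite ge0_fin_numE; last by apply: integral_ge0 => x _; rewrite lee_fin.
by rewrite g_split; apply: (@le_lt_trans _ _ ((s^-1)%:E + 4%:E)%E); [exact: leeD|exact: ltry].
Qed.

(** The singular part x^(s - 1) of the integrand, integrated over (0, 1), is 1 /
    s, and the exponential lies between e^(-1) and 1 there. As s tends to 0 this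
    is the exact order of growth. *)
Lemma Gamma_ge : expR (-1) / s <= Gamma s.
Proof.
rewrite /Gamma /Rintegral -lee_fin fineK//; apply: (le_trans g_ge).
rewrite g_split leeDl//; apply: integral_ge0 => x _.
by rewrite lee_fin.
Qed.

(** On (1, oo) the integrand is at most 4 / x^2, as e^x >= (1 + x / 2)^2. *)
Lemma Gamma_le : Gamma s <= s^-1 + 4.
Proof.
rewrite /Gamma /Rintegral -lee_fin fineK// EFinD -/g g_split.
exact: leeD.
Qed.

Lemma Gamma_gt0 : 0 < Gamma s.
Proof.
apply: lt_le_trans Gamma_ge; rewrite divr_gt0 ?expR_gt0//; by case/andP: s01.
Qed.

End Gamma_near_0.

(** * Integrals against the singular kernel *)

Section memory.
Context {R : realType}.
Local Notation mu := (@lebesgue_measure R).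
Variable a : R.
Hypothesis a01 : 0 < a < 1.

(** The kernel of the Marchaud derivative of order a. *)
Definition ker (r : R) : R := r `^ (- (a + 1)).

Definition memory (h : R -> R) : R := \int[mu]_(r in `]0, +oo[) (h r * ker r).

(** The size of an increment r |-> q t - q (t - r) of a bounded function q that
    is Lipschitz near t. The factor r compensates the singularity of the kernel
    at 0, and the bound 1 makes the integral converge at infinity. *)
Definition tame (h : R -> R) : Prop :=
  measurable_fun setT h /\
  exists C, forall r, 0 < r -> `|h r| <= C * Num.min 1 r.

Let a0 : 0 < a. Proof. by case/andP: a01. Qed.
Let a1 : 0 < 1 - a. Proof. by case/andP: a01; lra. Qed.

Lemma ker_ge0 r : 0 <= ker r.
Proof. exact: powR_ge0. Qed.

Lemma measurable_ker : measurable_fun setT ker.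
Proof. exact: measurable_powR. Qed.

Lemma ker_anti r r' : 0 < r -> r <= r' -> ker r' <= ker r.
Proof.
by move=> r0 rr'; apply: powR_anti => //; rewrite oppr_le0 addr_ge0// ltW.
Qed.

Lemma mulr_ker r : 0 < r -> r * ker r = r `^ ((1 - a) - 1).
Proof.
move=> r0; rewrite -[X in X * _]powRr1 ?ltW// /ker -powRD; last first.
  by rewrite (gt_eqF r0) implybT.
by congr (_ `^ _); lra.
Qed.

Let mE (h : R -> R) (D : set R) : measurable_fun setT h ->
  measurable_fun D (fun r => (h r * ker r)%:E).
Proof.
move=> mh; apply/measurable_EFinP; apply: measurable_funTS.
by apply: measurable_funM => //; exact: measurable_ker.
Qed.

Lemma measurable_cap (L : R) : measurable_fun setT (fun r : R => Num.min 1 (r / L)).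
Proof.
apply: measurable_minr => //; apply: measurable_funM => //.
Qed.

Lemma memory_split (h : R -> R) (b : R) : 0 < b -> measurable_fun setT h ->
  (forall r, 0 < r -> 0 <= h r) ->
  (\int[mu]_(r in `]0%R, +oo[) (h r * ker r)%:E =
   \int[mu]_(r in `]0%R, b[) (h r * ker r)%:E +
   \int[mu]_(r in `]b, +oo[) (h r * ker r)%:E)%E.
Proof.
move=> b0 mh h0.
rewrite (@itv_bndbnd_setU _ _ _ (BLeft b)) ?bnd_simp//.
rewrite ge0_integral_setU//=.
- by congr (_ + _)%E; rewrite -integral_itv_obnd_cbnd//; exact: mE.
- exact: mE.
- move=> r /= rb; rewrite lee_fin mulr_ge0 ?ker_ge0// h0//.
  case: rb; rewrite in_itv/= ?andbT; first by case/andP.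
  exact: lt_le_trans.
- apply/disj_setPS => x []/=; rewrite !in_itv/= => /andP[_ x1].
  by rewrite andbT leNgt x1.
Qed.

Lemma integral_linear_ker (k b : R) : 0 <= k -> 0 < b ->
  (\int[mu]_(r in `]0%R, b[) ((k * r) * ker r)%:E
   = (k * (b `^ (1 - a) / (1 - a)))%:E)%E.
Proof.
move=> k0 b0; rewrite [RHS]EFinM -integral_powR_0// -ge0_integralZl ?lee_fin//; last 2 first.
- exact: measurable_powR_EFin.
- by move=> x _; rewrite lee_fin powR_ge0.
apply: eq_integral => r /set_mem/=; rewrite in_itv/= => /andP[r0 _].
by rewrite -EFinM -mulrA mulr_ker.
Qed.

Lemma integral_const_ker (k b : R) : 0 <= k -> 0 < b ->
  (\int[mu]_(r in `]b, +oo[) (k * ker r)%:E = (k * (b `^ (- a) / a))%:E)%E.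
Proof.
move=> k0 b0; rewrite [RHS]EFinM -integral_powR_y// -ge0_integralZl ?lee_fin//; last 2 first.
- exact: measurable_powR_EFin.
- by move=> x _; rewrite lee_fin powR_ge0.
Qed.

Lemma integral_cap_ker (L : R) : 0 < L ->
  (\int[mu]_(r in `]0%R, +oo[) (Num.min 1 (r / L) * ker r)%:E
   = (L `^ (- a) * ((1 - a)^-1 + a^-1))%:E)%E.
Proof.
move=> L0; rewrite (memory_split _ _ L0); last 2 first.
- exact: measurable_cap.
- by move=> r r0; rewrite le_min ler01 divr_ge0 ?ltW.
rewrite mulrDr EFinD; congr (_ + _)%E.
- transitivity (\int[mu]_(r in `]0%R, L[) ((L^-1 * r) * ker r)%:E)%E.
    apply: eq_integral => r /set_mem/=; rewrite in_itv/= => /andP[r0 rL].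
    have rL1 : r / L <= 1 by rewrite ler_pdivrMr ?mul1r// ltW.
    by rewrite (min_r rL1) [L^-1 * r]mulrC.
  rewrite integral_linear_ker ?invr_ge0 ?ltW//; congr (_%:E); rewrite mulrA; congr (_ / _).
  rewrite -[X in X^-1](powRr1 (ltW L0)) -powRN -powRD; last by rewrite (gt_eqF L0) implybT.
  by congr (_ `^ _); lra.
- rewrite -[X in X * _^-1]mul1r -mulrA -integral_const_ker//.
  apply: eq_integral => r /set_mem/=; rewrite in_itv/= andbT => rL.
  have rL1 : 1 <= r / L by rewrite ler_pdivlMr ?mul1r// ltW.
  by rewrite (min_l rL1) mul1r.
Qed.

Lemma tame_integrable h : tame h ->
  mu.-integrable `]0, +oo[ (EFin \o (fun r => h r * ker r)).
Proof.
move=> [mh [C hC]]; apply/integrableP; split; first exact: mE.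
pose C' := Num.max C 0.
have C'0 : 0 <= C' by rewrite le_max lexx orbT.
apply: (@le_lt_trans _ _ (C'%:E *
    \int[mu]_(r in `]0%R, +oo[) (Num.min 1 (r / 1) * ker r)%:E)%E).
  rewrite -ge0_integralZl ?lee_fin//; last 2 first.
  - by apply: mE; exact: measurable_cap.
  - move=> r /=; rewrite in_itv/= andbT => r0; rewrite lee_fin mulr_ge0 ?ker_ge0//.
    by rewrite divr1 le_min ler01 ltW.
  apply: ge0_le_integral => //.
  - by apply: measurableT_comp => //; exact: mE.
  - by apply: measurable_funeM; apply: mE; exact: measurable_cap.
  - move=> r /=; rewrite in_itv/= andbT => r0.
    rewrite -EFinM lee_fin normrM (ger0_norm (ker_ge0 _)) mulrA ler_wpM2r ?ker_ge0//.
    rewrite divr1 (le_trans (hC _ r0))// ler_wpM2r ?le_min ?ler01 ?(ltW r0)//.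
    by rewrite /C' le_max lexx.
by rewrite integral_cap_ker// -EFinM ltry.
Qed.

Lemma tameD h k : tame h -> tame k -> tame (fun r => h r + k r).
Proof.
move=> [mh [C hC]] [mk [C' kC]]; split; first exact: measurable_funD.
exists (C + C') => r r0; rewrite mulrDl.
by rewrite (le_trans (ler_normD _ _))// lerD ?hC ?kC.
Qed.

Lemma tameZ c h : tame h -> tame (fun r => c * h r).
Proof.
move=> [mh [C hC]]; split; first exact: measurable_funM.
by exists (`|c| * C) => r r0; rewrite normrM -mulrA ler_wpM2l ?hC.
Qed.

Lemma memoryD h k : tame h -> tame k ->
  memory (fun r => h r + k r) = memory h + memory k.
Proof.
move=> th tk; rewrite /memory -RintegralD//; try exact: tame_integrable.
by apply: eq_Rintegral => r _; rewrite mulrDl.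
Qed.

Lemma memoryZ c h : tame h -> memory (fun r => c * h r) = c * memory h.
Proof.
move=> th; rewrite /memory -RintegralZl//; last exact: tame_integrable.
by apply: eq_Rintegral => r _; rewrite mulrA.
Qed.

Lemma le_memory h k : tame h -> tame k -> (forall r, 0 < r -> h r <= k r) ->
  memory h <= memory k.
Proof.
move=> th tk hk; apply: le_Rintegral => //; try exact: tame_integrable.
by move=> r /=; rewrite in_itv/= andbT => r0; rewrite ler_wpM2r ?ker_ge0// hk.
Qed.

Lemma eq_memory h k : (forall r, 0 < r -> h r = k r) -> memory h = memory k.
Proof.
move=> hk; apply: eq_Rintegral => r /set_mem/=; rewrite in_itv/= andbT => r0.
by rewrite hk.
Qed.

Lemma memory_ge0 h : (forall r, 0 < r -> 0 <= h r) -> 0 <= memory h.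
Proof.
move=> h0; apply: Rintegral_ge0 => r /=; rewrite in_itv/= andbT => r0.
by rewrite mulr_ge0 ?ker_ge0// h0.
Qed.

Lemma tame_cap L : 0 < L -> tame (fun r => Num.min 1 (r / L)).
Proof.
move=> L0; split; first exact: measurable_cap.
exists (1 + L^-1) => r r0.
have Li : 0 < L^-1 by rewrite invr_gt0.
rewrite ger0_norm; last by rewrite le_min ler01 divr_ge0 ?ltW.
have rL : 0 < r / L by rewrite divr_gt0.
have [r1|r1] := leP 1 r.
  rewrite mulr1; apply: (@le_trans _ _ 1); first by rewrite ge_min lexx.
  by rewrite lerDl ltW.
apply: (@le_trans _ _ (r / L)); first by rewrite ge_min lexx orbT.
by rewrite mulrDl mul1r [L^-1 * r]mulrC lerDr ltW.
Qed.

(** The factor L^(-a) is why a long ramp has a small Marchaud derivative. *)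
Lemma memory_cap L : 0 < L ->
  memory (fun r => Num.min 1 (r / L)) = L `^ (- a) * ((1 - a)^-1 + a^-1).
Proof. by move=> L0; rewrite /memory /Rintegral integral_cap_ker. Qed.

(** A linear lower bound over the near past (0, b) already has a memory
    proportional to 1 / (1 - a): this is the gain that the barriers below
    exploit. *)
Lemma memory_ge_linear h (k b : R) : tame h -> 0 <= k -> 0 < b ->
  (forall r, 0 < r -> 0 <= h r) -> (forall r, 0 < r < b -> k * r <= h r) ->
  k * (b `^ (1 - a) / (1 - a)) <= memory h.
Proof.
move=> th k0 b0 h0 hk; have ih := tame_integrable _ th; have [mh _] := th.
rewrite -lee_fin /memory /Rintegral fineK; last exact: integrable_fin_num.
rewrite (memory_split _ _ b0)// -integral_linear_ker//.
apply: (@le_trans _ _ (\int[mu]_(r in `]0%R, b[) (h r * ker r)%:E)%E).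
  apply: ge0_le_integral => //.
  - move=> r /=; rewrite in_itv/= => /andP[r0 _].
    by rewrite lee_fin !mulr_ge0 ?ker_ge0 ?(ltW r0).
  - by apply: mE; exact: measurable_funM.
  - exact: mE.
  - move=> r /=; rewrite in_itv/= => rb.
    by rewrite lee_fin ler_wpM2r ?ker_ge0// hk.
rewrite leeDl//; apply: integral_ge0 => r /=; rewrite in_itv/= andbT => br.
by rewrite lee_fin mulr_ge0 ?ker_ge0// h0// (lt_trans b0).
Qed.

End memory.

(** * Maximum principles for the Marchaud derivative *)

Section barriers.
Context {R : realType}.
Variable a : R.
Hypothesis a01 : 0 < a < 1.
Implicit Types (q : R -> R) (t T : R).

Let a0 : 0 < a. Proof. by case/andP: a01. Qed.
Let a1 : 0 < 1 - a. Proof. by case/andP: a01; lra. Qed.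

(** The Marchaud derivative of order a, up to the factor a / Gamma (1 - a). *)
Definition marchaud q t : R := memory a (fun r => q t - q (t - r)).

Lemma one_sub_expRN_ge x : 0 <= x <= 1 -> x / 2 <= 1 - expR (- x) :> R.
Proof.
move=> /andP[x0 x1]; rewrite expRN.
have x1' : 0 < 1 + x by lra.
have /lef_pV2 e : expR x \in Num.pos by rewrite posrE expR_gt0.
have := expR_ge1Dx x; rewrite -e ?posrE// => ei.
have : (1 + x)^-1 <= 1 - x / 2.
  by rewrite -[X in X <= _]mul1r ler_pdivrMr//; nra.
lra.
Qed.

(** Young's inequality with exponents 1 / a and 1 / (1 - a), applied to (1 -
    x)^a and 1. *)
Lemma powR_bernoulli x : 0 <= x <= 1 -> (1 - x) `^ a <= 1 - a * x.
Proof.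
move=> /andP[x0 x1].
have := @conjugate_powR R ((1 - x) `^ a) 1 a^-1 (1 - a)^-1 (powR_ge0 _ _) ler01.
rewrite !invr_gt0 !invrK powR1 -powRrM mulfV ?gt_eqF// powRr1; last lra.
by move=> /(_ a0 a1); rewrite mulr1; lra.
Qed.

Lemma powR_concave t r : 0 < t -> 0 <= r <= t ->
  (t - r) `^ a <= t `^ a - a * t `^ (a - 1) * r.
Proof.
move=> t0 rt.
have -> : t - r = t * (1 - r / t) by rewrite mulrBr mulr1 mulrCA mulfV ?mulr1// gt_eqF.
have rt1 : 0 <= r / t <= 1.
  by rewrite divr_ge0 ?(ltW t0)//= ?ler_pdivrMr ?mul1r//; case/andP: rt.
rewrite powRM ?(ltW t0)//; last by case/andP: rt1; lra.
apply: (le_trans (ler_wpM2l (powR_ge0 _ _) (powR_bernoulli _ rt1))).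
have -> : t `^ a = t * t `^ (a - 1).
  rewrite -[X in X * _]powRr1 ?(ltW t0)// -powRD ?(gt_eqF t0) ?implybT//.
  by congr (_ `^ _); ring.
by rewrite le_eqVlt; apply/orP; left; apply/eqP; field; rewrite gt_eqF.
Qed.

Lemma exists_argmax q s t : s <= t -> continuous q ->
  exists2 c, s <= c <= t & forall x, s <= x <= t -> q x <= q c.
Proof.
move=> st cq.
have [|c] := @EVT_max R q s t st; first exact: continuous_subspaceT.
by rewrite in_itv/= => cst h; exists c => // x xst; apply: h; rewrite in_itv.
Qed.

(** Suppose q exceeds the bound at t1, and let c be a maximum point of q t * exp
    (- lam (t - t0)) on [t0, t1]. Then q c > 2 B, so each past value is at most
    q c * exp (- lam r) or at most q c / 2, and the increments of q at c
    dominate q c * lam r / 2 for r < 1 / lam. Their memory is at least lam^a q c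
    / (2 (1 - a)), more than g * q c. A bound on (1 - a) g thus suffices to keep
    lam bounded as a tends to 1. *)
Lemma exp_barrier q t0 T B g lam :
  continuous q -> 0 <= B -> 0 < lam -> 2 * (1 - a) * g < lam `^ a ->
  (forall t, t <= t0 -> q t <= B) ->
  (forall t, t0 < t <= T -> tame (fun r => q t - q (t - r))) ->
  (forall t, t0 < t <= T -> marchaud q t <= g * q t) ->
  forall t, t0 < t <= T -> q t <= 2 * B * expR (lam * (t - t0)).
Proof.
move=> cq B0 lam0 lamg qB tq Mq t1 /andP[t01 t1T].
rewrite leNgt; apply/negP => qt1.
pose p t := q t * expR (- (lam * (t - t0))).
have cp : continuous p.
  move=> x; apply: cvgM; first exact: cq.
  apply: (@continuous_comp _ _ _ (fun t => - (lam * (t - t0))) expR); last exact: continuous_expR.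
  apply: cvgN; apply: cvgM; first exact: cvg_cst.
  by apply: cvgB; [exact: cvg_id|exact: cvg_cst].
have [c /andP[tc ct] cmax] := exists_argmax p t0 t1 (ltW t01) cp.
have pq x : q x = p x * expR (lam * (x - t0)).
  by rewrite /p -mulrA -expRD addNr expR0 mulr1.
have pt1 : 2 * B < p c.
  apply: lt_le_trans (cmax t1 _); last by rewrite lexx ltW.
  by rewrite /p expRN ltr_pdivlMr ?expR_gt0.
have tc' : t0 < c.
  rewrite lt_neqAle tc andbT; apply/eqP => tcE; move: pt1.
  by rewrite -tcE /p subrr mulr0 oppr0 expR0 mulr1; have := qB _ (lexx t0); lra.
have cT : c <= T by lra.
have qc : p c <= q c.
  rewrite pq ler_peMr//; first lra.
  by rewrite -expR0 ler_expR mulr_ge0 ?subr_ge0 ?ltW.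
have qc0 : 0 < q c by lra.
have dec r : 0 < r -> (t0 <= c - r /\ q (c - r) <= q c * expR (- (lam * r))) \/ q (c - r) <= q c / 2.
  move=> r0; have [rt|rt] := leP t0 (c - r).
    left; split => //; rewrite [q (c - r)]pq [q c]pq -mulrA -expRD.
    have -> : lam * (c - t0) + - (lam * r) = lam * (c - r - t0) by ring.
    by rewrite ler_wpM2r ?expR_ge0// cmax// rt/=; lra.
  by right; have := qB _ (ltW rt); lra.
have := Mq c; rewrite tc' cT => /(_ isT); apply/negP; rewrite -ltNge.
have li : 0 < lam^-1 by rewrite invr_gt0.
have := @memory_ge_linear R a a01 _ (q c * (lam / 2)) lam^-1 (tq c _) _ li.
rewrite tc' cT => /(_ isT) => M.
apply: (lt_le_trans _ (M _ _ _)).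
- rewrite -[lam^-1]powR_inv1 ?(ltW lam0)// -powRrM mulN1r opprB.
  have -> : q c * (lam / 2) * (lam `^ (a - 1) / (1 - a)) =
     q c * (lam * lam `^ (a - 1)) / (2 * (1 - a)).
    by field; rewrite gt_eqF.
  have -> : lam * lam `^ (a - 1) = lam `^ a.
    rewrite -{1}[lam]powRr1 ?(ltW lam0)// -powRD ?(gt_eqF lam0) ?implybT//.
    by congr (_ `^ _); ring.
  by rewrite ltr_pdivlMr ?mulr_gt0//; nra.
- by rewrite mulr_ge0 ?divr_ge0 ?(ltW qc0) ?(ltW lam0).
- move=> r r0; rewrite subr_ge0; case: (dec _ r0) => [[_ h]|h]; last lra.
  apply: (le_trans h); rewrite ler_piMr ?(ltW qc0)// expR_le1.
  by rewrite oppr_le0 mulr_ge0 ?ltW.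
- move=> r /andP[r0 rl].
  have lr : 0 <= lam * r <= 1.
    have : lam * r <= lam * lam^-1 by rewrite ler_wpM2l ?ltW.
    by rewrite mulfV ?(gt_eqF lam0)// => ->; rewrite andbT mulr_ge0 ?ltW.
  case: (dec _ r0) => [[_ h]|h].
    have := one_sub_expRN_ge _ lr; nra.
  by case/andP: lr => _ lr; nra.
Qed.

(** At a positive maximum point c of q t - C t^a, the increments of q dominate
    those of C t^a, which by concavity are at least C a c^(a - 1) r. The memory
    of that over (0, c) is C a / (1 - a), whatever c is. *)
Lemma power_barrier q T b C :
  continuous q -> 0 <= C -> (1 - a) * b < C * a ->
  (forall t, t <= 0 -> q t = 0) ->
  (forall t, 0 < t <= T -> tame (fun r => q t - q (t - r))) ->
  (forall t, 0 < t <= T -> marchaud q t <= b) ->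
  forall t, 0 < t <= T -> q t <= C * t `^ a.
Proof.
move=> cq C0 Cb q0 tq Mq t1 /andP[t10 t1T].
rewrite leNgt; apply/negP => qt1.
pose p t := q t - C * t `^ a.
have cx x : 0 < x -> {for x, continuous p}.
  move=> x0; apply: cvgB; first exact: cq.
  by apply: cvgM; [exact: cvg_cst|exact: continuous_powR].
have cp : {within `[0, t1], continuous p}.
  apply/continuous_within_itvP => //; split.
  - by move=> x; rewrite in_itv/= => /andP[x0 _]; exact: cx.
  - apply: cvgB; first exact/cvg_at_right_filter/cq.
    apply: cvgM; first exact: cvg_cst.
    by rewrite powR0 ?gt_eqF//; exact: (powR_cvg0 a0).
  - by apply: cvg_at_left_filter; exact: cx.
have [c] := @EVT_max R p 0 t1 (ltW t10) cp; rewrite in_itv/= => /andP[c0 ct] cmax.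
have pt1 : 0 < p c.
  apply: lt_le_trans (cmax t1 _); last by rewrite in_itv/= lexx ltW.
  by rewrite /p subr_gt0.
have c0' : 0 < c.
  rewrite lt_neqAle c0 andbT; apply/eqP => cE; move: pt1.
  by rewrite -cE /p powR0 ?gt_eqF// q0// mulr0 subrr ltxx.
have cT : 0 < c <= T by lra.
have qc : C * c `^ a < q c by rewrite -subr_gt0.
have qc0 : 0 < q c by apply: le_lt_trans qc; rewrite mulr_ge0 ?powR_ge0.
have dec r : 0 < r -> (r <= c /\ C * (a * c `^ (a - 1)) * r <= q c - q (c - r)) \/
    (c < r /\ q (c - r) = 0).
  move=> r0; have [rc|rc] := leP r c; last first.
    by right; split => //; apply: q0; lra.
  left; split => //.
  have : p (c - r) <= p c by apply: cmax; rewrite in_itv/=; lra.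
  have := @powR_concave c r c0'; rewrite (ltW r0) rc /p => /(_ isT); nra.
have := Mq c cT; apply/negP; rewrite -ltNge.
have k0 : 0 <= C * (a * c `^ (a - 1)) by rewrite mulr_ge0 ?mulr_ge0 ?powR_ge0 ?(ltW a0).
have M := @memory_ge_linear R a a01 _ (C * (a * c `^ (a - 1))) c (tq c cT) k0 c0'.
apply: (lt_le_trans _ (M _ _)).
- have -> : C * (a * c `^ (a - 1)) * (c `^ (1 - a) / (1 - a)) =
     (c `^ (a - 1) * c `^ (1 - a)) * (C * a / (1 - a)).
    by field; rewrite gt_eqF.
  rewrite -powRD ?(gt_eqF c0') ?implybT// (_ : a - 1 + (1 - a) = 0); last by ring.
  by rewrite powRr0 mul1r ltr_pdivlMr// mulrC.
- move=> r r0; case: (dec _ r0) => [[_ h]|[_ ->]]; last by rewrite subr0 ltW.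
  by apply: le_trans h; rewrite mulr_ge0 ?(ltW r0).
- by move=> r /andP[r0 rc]; case: (dec _ r0) => [[_ h]//|[cr _]]; lra.
Qed.

(** The point s maximizes q plus the ramp of slope A / L over [S, S + L]. It is
    not S, because the ramp gains A over the interval while q stays below A.
    Looking back from s within the interval, q gains at most what the ramp
    loses; before S the same holds with the whole gain of the ramp from S to s,
    since q s plus that gain is at least A. *)
Lemma sloped_argmax q S L A :
  continuous q -> 0 < L -> (forall t, 0 <= q t) -> (forall t, q t < A) ->
  exists2 s, S < s <= S + L &
    forall r, 0 < r -> - A * Num.min 1 (r / L) <= q s - q (s - r).
Proof.
move=> cq L0 q0 qA.
pose p t := q t + A / L * (t - S).
have cp : continuous p.
  move=> x; apply: cvgD; first exact: cq.
  apply: cvgM; first exact: cvg_cst.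
  by apply: cvgB; [exact: cvg_id|exact: cvg_cst].
have [|s /andP[Ss sS] smax] := exists_argmax p S (S + L) _ cp; first lra.
have A0 : 0 < A by apply: le_lt_trans (q0 0) (qA 0).
have k0 : 0 < A / L by rewrite divr_gt0.
have kL : A / L * L = A by rewrite divfK ?gt_eqF.
have ps : A <= p s.
  apply: (@le_trans _ _ (p (S + L))).
    by rewrite /p addrAC subrr add0r kL lerDr.
  by apply: smax; lra.
have Ss' : S < s.
  rewrite lt_neqAle Ss andbT; apply/eqP => E; move: ps.
  by rewrite -E /p subrr mulr0 addr0; have := qA S; lra.
exists s; first by rewrite Ss' sS.
move=> r r0; rewrite mulNr.
have Ae : A * (r / L) = A / L * r by ring.
have [rS|rS] := leP S (s - r).
  have : p (s - r) <= p s by apply: smax; lra.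
  have rL : r / L <= 1 by rewrite ler_pdivrMr// mul1r; lra.
  by rewrite (min_r rL) /p Ae; nra.
have := qA (s - r); move: ps; rewrite /p.
have : A / L * (s - S) <= A * Num.min 1 (r / L).
  rewrite minEle; case: ifP => _; last by rewrite Ae ler_wpM2l ?(ltW k0)//; lra.
  by rewrite mulr1 -[leRHS]kL ler_wpM2l ?(ltW k0)//; lra.
lra.
Qed.

End barriers.

(** * Lebesgue measure on row vectors *)

Section euclidean_measure.
Context {R : realType}.

(** The measurable sets of row vectors are those of the product structure; an
    open set is the union of the countably many rational boxes that it contains.
    *)
Lemma measurable_open_rV (d : nat) (U : set 'rV[R]_d) : open U -> measurable U.
Proof.
move=> oU.
pose rad (n : nat) : R := n.+1%:R^-1.
pose box (p : 'rV[rat]_d * nat) : set 'rV[R]_d :=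
  [set y | forall j, `|ratr (p.1 ord0 j) - y ord0 j| < rad p.2].
pose F p := if `[< box p `<=` U >] then box p else set0.
have mbox p : measurable (box p).
  rewrite (_ : box p = ~` \bigcup_j
      ((fun y : 'rV[R]_d => y ord0 j) @^-1` ~` ball (ratr (p.1 ord0 j) : R) (rad p.2))).
    apply: measurableC; apply: fin_bigcup_measurable => // j _.
    rewrite -[X in measurable X]setTI; apply: measurable_coord => //.
    by apply: measurableC; exact: measurable_ball.
  by rewrite setC_bigcup; apply/seteqP; split=> [y h j _|y h j];
    [rewrite /= => /(_ (h j))|apply: contrapT; exact: (h j)].
rewrite (_ : U = \bigcup_p F p).
  apply: countable_bigcupT_measurable => // p.
  by rewrite /F; case: ifPn.
apply/seteqP; split=> [x Ux|x [p _]]; last first.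
  by rewrite /F; case: ifPn => // /asboolP; exact.
have /nbhs_ballP[e /= e0 eU] : nbhs x U by exact: open_nbhs_nbhs.
have [n _ /(_ n (leqnn n)) hn] : \forall n \near \oo, rad n < e / 2.
  have e2 : 0 < e / 2 by rewrite divr_gt0.
  have /cvgrPdist_lt/(_ _ e2)[N _ hN] := @cvg_harmonic R.
  by exists N => // k /hN; rewrite /= sub0r normrN ger0_norm.
have r0 : 0 < rad n by rewrite invr_gt0.
have q j : {q : rat | `|ratr q - x ord0 j| < rad n}.
  apply: cid; have /rat_in_itvoo[q] : x ord0 j < x ord0 j + rad n by rewrite ltrDl.
  by rewrite in_itv/= => /andP[h1 h2]; exists q; rewrite ger0_norm; lra.
exists (\row_j sval (q j), n) => //.
rewrite /F asboolT => [j|y yb]; first by rewrite /= mxE; exact: (svalP (q j)).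
apply: eU; split => // i j; rewrite ord1.
have := yb j; rewrite /= mxE; have := svalP (q j).
rewrite /= => h1 h2.
rewrite /ball/= (_ : x ord0 j - y ord0 j =
  - (ratr (sval (q j)) - x ord0 j) + (ratr (sval (q j)) - y ord0 j)); last by ring.
by apply: (le_lt_trans (ler_normD _ _)); rewrite normrN; lra.
Qed.

Lemma continuous_measurable_rV (d : nat) (f : 'rV[R]_d -> R) :
  continuous f -> measurable_fun setT f.
Proof.
move=> /continuousP cf; apply: (measurability _ (RGenOpens.measurableE R)).
move=> _ [_ [a [b ->] <-]]; rewrite setTI; apply: measurable_open_rV.
exact/cf/interval_open.
Qed.

Lemma measurable_cube (n : nat) (M : R) :
  measurable [set x : 'rV[R]_n | forall i, `|x ord0 i| <= M]%R.
Proof.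
rewrite (_ : mkset _ = ~` \bigcup_j
    ((fun y : 'rV[R]_n => y ord0 j) @^-1` ~` `[- M, M]%classic)).
  apply: measurableC; apply: fin_bigcup_measurable => // j _.
  rewrite -[X in measurable X]setTI; apply: measurable_coord => //.
  by apply: measurableC; exact: measurable_itv.
rewrite setC_bigcup; apply/seteqP; split=> [y h j _|y h j].
  by rewrite /= in_itv/= -ler_norml => /(_ (h j)).
have := h j Logic.I => /contrapT.
by rewrite /= in_itv/= -ler_norml.
Qed.

Lemma rV_cons_hd (d : nat) p (j : 'I_1) : @rV_cons R d p ord0 (lshift d j) = p.1.
Proof. exact: etrans (row_mxEl _ _ _ _) (mxE _ _ _ _). Qed.

Lemma rV_cons_tl (d : nat) p (j : 'I_d) : @rV_cons R d p ord0 (rshift 1 j) = p.2 ord0 j.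
Proof. exact: row_mxEr. Qed.

Lemma lebesgue_rV_cube_lty (d : nat) (M : R) :
  (lebesgue_rV R d [set x | forall i, `|x ord0 i| <= M]%R < +oo)%E.
Proof.
elim: d => [|d IH].
  by rewrite /= diracE; case: (_ \in _); rewrite /= ltry.
have -> : lebesgue_rV R d.+1 [set x : 'rV[R]_d.+1 | forall i, `|x ord0 i| <= M]%R =
    (lebesgue_measure \x lebesgue_rV R d)%E
      (`[- M, M]%classic `*` [set x : 'rV[R]_d | forall i, `|x ord0 i| <= M]%R).
  rewrite /= /lebesgue_succ /pushforward; congr (_ _).
  apply/seteqP; split=> -[x y] /=.
    move=> h; split.
      have := h (lshift d (ord0 : 'I_1)).
      by rewrite rV_cons_hd in_itv/= -ler_norml.
    by move=> i; have := h (rshift 1 i); rewrite rV_cons_tl.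
  move=> [xM yM] i; case: (@split_ordP 1 d i) => j ->.
    by rewrite rV_cons_hd ler_norml; move: xM; rewrite in_itv.
  by rewrite rV_cons_tl; exact: yM.
rewrite product_measure1E//=; last exact: measurable_cube.
rewrite lte_mul_pinfty// ?ge0_fin_numE//.
  by rewrite lebesgue_measure_itv/=; case: ifP => // _; rewrite -EFinB ltry.
Qed.

Lemma bounded_lebesgue_lty (d : nat) (A : set 'rV[R]_d) : bounded_set A -> measurable A ->
  (lebesgue_rV R d A < +oo)%E.
Proof.
move=> [M [_ hM]] mA; apply: le_lt_trans (lebesgue_rV_cube_lty d (M + 1)).
apply: le_measure; rewrite ?inE//.
  exact: measurable_cube.
move=> x /hM h i; apply: le_trans (h _ _); last by rewrite ltrDl.
rewrite [leRHS]/Num.norm /= mx_normrE; apply/bigmax_geP; right => /=.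
by exists (ord0, i).
Qed.

End euclidean_measure.

(** * The inner product of L2 *)

Set Implicit Arguments.
Unset Strict Implicit.
Unset Printing Implicit Defensive.

Section L2_space.
Context {R : realType} {d : nat}.
Variable Om : set 'rV[R]_d.
Hypothesis mOm : measurable Om.
Local Notation vol := (lebesgue_rV R d).
Implicit Types f g h : 'rV[R]_d -> R.

Let LnormE f : ('N[vol]_(2%:E)[EFin \o (f \_ Om)] =
  (\int[vol]_(x in Om) (f x ^+ 2)%:E) `^ 2^-1)%E.
Proof.
rewrite unlock /Lnorm; congr (_ `^ _)%E; rewrite [RHS]integral_mkcond.
apply: eq_integral => x _; rewrite /= !patchE; case: ifPn => _.
  by rewrite powR_mulrn// real_normK// num_real.
by rewrite normr0 powR0 ?pnatr_eq0.
Qed.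

Let int_ge0 f : (0 <= \int[vol]_(x in Om) (f x ^+ 2)%:E)%E.
Proof. by apply: integral_ge0 => x _; rewrite lee_fin sqr_ge0. Qed.

Lemma L2P f : L2 Om f <-> measurable_fun Om f /\
  vol.-integrable Om (EFin \o (fun x => f x ^+ 2)).
Proof.
rewrite /L2 /= inE; split=> [/andP[]|[mf intf]].
  rewrite !inE/= => /(measurable_restrictT _ mOm) mf; rewrite /finite_norm LnormE => N.
  split => //; apply/integrableP; split.
    by apply/measurable_EFinP; exact: measurable_funX.
  under eq_integral do rewrite /= ger0_norm ?sqr_ge0//.
  by apply: (@lty_poweRy _ _ 2^-1).
apply/andP; rewrite !inE/=; split; first exact/(measurable_restrictT _ mOm).
rewrite /finite_norm LnormE; apply: poweR_lty.
move/integrableP : intf => [_].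
by under eq_integral do rewrite /= ger0_norm ?sqr_ge0//.
Qed.

Definition ip f g : R := \int[vol]_(x in Om) (f x * g x).

Lemma L2norm_ge0 f : 0 <= L2norm Om f.
Proof. by rewrite fine_ge0// Lnorm_ge0. Qed.

Lemma sqr_L2norm f : L2 Om f -> L2norm Om f ^+ 2 = ip f f.
Proof.
move=> /L2P[_ intf]; rewrite /L2norm LnormE /ip /Rintegral.
have : (\int[vol]_(x in Om) (f x ^+ 2)%:E \is a fin_num)%E by exact: integrable_fin_num.
have := int_ge0 f; under [in RHS]eq_integral do rewrite -expr2.
case: (\int[vol]_(x in Om) (f x ^+ 2)%:E)%E => //= r; rewrite lee_fin => r0 _.
by rewrite powR12_sqrt// sqr_sqrtr.
Qed.

Lemma L2_measurable f : L2 Om f -> measurable_fun Om f.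
Proof. by case/L2P. Qed.

Lemma L2_integrable_mul f g : L2 Om f -> L2 Om g ->
  vol.-integrable Om (EFin \o (fun x => f x * g x)).
Proof.
move=> /L2P[mf intf] /L2P[mg intg].
apply: (@le_integrable _ _ _ _ _ mOm _ (EFin \o (fun x => f x ^+ 2 + g x ^+ 2))).
- by apply/measurable_EFinP; exact: measurable_funM.
- move=> x _; rewrite /= lee_fin [leRHS]ger0_norm ?addr_ge0 ?sqr_ge0//.
  by rewrite ler_norml; apply/andP; split; nra.
- exact: (integrableD mOm intf intg).
Qed.

Lemma L2_add f g : L2 Om f -> L2 Om g -> L2 Om (f + g).
Proof.
move=> Lf Lg; have /L2P[mf intf] := Lf; have /L2P[mg intg] := Lg.
apply/L2P; split; first exact: measurable_funD.
rewrite (_ : _ \o _ = EFin \o (fun x => (f x ^+ 2 + g x ^+ 2) + (f x * g x + f x * g x))); last first.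
  by apply/funext => x /=; congr (_%:E); rewrite fctE; ring.
have h := L2_integrable_mul Lf Lg.
apply: (@integrableD _ _ _ _ _ mOm (EFin \o (fun x => f x ^+ 2 + g x ^+ 2))
  (EFin \o (fun x => f x * g x + f x * g x))).
  exact: (integrableD mOm intf intg).
exact: (integrableD mOm h h).
Qed.

Lemma L2_scale (c : R) f : L2 Om f -> L2 Om (c *: f).
Proof.
move=> /L2P[mf intf]; apply/L2P; split.
  by apply: measurable_funM.
rewrite (_ : _ \o _ = (fun x => (c ^+ 2)%:E * (f x ^+ 2)%:E)%E); last first.
  by apply/funext => x /=; rewrite -EFinM -exprMn.
exact: (integrableZl mOm _ intf).
Qed.

Lemma L2_sub f g : L2 Om f -> L2 Om g -> L2 Om (f - g).
Proof.
by move=> Lf Lg; rewrite -scaleN1r; apply: L2_add => //; exact: L2_scale.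
Qed.

Lemma L2_0 : L2 Om 0.
Proof.
apply/L2P; split; first exact: measurable_cst.
rewrite (_ : _ \o _ = (cst 0%E)); first exact: integrable0.
by apply/funext => x /=; rewrite expr0n.
Qed.

Lemma ipC f g : ip f g = ip g f.
Proof. by apply: eq_Rintegral => x _; rewrite mulrC. Qed.

Lemma ipDl f g h : L2 Om f -> L2 Om g -> L2 Om h -> ip (f + g) h = ip f h + ip g h.
Proof.
move=> Lf Lg Lh; rewrite /ip -RintegralD//; try exact: L2_integrable_mul.
by apply: eq_Rintegral => x _; rewrite fctE mulrDl.
Qed.

Lemma ipZl (c : R) f h : L2 Om f -> L2 Om h -> ip (c *: f) h = c * ip f h.
Proof.
move=> Lf Lh; rewrite /ip -RintegralZl//; last exact: L2_integrable_mul.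
by apply: eq_Rintegral => x _; rewrite mulrA.
Qed.

Lemma ipBl f g h : L2 Om f -> L2 Om g -> L2 Om h -> ip (f - g) h = ip f h - ip g h.
Proof.
by move=> Lf Lg Lh; rewrite -scaleN1r ipDl ?ipZl ?mulN1r//; exact: L2_scale.
Qed.

Lemma ipBr f g h : L2 Om f -> L2 Om g -> L2 Om h -> ip h (f - g) = ip h f - ip h g.
Proof. by move=> Lf Lg Lh; rewrite !(ipC h) ipBl. Qed.

Lemma ip_ge0 f : 0 <= ip f f.
Proof. by apply: Rintegral_ge0 => x _; rewrite -expr2 sqr_ge0. Qed.

(** The quadratic polynomial |f + c g|^2 of c is nonnegative. *)
Lemma cauchy_schwarz f g : L2 Om f -> L2 Om g ->
  `|ip f g| <= L2norm Om f * L2norm Om g.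
Proof.
move=> Lf Lg.
rewrite -ler_sqr ?nnegrE ?mulr_ge0 ?L2norm_ge0// exprMn !sqr_L2norm// real_normK ?num_real//.
have q (c : R) : 0 <= ip f f + c * (2 * ip f g) + c ^+ 2 * ip g g.
  have := ip_ge0 (f + c *: g); have Lc := L2_scale c Lg.
  rewrite ipDl//; last exact: L2_add.
  rewrite ipZl//; last exact: L2_add.
  rewrite (ipC f) (ipC g) !ipDl// !ipZl// (ipC g f); nra.
have g0 := ip_ge0 g; have f0 := ip_ge0 f.
have [gE|gn0] := eqVneq (ip g g) 0.
  rewrite gE mulr0.
  have [->|fg0] := eqVneq (ip f g) 0; first by rewrite expr0n.
  have := q (- (ip f f + 1) / (2 * ip f g)); rewrite gE mulr0 addr0 divfK; first lra.
  by rewrite mulf_neq0// pnatr_eq0.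
have gp : 0 < ip g g by rewrite lt_neqAle eq_sym gn0.
(* the value of c that minimizes the polynomial *)
have := q (- (ip f g / ip g g)).
set c := ip f g / ip g g; have cE : c * ip g g = ip f g by rewrite divfK.
nra.
Qed.

Lemma ip_le f g : L2 Om f -> L2 Om g -> ip f g <= L2norm Om f * L2norm Om g.
Proof. by move=> Lf Lg; apply: le_trans (cauchy_schwarz Lf Lg); exact: ler_norm. Qed.

Lemma sqr_L2normD f g : L2 Om f -> L2 Om g ->
  L2norm Om (f + g) ^+ 2 = L2norm Om f ^+ 2 + 2 * ip f g + L2norm Om g ^+ 2.
Proof.
move=> Lf Lg; have Lfg := L2_add Lf Lg.
rewrite !sqr_L2norm// ipDl// ![ip _ (f + g)]ipC !ipDl// (ipC g f); ring.
Qed.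

Lemma sqr_L2normB f g : L2 Om f -> L2 Om g ->
  L2norm Om (f - g) ^+ 2 = L2norm Om f ^+ 2 - 2 * ip f g + L2norm Om g ^+ 2.
Proof.
move=> Lf Lg; have Lfg := L2_sub Lf Lg.
rewrite !sqr_L2norm// ipBl// ![ip _ (f - g)]ipC !ipBl// (ipC g f); ring.
Qed.

Lemma L2normD f g : L2 Om f -> L2 Om g -> L2norm Om (f + g) <= L2norm Om f + L2norm Om g.
Proof.
move=> Lf Lg; rewrite -ler_sqr ?nnegrE ?addr_ge0 ?L2norm_ge0//.
rewrite sqr_L2normD//; have := ip_le Lf Lg; nra.
Qed.

Lemma L2normN f : L2norm Om (- f) = L2norm Om f.
Proof.
rewrite /L2norm !LnormE; congr (fine (_ `^ _)%E).
by apply: eq_integral => x _; rewrite fctE sqrrN.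
Qed.

Lemma L2normZ (c : R) f : L2 Om f -> L2norm Om (c *: f) = `|c| * L2norm Om f.
Proof.
move=> Lf; have Lc := L2_scale c Lf.
apply/eqP; rewrite -(@eqrXn2 _ 2) ?mulr_ge0 ?L2norm_ge0//.
by rewrite exprMn !sqr_L2norm// ipZl// ipC ipZl// real_normK ?num_real// expr2 mulrA.
Qed.

Lemma L2distC f g : L2dist Om f g = L2dist Om g f.
Proof. by rewrite /L2dist -opprB L2normN. Qed.

Lemma L2dist_ge0 f g : 0 <= L2dist Om f g.
Proof. exact: L2norm_ge0. Qed.

Lemma L2dist_triangle g f h : L2 Om f -> L2 Om g -> L2 Om h ->
  L2dist Om f h <= L2dist Om f g + L2dist Om g h.
Proof.
move=> Lf Lg Lh; rewrite /L2dist.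
rewrite (_ : f - h = (f - g) + (g - h)); last by rewrite addrA subrK.
by apply: L2normD; exact: L2_sub.
Qed.

Lemma L2distxx f : L2dist Om f f = 0.
Proof.
have := sqr_L2norm L2_0; rewrite /L2dist subrr /ip.
under eq_Rintegral do rewrite mulr0.
by rewrite Rintegral_cst// mul0r => /eqP; rewrite sqrf_eq0 => /eqP.
Qed.

Definition aeeq f g := {ae vol, forall x, Om x -> f x = g x}.

Lemma eq_ip_ae f g h : L2 Om f -> L2 Om g -> L2 Om h -> aeeq f g -> ip f h = ip g h.
Proof.
move=> Lf Lg Lh fg; rewrite /ip /Rintegral; congr fine.
have /L2_measurable mf := Lf; have /L2_measurable mg := Lg; have /L2_measurable mh := Lh.
apply: ae_eq_integral => //.
- by apply/measurable_EFinP; exact: measurable_funM.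
- by apply/measurable_EFinP; exact: measurable_funM.
- by apply: filterS fg => x + Ox => /(_ Ox) ->.
Qed.

Lemma eq_L2norm_ae f g : L2 Om f -> L2 Om g -> aeeq f g -> L2norm Om f = L2norm Om g.
Proof.
move=> Lf Lg fg.
apply/eqP; rewrite -(@eqrXn2 _ 2) ?L2norm_ge0// !sqr_L2norm//; apply/eqP.
by rewrite (eq_ip_ae Lf Lg Lf fg) ipC (eq_ip_ae Lf Lg Lg fg).
Qed.

End L2_space.

(** * The free energy and its semiconvexity *)

Section arithmetic.
Variable R : realFieldType.
Implicit Types a b x y z : R.

Lemma gradient_arith a x y z : 0 <= a -> 0 <= 2^-1 * x - 2^-1 * y + z ->
  - a * z <= a / 2 * x - a / 2 * y.
Proof. by move=> a0 h; have := mulr_ge0 a0 h; lra. Qed.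

Lemma quadratic_arith x y z : 0 <= x - 2 * y + z ->
  0 <= 2^-1 * x - 2^-1 * z + (- y - - z).
Proof. by lra. Qed.

Lemma sum_arith n (x y z : 'I_n -> R) :
  (forall i, 0 <= 2^-1 * x i - 2^-1 * y i + z i) ->
  0 <= 2^-1 * (\sum_i x i) - 2^-1 * (\sum_i y i) + \sum_i z i.
Proof.
move=> h; rewrite !mulr_sumr -sumrB -big_split/=.
by apply: sumr_ge0 => i _; exact: h.
Qed.

End arithmetic.

Section energy_functional.
Context {R : realType} {d : nat}.
Variable Om : set 'rV[R]_d.
Hypotheses (Om_open : open Om) (Om_bounded : bounded_set Om).
Local Notation vol := (lebesgue_rV R d).
Local Notation fct := ('rV[R]_d -> R).
Implicit Types (f g h u v w phi : fct).

Let mOm : measurable Om. Proof. exact: measurable_open_rV. Qed.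

Let finOm : (vol Om < +oo)%E. Proof. exact: bounded_lebesgue_lty. Qed.

Definition bounded_ae (M : R) f := {ae vol, forall x, Om x -> `|f x| <= M}.

Lemma bounded_ae_integrable M f : measurable_fun Om f -> bounded_ae M f ->
  vol.-integrable Om (EFin \o f).
Proof.
move=> mf bf; apply/integrableP; split; first exact/measurable_EFinP.
apply: (@le_lt_trans _ _ (\int[vol]_(x in Om) (`|M|%:E))%E).
  apply: ae_ge0_le_integral => //.
  - by apply: measurableT_comp => //; exact/measurable_EFinP.
  - apply: filterS bf => x h Ox; rewrite /= lee_fin.
    exact: le_trans (h Ox) (ler_norm _).
by rewrite integral_cst// lte_mul_pinfty// lee_fin.
Qed.

Lemma bounded_ae_L2 M f : measurable_fun Om f -> bounded_ae M f -> L2 Om f.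
Proof.
move=> mf bf; apply/(L2P mOm); split => //.
apply: (@bounded_ae_integrable (M ^+ 2)); first exact: measurable_funX.
apply: filterS bf => x h Ox; rewrite normrX.
have := h Ox; have := normr_ge0 (f x); nra.
Qed.

Lemma continuous_L2 f : continuous f -> L2 Om f.
Proof.
move=> cf.
have clb : bounded_set (closure Om).
  have [M [_ hM]] := Om_bounded.
  have cB : closed [set x : 'rV[R]_d | `|x| <= M + 1].
    apply: (@closed_comp _ _ (fun x : 'rV[R]_d => `|x|) [set y | y <= M + 1]) => [x _|].
      exact: norm_continuous.
    exact: closed_le.
  have sub : closure Om `<=` [set x : 'rV[R]_d | `|x| <= M + 1].
    rewrite ((closure_id _).1 cB); apply: closure_subset => x Ox.
    by apply: (hM (M + 1)) => //; rewrite ltrDl.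
  exists (M + 1); split; first exact: num_real.
  by move=> y My x /sub h; apply: le_trans h (ltW My).
have cK : compact (closure Om).
  by apply: bounded_closed_compact => //; exact: closed_closure.
have : compact (f @` closure Om).
  by apply: continuous_compact => //; exact: continuous_subspaceT.
move=> /compact_bounded[M [_ hM]].
apply: (@bounded_ae_L2 (M + 1)).
  by apply: measurable_funTS; exact: continuous_measurable_rV.
apply: aeW => x Ox; apply: (hM (M + 1)); first by rewrite ltrDl.
by exists x => //; exact: subset_closure.
Qed.

Lemma test_function_L2 phi : test_function Om phi -> L2 Om phi.
Proof.
move=> [dphi _ _]; apply: continuous_L2 => x.
exact: differentiable_continuous (dphi [::] x).
Qed.

Lemma test_function_pderiv_L2 phi i : test_function Om phi -> L2 Om (pderiv i phi).
Proof.
move=> [dphi _ _]; apply: continuous_L2 => x.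
exact: differentiable_continuous (dphi [:: i] x).
Qed.

Lemma H1_L2 f : H1 Om f -> L2 Om f.
Proof. by case. Qed.

Lemma wpderivP f i : H1 Om f -> is_weak_pderiv Om i f (wpderiv Om i f).
Proof.
move=> [_ /(_ i) ex]; exact: (xgetPex (cst 0) ex).
Qed.

Lemma wpderiv_L2 f i : H1 Om f -> L2 Om (wpderiv Om i f).
Proof. by move=> /wpderivP => /(_ i)[]. Qed.

Lemma H2_H1 f : H2 Om f -> H1 Om f.
Proof. by case. Qed.

Lemma H2_wpderiv f i : H2 Om f -> H1 Om (wpderiv Om i f).
Proof. by case. Qed.

Lemma laplacian_L2 f : H2 Om f -> L2 Om (laplacian Om f).
Proof.
move=> H2f.
rewrite (_ : laplacian Om f = \sum_i wpderiv Om i (wpderiv Om i f)); last first.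
  by apply/funext => x; rewrite fct_sumE.
elim/big_ind: _ => [|a b|i _]; first exact: L2_0.
- exact: L2_add.
- by apply: wpderiv_L2; exact: H2_wpderiv.
Qed.

(** True by definition of weak derivatives when w is a test function. Both sides
    are continuous in w for the norm in which test functions are dense. *)
Lemma weak_integration_by_parts i v g w : L2 Om v -> is_weak_pderiv Om i v g ->
  H10 Om w -> ip Om v (wpderiv Om i w) = - ip Om g w.
Proof.
move=> Lv [Lg vg] [H1w dens].
have Lw := H1_L2 H1w; have Ldw := wpderiv_L2 i H1w.
apply/eqP; rewrite -subr_eq0 opprK -normr_le0; apply/ler_addgt0Pl => e e0.
rewrite addr0.
pose K := L2norm Om v + L2norm Om g + 1.
have K0 : 0 < K by rewrite ltr_wpDl ?addr_ge0 ?L2norm_ge0.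
have [|phi [tphi wphi dwphi]] := dens (e / K); first by rewrite divr_gt0.
have Lp := test_function_L2 tphi; have Ldp := test_function_pderiv_L2 i tphi.
have E : ip Om v (wpderiv Om i w) + ip Om g w =
    ip Om v (wpderiv Om i w - pderiv i phi) + ip Om g (w - phi).
  by rewrite !ipBr//; have := vg _ tphi; rewrite -/(ip _ _ _) -/(ip _ _ _) => ->; ring.
rewrite E.
have L1 := L2_sub mOm Ldw Ldp; have L2' := L2_sub mOm Lw Lp.
apply: (le_trans (ler_normD _ _)).
have h1 := cauchy_schwarz mOm Lv L1; have h2 := cauchy_schwarz mOm Lg L2'.
have h3 := dwphi i; rewrite /L2dist in h3 wphi.
have v0 := L2norm_ge0 Om v; have g0 := L2norm_ge0 Om g.
have ek : 0 < e / K by rewrite divr_gt0.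
have eK : e / K * K = e by rewrite divfK ?gt_eqF.
have h4 : L2norm Om v * L2norm Om (wpderiv Om i w - pderiv i phi) <= L2norm Om v * (e / K).
  by rewrite ler_wpM2l// ltW.
have h5 : L2norm Om g * L2norm Om (w - phi) <= L2norm Om g * (e / K).
  by rewrite ler_wpM2l// ltW.
rewrite -eK /K; nra.
Qed.

Variable eps : R.

(** The L2 gradient of the free energy. *)
Definition chemical_potential u : fct :=
  (- eps ^+ 2) *: laplacian Om u + (fun x => reaction (u x)).

Definition free_energy u : R :=
  \int[vol]_(x in Om)
    (eps ^+ 2 / 2 * (\sum_i wpderiv Om i u x ^+ 2)
     + 4^-1 * (u x ^+ 2 - 1) ^+ 2).

Definition double_well u : R := \int[vol]_(x in Om) (4^-1 * (u x ^+ 2 - 1) ^+ 2).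

Lemma double_well_integrable M u : measurable_fun Om u -> bounded_ae M u ->
  vol.-integrable Om (EFin \o (fun x => 4^-1 * (u x ^+ 2 - 1) ^+ 2)).
Proof.
move=> mu bu; apply: (@bounded_ae_integrable (4^-1 * (M ^+ 2 + 1) ^+ 2)).
  apply: measurable_funM => //; apply: measurable_funX; apply: measurable_funB => //.
  exact: measurable_funX.
apply: filterS bu => x h Ox; have := h Ox; have := normr_ge0 (u x) => h0 h1.
rewrite /= ger0_norm; last by rewrite mulr_ge0 ?sqr_ge0.
have hu : 0 <= u x ^+ 2 <= M ^+ 2.
  by rewrite sqr_ge0/= -real_normK ?num_real//; nra.
apply: ler_wpM2l; first by rewrite invr_ge0.
by nra.
Qed.

Lemma reaction_L2 M u : measurable_fun Om u -> bounded_ae M u ->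
  L2 Om (fun x => reaction (u x)).
Proof.
move=> mu bu; apply: (@bounded_ae_L2 (M ^+ 3 + M)).
  by apply: measurable_funB => //; exact: measurable_funX.
apply: filterS bu => x h Ox; apply: (le_trans (ler_normB _ _)).
by rewrite normrX lerD ?h// lerXn2r ?nnegrE ?h// (le_trans _ (h Ox)).
Qed.

Lemma chemical_potential_L2 M u : H2 Om u -> bounded_ae M u ->
  L2 Om (chemical_potential u).
Proof.
move=> H2u bu; apply: L2_add => //.
  by apply: L2_scale => //; exact: laplacian_L2.
exact: (reaction_L2 (L2_measurable mOm (H1_L2 (H2_H1 H2u))) bu).
Qed.

Lemma free_energyE M u : H2 Om u -> bounded_ae M u ->
  free_energy u =
  eps ^+ 2 / 2 * (\sum_i ip Om (wpderiv Om i u) (wpderiv Om i u)) + double_well u.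
Proof.
move=> H2u bu; have Lu := H1_L2 (H2_H1 H2u).
have intd i : vol.-integrable Om (EFin \o (fun x => wpderiv Om i u x * wpderiv Om i u x)).
  by apply: L2_integrable_mul => //; apply: wpderiv_L2; exact: H2_H1.
have sumE : [/\ vol.-integrable Om (EFin \o (fun x => \sum_i wpderiv Om i u x ^+ 2)) &
    \int[vol]_(x in Om) (\sum_i wpderiv Om i u x ^+ 2) =
    \sum_i ip Om (wpderiv Om i u) (wpderiv Om i u)].
  rewrite (_ : (fun x => \sum_i wpderiv Om i u x ^+ 2) =
    \sum_i (fun x => wpderiv Om i u x * wpderiv Om i u x)); last first.
    by apply/funext => x; rewrite fct_sumE; apply: eq_bigr => i _; rewrite expr2.
  elim/big_ind2: _ => [|f F g G [If Ef] [Ig Eg]|i _]; last by split.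
    split; last by rewrite Rintegral_cst// mul0r.
    exact: integrable0.
  split; first exact: (integrableD mOm If Ig).
  by rewrite -Ef -Eg -RintegralD.
have [Is Es] := sumE.
have Iw := double_well_integrable (L2_measurable mOm Lu) bu.
rewrite /free_energy RintegralD//; last exact: (integrableZl mOm _ Is).
by rewrite RintegralZl// Es.
Qed.

(** The derivative of the reaction is at least -1, so adding half a square makes
    the double well convex. *)
Lemma double_well_ineq (a b : R) :
  reaction a * (b - a) - 2^-1 * ((b - a) * (b - a)) <=
  4^-1 * (b ^+ 2 - 1) ^+ 2 - 4^-1 * (a ^+ 2 - 1) ^+ 2.
Proof.
rewrite /reaction -subr_ge0.
rewrite (_ : _ - _ = 4^-1 * (b - a) ^+ 2 * ((b + a) ^+ 2 + 2 * a ^+ 2)); last by field.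
have h1 := sqr_ge0 (b - a); have h2 := sqr_ge0 (b + a); have h3 := sqr_ge0 a.
apply: mulr_ge0; first by apply: mulr_ge0 => //; rewrite invr_ge0.
by lra.
Qed.

Lemma double_well_semiconvex M u w :
  L2 Om u -> bounded_ae M u -> L2 Om w -> bounded_ae M w ->
  ip Om (fun x => reaction (u x)) (w - u) - 2^-1 * L2norm Om (w - u) ^+ 2
  <= double_well w - double_well u.
Proof.
move=> Lu bu Lw bw.
have Lr := reaction_L2 (L2_measurable mOm Lu) bu; have Ld := L2_sub mOm Lw Lu.
have Iu := double_well_integrable (L2_measurable mOm Lu) bu.
have Iw := double_well_integrable (L2_measurable mOm Lw) bw.
have I1 := L2_integrable_mul mOm Lr Ld.
have I2 := L2_integrable_mul mOm Ld Ld.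
rewrite sqr_L2norm// /double_well -RintegralB// /ip -RintegralZl// -RintegralB//; last first.
  exact: (integrableZl mOm _ I2).
apply: le_Rintegral => //.
- exact: (integrableB mOm I1 (integrableZl mOm _ I2)).
- exact: (integrableB mOm Iw Iu).
- by move=> x _; exact: double_well_ineq.
Qed.

(** The gradient term is convex, and the double well is so after adding half a
    square. The first-order term is the chemical potential because w - u
    vanishes at the boundary in the sense of [H10], which allows one integration
    by parts. *)
Lemma free_energy_semiconvex M u w :
  H2 Om u -> H10 Om u -> bounded_ae M u ->
  H2 Om w -> H10 Om w -> bounded_ae M w ->
  ip Om (chemical_potential u) (w - u) - 2^-1 * L2norm Om (w - u) ^+ 2
  <= free_energy w - free_energy u.
Proof.
move=> H2u H10u bu H2w H10w bw.
have Lu := H1_L2 (H2_H1 H2u); have Lw := H1_L2 (H2_H1 H2w).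
rewrite (free_energyE H2u bu) (free_energyE H2w bw).
have Lr := reaction_L2 (L2_measurable mOm Lu) bu; have Ld := L2_sub mOm Lw Lu.
have LL := laplacian_L2 H2u; have DW := double_well_semiconvex Lu bu Lw bw.
rewrite /chemical_potential ipDl//; last exact: L2_scale.
rewrite ipZl//.
suff : - eps ^+ 2 * ip Om (laplacian Om u) (w - u) <=
  eps ^+ 2 / 2 * (\sum_i ip Om (wpderiv Om i w) (wpderiv Om i w)) -
  eps ^+ 2 / 2 * (\sum_i ip Om (wpderiv Om i u) (wpderiv Om i u)).
  by move=> h; have := lerD h DW; rewrite addrA [(_ - _) + (_ - _)]addrACA -opprD.
have -> : ip Om (laplacian Om u) (w - u) =
    \sum_i ip Om (wpderiv Om i (wpderiv Om i u)) (w - u).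
  rewrite (_ : laplacian Om u = \sum_i wpderiv Om i (wpderiv Om i u)); last first.
    by apply/funext => x; rewrite fct_sumE.
  have : [/\ L2 Om (\sum_i wpderiv Om i (wpderiv Om i u)) &
     ip Om (\sum_i wpderiv Om i (wpderiv Om i u)) (w - u) =
     \sum_i ip Om (wpderiv Om i (wpderiv Om i u)) (w - u)]; last by case.
  elim/big_ind2: _ => [|f F g G [If Ef] [Ig Eg]|i _].
  - split; first exact: L2_0.
    by rewrite /ip; under eq_Rintegral do rewrite mul0r; rewrite Rintegral_cst// mul0r.
  - by split; [exact: L2_add|rewrite ipDl// Ef Eg].
  - by split => //; apply: wpderiv_L2; exact: H2_wpderiv.
suff key : 0 <= 2^-1 * (\sum_i ip Om (wpderiv Om i w) (wpderiv Om i w)) -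
    2^-1 * (\sum_i ip Om (wpderiv Om i u) (wpderiv Om i u)) +
    \sum_i ip Om (wpderiv Om i (wpderiv Om i u)) (w - u).
  exact: gradient_arith (sqr_ge0 eps) key.
apply: sum_arith => i.
have Lui := wpderiv_L2 i (H2_H1 H2u); have Lwi := wpderiv_L2 i (H2_H1 H2w).
have Luii := wpderiv_L2 i (H2_wpderiv i H2u).
have wp := wpderivP i (H2_wpderiv i H2u).
rewrite ipBr//.
have -> : ip Om (wpderiv Om i (wpderiv Om i u)) w = - ip Om (wpderiv Om i u) (wpderiv Om i w).
  by rewrite (weak_integration_by_parts Lui wp H10w) opprK.
have -> : ip Om (wpderiv Om i (wpderiv Om i u)) u = - ip Om (wpderiv Om i u) (wpderiv Om i u).
  by rewrite (weak_integration_by_parts Lui wp H10u) opprK.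
have := sqr_ge0 (L2norm Om (wpderiv Om i w - wpderiv Om i u)).
rewrite sqr_L2normB// !sqr_L2norm// (ipC _ (wpderiv Om i w)).
exact: quadratic_arith.
Qed.

End energy_functional.

(** * Essential bounds at every time *)

Section fubini_ae.
Context d1 d2 (T1 : measurableType d1) (T2 : measurableType d2) (R : realType).
Variable m1 : {sigma_finite_measure set T1 -> \bar R}.
Variable m2 : {sigma_finite_measure set T2 -> \bar R}.

(** Fubini's theorem for null sets. *)
Lemma ae_section (P : T1 * T2 -> Prop) :
  {ae (m1 \x m2)%E, forall p, P p} ->
  {ae m1, forall x, {ae m2, forall y, P (x, y)}}.
Proof.
move=> [N [mN N0 PN]].
have mphi := measurable_fun_xsection m2 mN.
have : ae_eq m1 setT (m2 \o xsection N) (cst 0%E).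
  apply/ae_eq_integral_abs => //.
  rewrite -N0 /product_measure1; apply: eq_integral => x _.
  by rewrite gee0_abs.
apply: filterS => x /(_ Logic.I) /= Nx0.
exists (xsection N x); split => //; first exact: measurable_xsection.
by move=> y Py; rewrite /xsection /= inE; exact: PN.
Qed.

End fubini_ae.

Section essential_bound.
Context {R : realType} {d : nat}.
Variable Om : set 'rV[R]_d.
Hypothesis mOm : measurable Om.
Local Notation mu := (@lebesgue_measure R).
Local Notation vol := (lebesgue_rV R d).
Local Notation fct := ('rV[R]_d -> R).

Lemma essentially_bounded_slices (D : set R) (u : R -> fct) :
  essentially_bounded Om D u ->
  exists2 M, 0 <= M & {ae mu, forall t, D t -> bounded_ae Om M (u t)}.
Proof.
rewrite /essentially_bounded inE => /andP[]; rewrite !inE/= => _.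
set F := (_ \_ _); rewrite /finite_norm unlock /= => N.
have [M M0 FM] : exists2 M, 0 <= M &
    {ae (mu \x vol)%E, forall p, `|F p| <= M}.
  move: N; case: ifPn => [muT N|].
    have := ess_sup_ge (mu \x vol)%E (abse \o (EFin \o F)).
    have e0 : (0 <= ess_sup (mu \x vol)%E (abse \o (EFin \o F)))%E.
      by apply: ess_sup_gee => //; apply: aeW => p /=; rewrite lee_fin.
    move: N e0; case: (ess_sup _ _) => // M _; rewrite lee_fin => M0 h.
    by exists M => //; apply: filterS h => p /=; rewrite lee_fin.
  (* if the product measure vanishes, its null sets are all the sets *)
  rewrite -leNgt => mu0 _; exists 0 => //.
  exists setT; split => //.
  by apply/eqP; rewrite eq_le mu0 measure_ge0.
exists M => //; have := ae_section FM; apply: filterS => t ht Dt.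
apply: filterS ht => x; rewrite /F patchE => + Ox.
by rewrite mem_set.
Qed.

Lemma integral_sqr f : L2 Om f ->
  (\int[vol]_(x in Om) (f x ^+ 2)%:E = (L2norm Om f ^+ 2)%:E)%E.
Proof.
move=> Lf; have /(L2P mOm)[_ intf] := Lf.
rewrite sqr_L2norm// /ip /Rintegral fineK.
  by apply: eq_integral => x _; rewrite expr2.
by apply: integrable_fin_num => //; exact: L2_integrable_mul.
Qed.

(** If g is bounded by M, then the excess of |f| over M is at most |f - g|; so
    the square integral of the excess is as small as desired. *)
Lemma bounded_ae_closed M f : 0 <= M -> L2 Om f ->
  (forall e, 0 < e -> exists g, [/\ L2 Om g, bounded_ae Om M g & L2dist Om f g < e]) ->
  bounded_ae Om M f.
Proof.
move=> M0 Lf H.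
have mf := L2_measurable mOm Lf.
pose h : fct := fun x => Num.max (`|f x| - M) 0.
have mh : measurable_fun Om h.
  apply: measurable_maxr => //; apply: measurable_funB => //.
  exact: measurableT_comp.
have h0 x : 0 <= h x by rewrite /h le_max lexx orbT.
have hle g x : `|g x| <= M -> h x ^+ 2 <= (f x - g x) ^+ 2.
  move=> gM; rewrite -[leRHS]real_normK ?num_real// lerXn2r ?nnegrE//.
  rewrite /h ge_max normr_ge0 andbT lerBlDr.
  by rewrite -{1}[f x](subrK (g x)) (le_trans (ler_normD _ _))// lerD2l.
have int0 : (\int[vol]_(x in Om) (h x ^+ 2)%:E = 0)%E.
  apply/eqP; rewrite eq_le integral_ge0 ?andbT; last by move=> x _; rewrite lee_fin sqr_ge0.
  apply/lee_addgt0Pr => e e0; rewrite add0e.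
  have [|g [Lg bg fg]] := H (Num.sqrt e); first by rewrite sqrtr_gt0.
  have Lfg := L2_sub mOm Lf Lg.
  have /(L2P mOm)[mfg ifg] := Lfg.
  apply: (@le_trans _ _ (\int[vol]_(x in Om) (((f - g) x) ^+ 2)%:E)%E).
    apply: ae_ge0_le_integral => //.
    - by move=> x _; rewrite lee_fin sqr_ge0.
    - by apply/measurable_EFinP; exact: measurable_funX.
    - by move=> x _; rewrite lee_fin sqr_ge0.
    - by apply/measurable_EFinP; exact: measurable_funX.
    - by apply: filterS bg => x bx Ox; rewrite lee_fin; exact/hle/bx.
  rewrite integral_sqr// lee_fin.
  by rewrite -(sqr_sqrtr (ltW e0)) lerXn2r ?nnegrE ?sqrtr_ge0 ?L2norm_ge0// ltW.
have : ae_eq vol Om (fun x => (h x ^+ 2)%:E) (cst 0%E).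
  apply/ae_eq_integral_abs => //; first by apply/measurable_EFinP; exact: measurable_funX.
  rewrite -int0; apply: eq_integral => x _ /=.
  by rewrite ger0_norm ?sqr_ge0.
apply: filterS => x hx Ox; have := hx Ox => /= -[] /eqP.
rewrite sqrf_eq0 => /eqP hE.
have : `|f x| - M <= h x by rewrite /h le_max lexx.
by rewrite hE subr_le0.
Qed.

Lemma ae_itv_meets (P : R -> Prop) (a b : R) : a < b ->
  {ae mu, forall t, P t} -> exists2 s, a < s < b & P s.
Proof.
move=> ab [N [mN N0 PN]]; apply: contrapT => H.
have sub : `]a, b[%classic `<=` N.
  move=> s; rewrite /= in_itv/= => sab; apply: PN => Ps; apply: H.
  by exists s.
have : (mu `]a, b[%classic <= mu N)%E by apply: le_measure; rewrite ?inE.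
by rewrite N0 lebesgue_measure_itv/= lte_fin ab -EFinB lee_fin leNgt subr_gt0 ab.
Qed.

(** Every time is a limit of later times at which the bound holds, and the bound
    is closed in L2. *)
Lemma right_continuous_bounded_ae (u : R -> fct) M a :
  (forall t, a <= t -> L2 Om (u t)) ->
  (forall t, a <= t -> forall e, 0 < e -> exists2 del, 0 < del &
     forall s, t < s < t + del -> L2dist Om (u t) (u s) < e) ->
  0 <= M -> {ae mu, forall t, a < t -> bounded_ae Om M (u t)} ->
  forall t, a <= t -> bounded_ae Om M (u t).
Proof.
move=> Lu cu M0 bu t at_; apply: bounded_ae_closed => //; first exact: Lu.
move=> e e0; have [del d0 h] := cu _ at_ _ e0.
have [|s ts bs] := @ae_itv_meets _ t (t + del) _ bu; first by rewrite ltrDl.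
have as_ : a < s by case/andP: ts => ts _; exact: le_lt_trans ts.
by exists (u s); split; [exact/Lu/ltW|exact: bs|exact: h].
Qed.

End essential_bound.

(** * From the Caputo to the Marchaud derivative *)

Section integral_monotone.
Context d (T : measurableType d) (R : realType).
Variable mu : {measure set T -> \bar R}.

(** The integral of a nonnegative function is a supremum over the simple
    functions below it. Used when the measurability of an integrand is unknown,
    as for the distance from a simple curve to a curve. *)
Lemma ge0_le_integral_any (D : set T) (f g : T -> \bar R) :
  (forall x, D x -> (0 <= f x)%E) -> (forall x, D x -> (f x <= g x)%E) ->
  (\int[mu]_(x in D) f x <= \int[mu]_(x in D) g x)%E.
Proof.
move=> f0 fg.
have g0 x : D x -> (0 <= g x)%E by move=> Dx; exact: le_trans (f0 _ Dx) (fg _ Dx).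
rewrite !ge0_integralE//; apply: le_ereal_sup => _ [h hf <-]; exists h => // x.
apply: le_trans (hf x) _; rewrite !patchE; case: ifPn => // /set_mem; exact: fg.
Qed.

End integral_monotone.

Section reflection_integrable.
Context {R : realType}.
Local Notation mu := (@lebesgue_measure R).

Lemma integrable_reflect (t : R) (D : set R) (f : R -> \bar R) : measurable D ->
  measurable_fun D f ->
  mu.-integrable [set r | D (t - r)] (fun r => f (t - r)) -> mu.-integrable D f.
Proof.
move=> mD mf /integrableP[_ h]; apply/integrableP; split => //.
by rewrite (integral_reflect t)//; exact: measurableT_comp.
Qed.

Lemma reflect_oo (t : R) : [set r | `]0, t[%classic (t - r)] = `]0, t[%classic.
Proof. by apply/seteqP; split=> r; rewrite /= !in_itv/=; lra. Qed.

End reflection_integrable.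

Section history.
Context {R : realType}.
Local Notation mu := (@lebesgue_measure R).
Variable a : R.
Hypothesis a01 : 0 < a < 1.
Let a0 : 0 < a. Proof. by case/andP: a01. Qed.

Lemma ker_integrable (t : R) : 0 < t -> mu.-integrable `]t, +oo[ (EFin \o ker a).
Proof.
move=> t0; apply/integrableP; split; first exact: measurable_powR_EFin.
have := integral_const_ker a a01 1 t ler01 t0.
under eq_integral do rewrite mul1r.
under [X in _ -> (X < _)%E]eq_integral do rewrite /= ger0_norm ?ker_ge0//.
by move=> ->; exact: ltry.
Qed.

(** A function that keeps its initial value before time 0 contributes the tail r
    > t of the memory integral in closed form. *)
Lemma memory_history (k : R -> R) (t : R) : 0 < t ->
  tame (fun r => k (Num.max (t - r) 0)) ->
  memory a (fun r => k (Num.max (t - r) 0)) =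
  \int[mu]_(s in `]0, t[) (k s * ker a (t - s)) + k 0 * (t `^ (- a) / a) /\
   mu.-integrable `]0, t[ (EFin \o (fun s => k s * ker a (t - s))).
Proof.
move=> t0; pose h := fun r => k (Num.max (t - r) 0); rewrite -/h => th.
have [mh _] := th.
have ih := tame_integrable a a01 h th.
have split0 : `]0, +oo[%classic = `]0, t[ `|` `[t, +oo[ :> set R.
  by rewrite -itv_bndbnd_setU ?bnd_simp// ltW.
have dis : [disjoint `]0%R, t[%classic & `[t, +oo[%classic].
  apply/disj_setPS => x []/=; rewrite !in_itv/= => /andP[_ x1].
  by rewrite andbT leNgt x1.
have i1 : mu.-integrable `]0, t[ (EFin \o (fun r => h r * ker a r)).
  by apply: integrableS ih => //; rewrite split0; exact: subsetUl.
have E1 r : `]0, t[%classic r -> h r * ker a r = k (t - r) * ker a (t - (t - r)).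
  rewrite /= in_itv/= => /andP[r0 rt]; rewrite subKr /h max_l// subr_ge0 ltW//.
have ik : measurable_fun `]0, t[ (EFin \o (fun s => k s * ker a (t - s))).
  have mh' : measurable_fun setT (fun s : R => h (t - s) * ker a (t - s)).
    apply: measurable_funM; apply: measurableT_comp => //; try exact: measurable_ker;
      by apply: measurable_funB.
  apply/measurable_EFinP; apply: (eq_measurable_fun (fun s : R => h (t - s) * ker a (t - s))).
    by move=> s /set_mem; rewrite /= in_itv/= /h subKr => /andP[s0 _]; rewrite max_l// ltW.
  exact: measurable_funTS.
split.
  rewrite /memory split0 Rintegral_setU//; last by rewrite -split0.
  apply: (f_equal2 +%R).
    have := integral_reflect t _ _ (measurable_itv `]0, t[) ik.
    rewrite reflect_oo /Rintegral => ->; congr fine.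
    by apply: eq_integral => r /set_mem rt; rewrite /= E1.
  rewrite -Rintegral_itv_obnd_cbnd; last first.
    apply: integrableS ih => // r; rewrite /= !in_itv/= !andbT.
    exact: lt_trans.
  transitivity (\int[mu]_(r in `]t, +oo[) (k 0 * ker a r)).
    apply: eq_Rintegral => r /set_mem; rewrite /= in_itv/= andbT => tr.
    by rewrite /h max_r// subr_le0 ltW.
  rewrite RintegralZl//; last exact: ker_integrable.
  by congr (_ * _); rewrite /Rintegral (integral_powR_y a t a0 t0).
apply: (integrable_reflect (t := t)) => //; rewrite reflect_oo.
apply: eq_integrable i1 => // r /set_mem rt; by rewrite /= E1.
Qed.

End history.

Section bochner_pairing.
Context {R : realType} {d : nat}.
Variable Om : set 'rV[R]_d.
Hypothesis mOm : measurable Om.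
Local Notation mu := (@lebesgue_measure R).
Local Notation fct := ('rV[R]_d -> R).

Lemma ip_sum n (c : 'I_n -> R) (f : 'I_n -> fct) v :
  (forall k, L2 Om (f k)) -> L2 Om v ->
  L2 Om (\sum_k c k *: f k) /\
  ip Om (\sum_k c k *: f k) v = \sum_k c k * ip Om (f k) v.
Proof.
move=> Lf Lv; elim/big_ind2: _ => [|x X y Y [Lx xX] [Ly yY]|k _].
- split; first exact: L2_0.
  by rewrite /ip; under eq_Rintegral do rewrite mul0r; rewrite Rintegral_cst// mul0r.
- by split; [exact: L2_add|rewrite ipDl// xX yY].
- by split; [exact: L2_scale|rewrite ipZl].
Qed.

Lemma integral_step (D : set (measurableTypeR R)) n (A : 'I_n -> set (measurableTypeR R)) (c : 'I_n -> R) :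
  measurable D -> (mu D < +oo)%E -> (forall k, measurable (A k)) ->
  mu.-integrable D (EFin \o (fun t => \sum_k \1_(A k) t * c k)) /\
  \int[mu]_(t in D) (\sum_k \1_(A k) t * c k) =
  \sum_k fine (mu (D `&` A k)) * c k.
Proof.
move=> mD finD mA.
have H k : mu.-integrable D (EFin \o (fun t => \1_(A k) t * c k)) /\
    \int[mu]_(t in D) (\1_(A k) t * c k) = fine (mu (D `&` A k)) * c k.
  have fin : (mu (D `&` A k) < +oo)%E.
    apply: le_lt_trans finD; apply: le_measure; rewrite ?inE//; exact: measurableI.
  have i1 : mu.-integrable D (EFin \o (\1_(A k) : R -> R)).
    apply/integrableP; split; first exact/measurable_EFinP.
    under eq_integral do rewrite /= ger0_norm//.
    by rewrite integral_indic// setIC.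
  split.
    have := integrableZr mD (c k) i1; apply: eq_integrable => // t _.
  rewrite RintegralZr//; congr (_ * _).
  by rewrite /Rintegral integral_indic// setIC.
have -> : (fun t => \sum_k \1_(A k) t * c k) = \sum_k (fun t => \1_(A k) t * c k).
  by apply/funext => t; rewrite fct_sumE.
elim/big_ind2: _ => [|f x g y [If Ef] [Ig Eg]|k _]; last exact: H.
  split; first exact: integrable0.
  by rewrite Rintegral_cst// mul0r.
split; first exact: (integrableD mD If Ig).
by rewrite -Ef -Eg -RintegralD.
Qed.

(** The pairing with v commutes with the integral of simple curves, and both
    sides are Lipschitz for the distances in which simple curves approximate F.
    *)
Lemma bochner_pairing (D : set (measurableTypeR R)) (F : R -> fct) (G v : fct) :
  measurable D -> (mu D < +oo)%E -> (forall t, D t -> L2 Om (F t)) -> L2 Om v ->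
  mu.-integrable D (EFin \o (fun t => ip Om (F t) v)) ->
  is_bochner_integral Om D F G ->
  ip Om G v = \int[mu]_(t in D) ip Om (F t) v.
Proof.
move=> mD finD LF Lv intF [LG [s [[sX _] sF sG]]].
have N0 : 0 < L2norm Om v + 1 by rewrite ltr_wpDl ?L2norm_ge0.
set N := L2norm Om v + 1 in N0.
have vN : L2norm Om v <= N by rewrite lerDl.
have Lsc n t : L2 Om (sc_fun (s n) t).
  exact: (ip_sum _ (fun k => (sX n k).2) Lv).1.
have Lsi n : L2 Om (sc_integral D (s n)).
  exact: (ip_sum _ (fun k => (sX n k).2) Lv).1.
have Esc n t : ip Om (sc_fun (s n) t) v =
    \sum_k \1_(@sc_set _ _ (s n) k) t * ip Om (@sc_val _ _ (s n) k) v.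
  exact: (ip_sum _ (fun k => (sX n k).2) Lv).2.
have Esi n : ip Om (sc_integral D (s n)) v =
    \sum_k fine (mu (D `&` @sc_set _ _ (s n) k)) * ip Om (@sc_val _ _ (s n) k) v.
  exact: (ip_sum _ (fun k => (sX n k).2) Lv).2.
have IE n : mu.-integrable D (EFin \o (fun t => ip Om (sc_fun (s n) t) v)) /\
   \int[mu]_(t in D) ip Om (sc_fun (s n) t) v = ip Om (sc_integral D (s n)) v.
  have := @integral_step D _ (@sc_set _ _ (s n)) (fun k => ip Om (@sc_val _ _ (s n) k) v)
    mD finD (fun k => (sX n k).1).
  by rewrite Esi; under [in X in _ -> X]eq_fun do rewrite Esc.
apply/eqP; rewrite -subr_eq0 -normr_le0; apply/ler_addgt0Pl => e e0; rewrite addr0.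
have d0 : 0 < e / (2 * N) by rewrite divr_gt0// mulr_gt0.
have [n [n1 n2]] : exists n, (\int[mu]_(t in D) (L2dist Om (sc_fun (s n) t) (F t))%:E
     < (e / (2 * N))%:E)%E /\ L2dist Om (sc_integral D (s n)) G < e / (2 * N).
  have /fine_cvgP[nf /cvgrPdist_lt/(_ _ d0) nl] := sF.
  have /cvgrPdist_lt/(_ _ d0) ng := sG.
  near \oo => n; exists n; split.
    have fn : (\int[mu]_(t in D) (L2dist Om (sc_fun (s n) t) (F t))%:E \is a fin_num)%E.
      by near: n.
    rewrite -(fineK fn) lte_fin.
    have : `|0 - fine (\int[mu]_(t in D) (L2dist Om (sc_fun (s n) t) (F t))%:E)%E| < e / (2 * N).
      by near: n.
    by rewrite sub0r normrN; apply: le_lt_trans; exact: ler_norm.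
  have : `|0 - L2dist Om (sc_integral D (s n)) G| < e / (2 * N) by near: n.
  by rewrite sub0r normrN; apply: le_lt_trans; exact: ler_norm.
have [I1 E1] := IE n.
have A1 : `|ip Om G v - ip Om (sc_integral D (s n)) v| <= e / 2.
  rewrite -ipBl//; apply: le_trans (cauchy_schwarz mOm (L2_sub mOm LG (Lsi n)) Lv) _.
  rewrite -/(L2dist _ _ _) L2distC.
  have -> : e / 2 = e / (2 * N) * N by field; rewrite gt_eqF.
  by apply: ler_pM => //; [exact: L2dist_ge0|exact: L2norm_ge0|exact: ltW].
have A2 : `|ip Om (sc_integral D (s n)) v - \int[mu]_(t in D) ip Om (F t) v| <= e / 2.
  rewrite -E1 -RintegralB//.
  have I2 := integrableB mD I1 intF.
  apply: (le_trans (le_normr_Rintegral mD I2)).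
  have I3 := integrable_abse I2.
  rewrite -lee_fin /Rintegral fineK; last exact: integrable_fin_num I3.
  have -> : e / 2 = N * (e / (2 * N)) by field; rewrite gt_eqF.
  rewrite EFinM.
  apply: (@le_trans _ _ (N%:E * \int[mu]_(t in D)
     (N^-1 * `|ip Om (sc_fun (s n) t) v - ip Om (F t) v|)%:E)%E).
    under [in leRHS]eq_integral do rewrite EFinM.
    rewrite (integralZl mD I3) muleA -EFinM mulfV ?gt_eqF// mul1e.
    by [].
  rewrite lee_pmul2l//; apply: le_trans (ltW n1); apply: ge0_le_integral_any => t Dt.
    by rewrite lee_fin mulr_ge0 ?invr_ge0 ?(ltW N0).
  rewrite lee_fin ler_pdivrMl// -ipBl//; last exact: LF.
  apply: le_trans (cauchy_schwarz mOm (L2_sub mOm (Lsc n t) (LF t Dt)) Lv) _.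
  by rewrite mulrC ler_wpM2r ?L2norm_ge0.
rewrite -(subrK (ip Om (sc_integral D (s n)) v) (ip Om G v)) -addrA.
by apply: (le_trans (ler_normD _ _)); rewrite [leRHS]splitr lerD.
Unshelve. all: by end_near. Qed.

End bochner_pairing.

Section curve.
Context {R : realType} {d : nat}.
Variable Om : set 'rV[R]_d.
Hypothesis mOm : measurable Om.
Local Notation mu := (@lebesgue_measure R).
Local Notation fct := ('rV[R]_d -> R).
Implicit Types (u V : R -> fct) (v : fct) (D : set R).

Lemma cvg_within_eps D (g : R -> R) (t : R) :
  g s @[s --> within D (nbhs t)] --> (0 : R) -> (forall s, 0 <= g s) ->
  forall e, 0 < e -> exists2 del, 0 < del &
    forall s, D s -> `|s - t| < del -> g s < e.
Proof.
move=> gt g0 e e0; have /cvgrPdist_lt/(_ _ e0) := gt.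
rewrite near_withinE => /nbhs_ballP[del /= d0 H]; exists del => // s Ds st.
have := H s; rewrite /ball/= distrC => /(_ st Ds).
by rewrite sub0r normrN ger0_norm.
Qed.

Lemma cvg_within_dnbhs_eps D (g : R -> R) (t : R) :
  g s @[s --> within D t^'] --> (0 : R) -> (forall s, 0 <= g s) ->
  forall e, 0 < e -> exists2 del, 0 < del &
    forall s, D s -> s != t -> `|s - t| < del -> g s < e.
Proof.
move=> gt g0 e e0; have /cvgrPdist_lt/(_ _ e0) := gt.
rewrite near_withinE => /nbhs_ballP[del /= d0 H]; exists del => // s Ds sn st.
have := H s; rewrite /ball/= distrC => /(_ st sn Ds).
by rewrite sub0r normrN ger0_norm.
Qed.

Lemma curve_ip_continuous D F v t : open_nbhs t D ->
  continuous_curve (L2 Om) (L2dist Om) D F -> L2 Om v ->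
  {for t, continuous (fun s => ip Om (F s) v)}.
Proof.
move=> [oD Dt] cF Lv; have [LF Ft] := cF _ Dt.
apply/cvgrPdist_lt => e e0.
have N0 : 0 < L2norm Om v + 1 by rewrite ltr_wpDl ?L2norm_ge0.
have [del d0 H] := cvg_within_eps Ft (fun s => L2dist_ge0 _ _ _) (divr_gt0 e0 N0).
have nD : nbhs t D by exact: open_nbhs_nbhs.
near=> s.
have Ds : D s by near: s.
have st : `|s - t| < del.
  by rewrite distrC; near: s; exact: (@nbhsx_ballx _ _ t del).
have Ls := (cF _ Ds).1.
rewrite -ipBl//; apply: le_lt_trans (cauchy_schwarz mOm (L2_sub mOm LF Ls) Lv) _.
rewrite -/(L2dist _ _ _) L2distC.
apply: (@le_lt_trans _ _ (L2dist Om (F s) (F t) * (L2norm Om v + 1))).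
  by rewrite ler_wpM2l ?L2dist_ge0// lerDl.
by rewrite -ltr_pdivlMr// H.
Unshelve. all: by end_near. Qed.

Lemma curve_ip_derive T u V v t : 0 < t < T ->
  (forall s, 0 <= s <= T -> L2 Om (u s)) -> (forall s, 0 < s <= T -> L2 Om (V s)) ->
  is_time_derivative Om `]0, T] u V -> L2 Om v ->
  is_derive t 1 (fun s => ip Om (u s) v) (ip Om (V t) v).
Proof.
move=> /andP[t0 tT] Lu LV uV Lv.
have Lut : L2 Om (u t) by apply: Lu; rewrite !ltW.
have LVt : L2 Om (V t) by apply: LV; rewrite t0 ltW.
have Dt : `]0, T]%classic t by rewrite /= in_itv/= t0 ltW.
have N0 : 0 < L2norm Om v + 1 by rewrite ltr_wpDl ?L2norm_ge0.
have lim : (fun h : R => h^-1 *: ((fun s => ip Om (u s) v) (h *: 1 + t) - ip Om (u t) v))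
    @ 0^' --> ip Om (V t) v.
  apply/cvgrPdist_lt => e e0.
  have [del d0 H] := cvg_within_dnbhs_eps (uV _ Dt)
    (fun s => L2dist_ge0 _ _ _) (divr_gt0 e0 N0).
  near=> h.
  have hn : h != 0 by near: h; exact: nbhs_dnbhs_neq.
  have hd : `|h| < Num.min del (Num.min t (T - t)).
    near: h; apply: dnbhs0_lt.
    by rewrite !lt_min d0 t0 subr_gt0.
  have {hd} [hd [ht hT]] : `|h| < del /\ `|h| < t /\ `|h| < T - t.
    by move: hd; rewrite !lt_min => /and3P[].
  have hp : -`|h| <= h <= `|h| by rewrite -ler_norml.
  rewrite /GRing.scale/= mulr1.
  have Ds : 0 < h + t <= T by lra.
  have Ls : L2 Om (u (h + t)) by apply: Lu; case/andP: Ds => /ltW -> ->.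
  have := H (h + t) Ds; rewrite addrK => /(_ _ hd).
  have -> : h + t != t by rewrite -subr_eq0 addrK.
  move=> /(_ isT) => Hh.
  have LD : L2 Om (h^-1 *: (u (h + t) - u t)) by apply: L2_scale => //; exact: L2_sub.
  have -> : ip Om (V t) v - h^-1 * (ip Om (u (h + t)) v - ip Om (u t) v) =
     ip Om (V t - h^-1 *: (u (h + t) - u t)) v.
    by rewrite ipBl// ipZl//; [rewrite ipBl|exact: L2_sub].
  apply: le_lt_trans (cauchy_schwarz mOm (L2_sub mOm LVt LD) Lv) _.
  rewrite -/(L2dist _ _ _) L2distC.
  apply: (@le_lt_trans _ _ (L2dist Om (h^-1 *: (u (h + t) - u t)) (V t) * (L2norm Om v + 1))).
    by rewrite ler_wpM2l ?L2dist_ge0// lerDl.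
  by rewrite -ltr_pdivlMr.
apply: DeriveDef; first by apply/cvg_ex; exists (ip Om (V t) v).
exact: cvg_lim lim.
Unshelve. all: by end_near. Qed.

(** Mean value theorem for the pairing of the curve with its own increment u q -
    u p. *)
Lemma curve_lipschitz T u V L p q :
  (forall s, 0 <= s <= T -> L2 Om (u s)) -> (forall s, 0 < s <= T -> L2 Om (V s)) ->
  is_time_derivative Om `]0, T] u V -> 0 < p -> p <= q -> q < T ->
  (forall s, p <= s <= q -> L2norm Om (V s) <= L) ->
  L2dist Om (u q) (u p) <= L * (q - p).
Proof.
move=> Lu LV uV p0 pq qT VL.
have [->|pnq] := eqVneq p q; first by rewrite subrr mulr0 L2distxx.
have {pnq}pq' : p < q by rewrite lt_neqAle pnq.
have Lp : L2 Om (u p) by apply: Lu; rewrite ltW//= (le_trans pq)// ltW.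
have Lq : L2 Om (u q) by apply: Lu; rewrite (ltW (lt_trans p0 pq'))//= ltW.
have Lv := L2_sub mOm Lq Lp; set v := u q - u p in Lv.
have dd s : p <= s <= q -> is_derive s 1 (fun s => ip Om (u s) v) (ip Om (V s) v).
  move=> /andP[ps sq]; apply: (curve_ip_derive (T := T)) => //.
  by rewrite (lt_le_trans p0 ps) (le_lt_trans sq qT).
have [||c cpq E] := @MVT R (fun s => ip Om (u s) v) (fun s => ip Om (V s) v) p q pq'.
- by move=> x; rewrite in_itv/= => /andP[px xq]; apply: dd; rewrite !ltW.
- apply: derivable_within_continuous => x; rewrite in_itv/= => xpq.
  exact: (ex_derive (is_derive := dd _ xpq)).
have cpq' : p <= c <= q by move: cpq; rewrite in_itv/= => /andP[/ltW -> /ltW ->].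
have LVc : L2 Om (V c).
  case/andP: cpq' => pc cq; apply: LV.
  by rewrite (lt_le_trans p0 pc) (le_trans cq)// ltW.
have E2 : L2norm Om v ^+ 2 = ip Om (V c) v * (q - p).
  by rewrite sqr_L2norm// {1}/v ipBl.
have h1 : ip Om (V c) v <= L * L2norm Om v.
  apply: le_trans (ip_le mOm LVc Lv) _.
  by rewrite ler_wpM2r ?L2norm_ge0// VL.
have h2 : L2norm Om v ^+ 2 <= (L * (q - p)) * L2norm Om v.
  by rewrite E2 mulrAC ler_wpM2r// subr_ge0.
have [v0|vn] := eqVneq (L2norm Om v) 0.
  rewrite /L2dist -/v v0 mulr_ge0 ?subr_ge0//.
  exact: le_trans (L2norm_ge0 _ _) (VL _ cpq').
have v1 : 0 < L2norm Om v by rewrite lt_neqAle eq_sym vn L2norm_ge0.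
by rewrite /L2dist -/v -(ler_pM2r v1) -expr2.
Qed.

End curve.

Section scalar_marchaud.
Context {R : realType}.
Local Notation mu := (@lebesgue_measure R).
Variable a : R.
Hypothesis a01 : 0 < a < 1.
Let a0 : 0 < a. Proof. by case/andP: a01. Qed.
Let a1 : 0 < 1 - a. Proof. by case/andP: a01; lra. Qed.

Lemma measurable_reflect_fun (f : R -> R) (t : R) : measurable_fun setT f ->
  measurable_fun setT (fun s : R => f (t - s)).
Proof. by move=> mf; apply: measurableT_comp => //; exact: measurable_funB. Qed.

(** Lipschitz near the present and bounded in the past: the form in which
    increments of solutions are tame. *)
Lemma tame_near_far (h : R -> R) (L B del : R) : measurable_fun setT h ->
  0 <= L -> 0 <= B -> 0 < del ->
  (forall r, 0 < r -> r < del -> `|h r| <= L * r) ->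
  (forall r, 0 < r -> `|h r| <= B) -> tame h.
Proof.
move=> mh L0 B0 d0 hL hB; split => //; exists (L + B + B / del) => r r0.
have Bd : 0 <= B / del by rewrite divr_ge0 ?(ltW d0).
have [r1|r1] := leP 1 r.
  by rewrite mulr1; have := hB _ r0; lra.
have [rd|rd] := ltP r del.
  have Br : 0 <= B * r by rewrite mulr_ge0// ltW.
  have Bdr : 0 <= B / del * r by rewrite mulr_ge0// ltW.
  by rewrite !mulrDl; have := hL _ r0 rd; lra.
have : B <= B / del * r.
  by rewrite mulrAC -mulrA ler_peMr// ler_pdivlMr// mul1r.
have Br : 0 <= B * r by rewrite mulr_ge0// ltW.
have Lr : 0 <= L * r by rewrite mulr_ge0// ltW.
by rewrite !mulrDl; have := hB _ r0; lra.
Qed.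

Lemma measurable_itvR (t : R) :
  measurable (`]0, t[%classic : set (measurableTypeR R)).
Proof. exact: measurable_itv. Qed.

Lemma singular_integrable (t : R) : 0 < t ->
  mu.-integrable `]0, t[ (EFin \o (fun s => s `^ (a - 1) + (t - s) `^ (- a))).
Proof.
move=> t0.
have i1 (b : R) : 0 < b -> mu.-integrable `]0, t[ (EFin \o (fun s : R => s `^ (b - 1))).
  move=> b0; apply/integrableP; split; first exact: measurable_powR_EFin.
  under eq_integral do rewrite /= ger0_norm ?powR_ge0//.
  by rewrite integral_powR_0// ltry.
have i2 : mu.-integrable `]0, t[ (EFin \o (fun s : R => (t - s) `^ (- a))).
  apply: (integrable_reflect (t := t)) => //.
    apply/measurable_EFinP; apply: measurable_funTS; apply: (@measurable_reflect_fun (fun x => x `^ (- a))); exact: measurable_powR.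
  rewrite reflect_oo; apply: eq_integrable (i1 (1 - a) a1) => // r _ /=.
  by rewrite subKr; congr (_ `^ _)%:E; lra.
have mI := measurable_itvR t.
exact: (integrableD mI (i1 a a0) i2).
Qed.

Lemma singular_arith (x y z w : R) : 0 <= x -> 0 <= y -> 0 <= z -> 0 <= w ->
  y <= z \/ x <= w -> x * y <= (z + w) * (x + y).
Proof.
move=> x0 y0 z0 w0 h.
have zx := mulr_ge0 z0 x0; have zy := mulr_ge0 z0 y0.
have wx := mulr_ge0 w0 x0; have wy := mulr_ge0 w0 y0.
have : x * y <= z * x \/ x * y <= w * y.
  by case: h => h; [left; rewrite mulrC ler_wpM2r|right; rewrite ler_wpM2r].
by rewrite mulrDl !mulrDr => -[]; lra.
Qed.

(** On each half of (0, t) only one of the two singularities occurs, so that the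
    product of the powers is of the size of their sum. *)
Lemma singular_bound (t s : R) : 0 < s -> s < t ->
  s `^ (a - 1) * (t - s) `^ (- a) <=
  ((t / 2) `^ (- a) + (t / 2) `^ (a - 1)) * (s `^ (a - 1) + (t - s) `^ (- a)).
Proof.
move=> s0 st.
have [A0 B0] : 0 <= s `^ (a - 1) /\ 0 <= (t - s) `^ (- a) by rewrite !powR_ge0.
have [C0 D0] : 0 <= (t / 2) `^ (- a) /\ 0 <= (t / 2) `^ (a - 1) by rewrite !powR_ge0.
have [h|h] := leP s (t / 2).
  have : (t - s) `^ (- a) <= (t / 2) `^ (- a) by apply: powR_anti; have := a0; lra.
  by move=> h1; apply: singular_arith => //; left.
have : s `^ (a - 1) <= (t / 2) `^ (a - 1) by apply: powR_anti; have := a1; lra.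
by move=> h1; apply: singular_arith => //; right.
Qed.

Variables (phi psi : R -> R) (t L B C : R).
Hypotheses (t0 : 0 < t) (L0 : 0 <= L) (B0 : 0 <= B) (C0 : 0 <= C)
  (cphi : continuous (fun s : R => phi (Num.max s 0)))
  (dphi : forall s, 0 < s < t -> is_derive s 1 phi (psi s))
  (cpsi : forall s, 0 < s < t -> {for s, continuous psi})
  (phiB : forall s, 0 <= s <= t -> `|phi t - phi s| <= B)
  (phiL : forall s, t / 2 <= s <= t -> `|phi t - phi s| <= L * (t - s))
  (psiC : forall s, 0 < s < t -> `|psi s| <= C * s `^ (a - 1)).

Lemma history_tame : tame (fun r => phi t - phi (Num.max (t - r) 0)).
Proof.
have rng r : 0 < r -> 0 <= Num.max (t - r) 0 <= t.
  by move=> r0; rewrite le_max lexx orbT/= ge_max (ltW t0) andbT gerBl ltW.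
apply: (@tame_near_far _ L B (t / 2)) => //.
- apply: measurable_funB => //.
  apply: (@measurable_reflect_fun (fun s => phi (Num.max s 0))).
  exact: continuous_measurable_fun.
- by rewrite divr_gt0.
- move=> r r0 rt.
  have -> : Num.max (t - r) 0 = t - r by rewrite max_l//; lra.
  by apply: le_trans (phiL _) _; [lra|rewrite subKr].
- by move=> r r0; apply: phiB; exact: rng.
Qed.

Lemma marchaud_integrable :
  mu.-integrable `]0, t[ (EFin \o (fun s => (t - s) `^ (- a) * psi s)).
Proof.
pose K := C * ((t / 2) `^ (- a) + (t / 2) `^ (a - 1)).
apply: (@le_integrable _ _ _ mu `]0, t[%classic (measurable_itvR t) _
   (fun s => K%:E * (s `^ (a - 1) + (t - s) `^ (- a))%:E)%E).
- apply/measurable_EFinP; apply: measurable_funM.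
    apply: measurable_funTS; apply: (@measurable_reflect_fun (fun x => x `^ (- a))); exact: measurable_powR.
  apply: open_continuous_measurable_fun; first exact: interval_open.
  by move=> s /set_mem; rewrite /= in_itv/=; exact: cpsi.
- move=> s; rewrite /= in_itv/= => st; have /andP[s0 st'] := st.
  rewrite lee_fin normrM (ger0_norm (powR_ge0 _ _)) [leRHS]ger0_norm; last first.
    by rewrite !mulr_ge0// addr_ge0 ?powR_ge0.
  apply: le_trans (ler_wpM2l (powR_ge0 _ _) (psiC st)) _.
  rewrite mulrCA -mulrA ler_wpM2l// mulrC; exact: singular_bound.
- exact: (integrableZl (measurable_itvR t) _ (singular_integrable t0)).
Qed.

(** Integration by parts with the primitive [phi s - phi t] of [psi]:
    subtracting the value at t makes the boundary term at t vanish, since phi is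
    Lipschitz there. The boundary term at 0 is the tail of the memory integral.
    *)
Lemma scalar_marchaud :
  \int[mu]_(s in `]0, t[) ((t - s) `^ (- a) * psi s) =
  a * memory a (fun r => phi t - phi (Num.max (t - r) 0)).
Proof.
have [-> ik] := @memory_history _ a a01 (fun s => phi t - phi s) t t0 history_tame.
pose F s := (phi s - phi t) * (t - s) `^ (- a).
pose F' s := (t - s) `^ (- a) * psi s - a * ((phi t - phi s) * ker a (t - s)).
have dF s : 0 < s < t -> is_derive s 1 F (F' s).
  move=> st; have ts : 0 < t - s by case/andP: st; lra.
  have d1 := dphi st.
  have d2 : is_derive s 1 (fun s => t - s) (- 1 : R).
    by apply: is_derive_eq; rewrite add0r mul1r.
  have d3 : is_derive s 1 (fun s => (t - s) `^ (- a)) (- a * (t - s) `^ (- a - 1) * -1).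
    have d4 := is_derive1_powR (- a) ts.
    exact: (is_derive1_comp (f := fun x => x `^ (- a)) (g := fun s => t - s)).
  have d5 : is_derive s 1 (fun s => phi s - phi t) (psi s).
    by apply: is_derive_eq; rewrite subr0.
  apply: is_derive_eq.
  rewrite /F' /ker opprD /GRing.scale/=; ring.
have cphi' s : 0 < s < t -> {for s, continuous phi}.
  move=> st; apply: differentiable_continuous; apply/derivable1_diffP.
  exact: (ex_derive (is_derive := dphi st)).
have cpow p s : s < t -> {for s, continuous (fun s : R => (t - s) `^ p)}.
  move=> st; apply: (@continuous_comp _ _ _ (fun s => t - s) (fun x : R => x `^ p)).
    by apply: cvgB; [exact: cvg_cst|exact: cvg_id].
  by apply: continuous_powR; rewrite subr_gt0.
have cF' s : 0 < s < t -> {for s, continuous F'}.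
  move=> st; have st' : s < t by case/andP: st.
  apply: cvgB; first by apply: cvgM; [exact: cpow|exact: cpsi].
  apply: cvgM; first exact: cvg_cst.
  apply: cvgM; last exact: cpow.
  by apply: cvgB; [exact: cvg_cst|exact: cphi'].
have F0 : F s @[s --> 0^'+] --> (phi 0 - phi t) * t `^ (- a).
  apply: cvgM; last first.
    by rewrite -[X in _ --> X `^ _](subr0 t); apply: cvg_at_right_filter; exact: cpow.
  apply: cvgB; last exact: cvg_cst.
  have c0 : (fun s : R => phi (Num.max s 0)) @ (0 : R) --> phi (Num.max 0 0) by exact: cphi.
  have := cvg_at_right_filter c0; rewrite maxxx.
  apply: cvg_trans; apply: near_eq_cvg; near=> s.
  by rewrite max_l.
have Ft : F s @[s --> t^'-] --> (0 : R).
  apply/cvgrPdist_lt => e e0.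
  have L1 : 0 < L + 1 by rewrite ltr_wpDl.
  have /cvgrPdist_lt/(_ _ (divr_gt0 e0 L1)) := powR_cvg0 a1.
  rewrite near_withinE => /nbhs_ballP[del /= d0 H].
  near=> s.
  have st : s < t by near: s; exact: nbhs_left_lt.
  have s2 : t / 2 <= s by near: s; apply: nbhs_left_ge; rewrite ltr_pdivrMr// ltr_pMr ?ltr1n.
  have sd : t - del < s by near: s; apply: nbhs_left_gt; rewrite ltrBlDr ltrDl.
  have ts0 : 0 < t - s by rewrite subr_gt0.
  have := H (t - s); rewrite /ball/= sub0r normrN gtr0_norm//.
  have -> : t - s < del by lra.
  move=> /(_ isT ts0); rewrite sub0r normrN ger0_norm ?powR_ge0// => h.
  rewrite sub0r normrN /F normrM distrC (ger0_norm (powR_ge0 _ _)).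
  have phs : `|phi t - phi s| <= L * (t - s) by apply: phiL; rewrite s2 ltW.
  apply: le_lt_trans (ler_wpM2r (powR_ge0 _ _) phs) _.
  have -> : L * (t - s) * (t - s) `^ (- a) = L * (t - s) `^ (1 - a).
    rewrite -mulrA; congr (_ * _).
    rewrite -[X in X * _]powRr1 ?(ltW ts0)// -powRD//.
    by rewrite (gt_eqF ts0) implybT.
  apply: (@le_lt_trans _ _ ((L + 1) * (t - s) `^ (1 - a))).
    by rewrite ler_wpM2r ?powR_ge0// lerDl.
  by rewrite mulrC -ltr_pdivlMr.
have iF' : mu.-integrable `]0, t[ (EFin \o F').
  exact: (integrableB (measurable_itvR t) marchaud_integrable
    (integrableZl (measurable_itvR t) a ik)).
have := FTC_oo F' F 0 t _ _ t0 cF' dF F0 Ft iF'.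
rewrite /F' RintegralB//; last 2 first.
- exact: marchaud_integrable.
- exact: (integrableZl (measurable_itvR t) _ ik).
rewrite RintegralZl// => E.
have an : a != 0 by rewrite gt_eqF.
move/eqP: E; rewrite subr_eq => /eqP ->.
by field.
Unshelve. all: by end_near. Qed.

End scalar_marchaud.

(** * Solutions as curves with memory *)

Lemma potential_arith (R : realFieldType) (g e l r : R) :
  - g * (- e ^+ 2 * l + r) = g * (e ^+ 2 * l - r).
Proof. by ring. Qed.

Section evolution.
Context {R : realType} {d : nat}.
Variable Om : set 'rV[R]_d.
Hypotheses (Om_open : open Om) (Om_bounded : bounded_set Om).
Variables (gamma eps : R) (u0 : 'rV[R]_d -> R).
Hypothesis gamma_gt0 : 0 < gamma.
Local Notation mu := (@lebesgue_measure R).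
Local Notation fct := ('rV[R]_d -> R).
Implicit Types (u V G : R -> fct) (v : fct).

Let mOm : measurable Om. Proof. exact: measurable_open_rV. Qed.

(** The curve extended by its initial value to negative times. *)
Definition past u (s : R) : fct := u (Num.max s 0).

(** The properties of a solution on which the three limits rest. The equation is
    tested, and its derivative is in Marchaud form; the last field reflects that
    the Caputo derivative has a limit in L2 at time 0. *)
Record evolution (a : R) u : Prop := {
  evo_H2 : forall t, 0 <= t -> H2 Om (u t) ;
  evo_H10 : forall t, 0 <= t -> H10 Om (u t) ;
  evo_init : aeeq Om (u 0) u0 ;
  evo_bounded : exists2 M, 0 <= M & forall t, 0 <= t -> bounded_ae Om M (u t) ;
  evo_holder : forall T, 0 < T -> exists2 K, 0 <= K & forall s t,
    0 <= s <= T -> 0 <= t <= T -> L2dist Om (u t) (u s) <= K * `|t - s| `^ a ;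
  evo_lipschitz : forall p q, 0 < p -> p <= q -> exists2 L, 0 <= L &
    forall s t, p <= s -> s <= t -> t <= q -> L2dist Om (u t) (u s) <= L * (t - s) ;
  evo_equation : forall t v, 0 < t -> L2 Om v ->
    - gamma * ip Om (chemical_potential Om eps (u t)) v =
    a / Gamma (1 - a) * memory a (fun r => ip Om (u t - past u (t - r)) v) ;
  evo_potential0 : exists B, exists2 del, 0 < del &
    forall t, 0 < t < del -> L2norm Om (chemical_potential Om eps (u t)) <= B }.

Lemma past_nonneg u s : 0 <= s -> past u s = u s.
Proof. by move=> s0; rewrite /past max_l. Qed.

Section holder_continuity.
Variables (a : R) (u : R -> fct).
Hypotheses (a01 : 0 < a < 1)
  (Lu : forall t, 0 <= t -> L2 Om (u t))
  (Hu : forall T, 0 < T -> exists2 K, 0 <= K & forall s t,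
    0 <= s <= T -> 0 <= t <= T -> L2dist Om (u t) (u s) <= K * `|t - s| `^ a).

Let a0 : 0 < a. Proof. by case/andP: a01. Qed.

Lemma past_L2 s : L2 Om (past u s).
Proof. by apply: Lu; rewrite le_max lexx orbT. Qed.

Lemma max0_lipschitz (x y : R) : `|Num.max x 0 - Num.max y 0| <= `|x - y|.
Proof.
have hx := ler_norm (x - y); have hy := ler_norm (y - x); rewrite distrC in hy.
by have [x0|x0] := leP x 0; have [y0|y0] := leP y 0; rewrite ler_norml; apply/andP; split; lra.
Qed.

(** The extension to negative times does not spoil the Hölder bound, because
    clamping is 1-Lipschitz. *)
Lemma past_eps s e : 0 < e -> exists2 del, 0 < del &
  forall s', `|s' - s| < del -> L2dist Om (past u s') (past u s) < e.
Proof.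
move=> e0; have T0 : 0 < `|s| + 1 by rewrite ltr_wpDl.
have [K K0 HK] := Hu T0.
have K1 : 0 < K + 1 by rewrite ltr_wpDl.
pose eta := (e / (K + 1)) `^ a^-1.
have eta0 : 0 < eta by apply: powR_gt0; rewrite divr_gt0.
exists (Num.min 1 eta) => [|s']; first by rewrite lt_min ltr01.
rewrite lt_min => /andP[s1 se].
have hs := ler_norm s.
have dom x : `|x - s| < 1 -> 0 <= Num.max x 0 <= `|s| + 1.
  move=> xs; rewrite le_max lexx orbT/= ge_max (ltW T0) andbT.
  by have := ler_norm (x - s); lra.
apply: le_lt_trans (HK _ _ (dom s _) (dom s' s1)) _; first by rewrite subrr normr0.
have le1 : `|Num.max s' 0 - Num.max s 0| `^ a <= e / (K + 1).
  rewrite (_ : e / (K + 1) = eta `^ a); last first.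
    by rewrite /eta -powRrM mulVf ?gt_eqF// powRr1// ltW// divr_gt0.
  rewrite ge0_ler_powR ?nnegrE ?(ltW a0) ?(ltW eta0)//.
  by apply: le_trans (max0_lipschitz _ _) (ltW se).
apply: le_lt_trans (ler_wpM2l K0 le1) _.
rewrite mulrCA -[X in _ < X]mulr1 ltr_pM2l// ltr_pdivrMr// mul1r ltrDl//.
Qed.

Lemma past_ip_continuous v : L2 Om v -> continuous (fun s : R => ip Om (past u s) v).
Proof.
move=> Lv s; apply/cvgrPdist_lt => e e0.
have N0 : 0 < L2norm Om v + 1 by rewrite ltr_wpDl ?L2norm_ge0.
have [del d0 H] := past_eps s (divr_gt0 e0 N0).
near=> s'.
have st : `|s' - s| < del.
  by rewrite distrC; near: s'; exact: (@nbhsx_ballx _ _ s del).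
rewrite distrC -(ipBl mOm (past_L2 s') (past_L2 s) Lv).
apply: le_lt_trans (cauchy_schwarz mOm (L2_sub mOm (past_L2 _) (past_L2 _)) Lv) _.
apply: (@le_lt_trans _ _ (L2dist Om (past u s') (past u s) * (L2norm Om v + 1))).
  by rewrite ler_wpM2l ?L2dist_ge0// lerDl.
by rewrite -ltr_pdivlMr// H.
Unshelve. all: by end_near. Qed.

Lemma past_dist_continuous v : L2 Om v -> continuous (fun s : R => L2dist Om (past u s) v).
Proof.
move=> Lv s; apply/cvgrPdist_lt => e e0.
have [del d0 H] := past_eps s e0.
near=> s'.
have st : `|s' - s| < del.
  by rewrite distrC; near: s'; exact: (@nbhsx_ballx _ _ s del).
have h := H _ st.
have h1 := L2dist_triangle mOm (past_L2 s) (past_L2 s') Lv.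
have h2 := L2dist_triangle mOm (past_L2 s') (past_L2 s) Lv.
rewrite (L2distC _ (past u s) (past u s')) in h1.
move: h h1 h2; move: (L2dist _ _ _) (L2dist _ _ _) (L2dist _ _ _) => x y z h h1 h2.
by rewrite ltr_norml; apply/andP; split; lra.
Unshelve. all: by end_near. Qed.

End holder_continuity.

(** After pairing with v, the Caputo derivative is the integral of a scalar
    function, to which [scalar_marchaud] applies: the bound on the time
    derivative controls the singularity at time 0, and the local Lipschitz bound
    the one at time t. The essential bound on u holds at every time by
    continuity in L2. *)
Lemma solution_evolution a u : 0 < a < 1 ->
  global_bounded_solution Om gamma eps u0 a u -> evolution a u.
Proof.
move=> a01 [sol bu].
have a0 : 0 < a by case/andP: a01.
have uX t : 0 <= t -> H2 Om (u t) /\ H10 Om (u t).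
  move=> t0; have T0 : 0 < t + 1 by rewrite ltr_wpDl.
  have [V [G S]] := sol _ T0.
  have tD : `[0, t + 1]%classic t by rewrite /= in_itv/= t0/= lerDl.
  by have [[H2t H10t] _] := solves_continuous S tD; split.
have Lu t : 0 <= t -> L2 Om (u t) by move=> /uX[/H2_H1/H1_L2].
have Hu T : 0 < T -> exists2 K, 0 <= K & forall s t,
    0 <= s <= T -> 0 <= t <= T -> L2dist Om (u t) (u s) <= K * `|t - s| `^ a.
  move=> T0; have [V [G S]] := sol _ T0.
  have [_ [K HK]] := solves_holder S.
  exists (Num.max K 0); first by rewrite le_max lexx orbT.
  move=> s t sT tT; apply: le_trans (HK s t _ _) _; rewrite ?/= ?in_itv//=.
  by rewrite ler_wpM2r ?powR_ge0// le_max lexx.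
have lip p q : 0 < p -> p <= q -> exists2 L, 0 <= L &
    forall s t, p <= s -> s <= t -> t <= q -> L2dist Om (u t) (u s) <= L * (t - s).
  move=> p0 pq; have T0 : 0 < q + 1 by rewrite ltr_wpDl// (le_trans (ltW p0)).
  have [V [G S]] := sol _ T0.
  have [C HC] := solves_derivative_bound S.
  exists (`|C| * p `^ (a - 1)); first by rewrite mulr_ge0 ?powR_ge0.
  move=> s t ps st tq; have s0 := lt_le_trans p0 ps.
  have LV x : 0 < x <= q + 1 -> L2 Om (V x).
    move=> x0; have xD : `]0, q + 1]%classic x by rewrite /= in_itv.
    by have [] := solves_continuous_derivative S xD.
  apply: (curve_lipschitz mOm (T := q + 1) (V := V)) => //.
  - by move=> x /andP[x0 _]; exact: Lu.
  - exact: solves_time_derivative S.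
  - by rewrite (le_lt_trans tq)// ltrDl.
  - move=> x /andP[sx xt]; have x0 := lt_le_trans s0 sx.
    apply: le_trans (HC x _) _.
      by rewrite x0 (le_trans xt)// (le_trans tq)// lerDl.
    apply: (@le_trans _ _ (`|C| * x `^ (a - 1))).
      by rewrite ler_wpM2r ?powR_ge0// ler_norm.
    rewrite ler_wpM2l//; apply: powR_anti => //; last exact: le_trans sx.
    by rewrite subr_le0 ltW//; case/andP: a01.
have Mb : exists2 M, 0 <= M & forall t, 0 <= t -> bounded_ae Om M (u t).
  have [M M0 HM] := essentially_bounded_slices bu.
  exists M => //; apply: right_continuous_bounded_ae => //.
    move=> t t0 e e0; have [del d0 H] := past_eps a01 Hu t e0.
    exists del => // s /andP[ts sd].
    have := H s; rewrite !past_nonneg ?(le_trans t0 (ltW ts))// L2distC; apply.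
    by rewrite gtr0_norm ?subr_gt0// ltrBlDl.
  case: HM => N [mN N0 sub]; exists N; split => // t nt; apply: sub => h.
  by apply: nt => t0; apply: h; rewrite /= in_itv/= t0.
have [M M0 bM] := Mb.
split => //.
- by move=> t /uX[].
- by move=> t /uX[].
- by have [V [G S]] := sol _ ltr01; exact: solves_init S.
- move=> t v t0 Lv; have T0 : 0 < t + 1 by rewrite ltr_wpDl// ltW.
  have [V [G S]] := sol _ T0.
  have tT : 0 < t <= t + 1 by rewrite t0/= lerDl.
  have LV x : 0 < x <= t + 1 -> L2 Om (V x).
    move=> x0; have xD : `]0, t + 1]%classic x by rewrite /= in_itv.
    by have [] := solves_continuous_derivative S xD.
  have LG : L2 Om (G t).
    have xD : `[0, t + 1]%classic t by rewrite /= in_itv/= ltW//= lerDl.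
    by have [] := solves_continuous_caputo S xD.
  have [H2t H10t] := uX t (ltW t0).
  have Lm := chemical_potential_L2 Om_open Om_bounded eps H2t (bM t (ltW t0)).
  rewrite -ipZl//.
  have -> : ip Om (- gamma *: chemical_potential Om eps (u t)) v = ip Om (G t) v.
    apply: eq_ip_ae => //; first exact: L2_scale.
    by apply: filterS (solves_eq S tT) => x + Ox => /(_ Ox) ->; exact: potential_arith.
  have [I bI GI] := solves_caputo S tT.
  have LI : L2 Om I by case: bI.
  have tin x : `]0, t[%classic x -> 0 < x <= t + 1.
    by rewrite /= in_itv/= => /andP[-> xt]; rewrite ltW// (lt_trans xt)// ltrDl.
  have cV x : 0 < x < t -> {for x, continuous (fun s => ip Om (V s) v)}.
    move=> /andP[x0 xt].
    apply: (@curve_ip_continuous _ _ _ mOm `]0, t + 1[%classic) => //.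
      split; first exact: interval_open.
      by rewrite /= in_itv/= x0 (lt_trans xt)// ltrDl.
    have cV := solves_continuous_derivative S.
    move=> y; rewrite /= in_itv/= => /andP[y0 yt].
    have yD : `]0, t + 1]%classic y by rewrite /= in_itv/= y0 ltW.
    have [Ly Hy] := cV _ yD; split => //.
    apply: cvg_trans Hy; apply: cvg_app; apply: within_subset => z.
    by rewrite /= !in_itv/= => /andP[-> /ltW ->].
  have [C HC] := solves_derivative_bound S.
  have [K K0 HK] := Hu t t0.
  have t20 : 0 < t / 2 by rewrite divr_gt0.
  have t2t : t / 2 <= t by rewrite ler_pdivrMr// ler_pMr// ler1n.
  have [L L0 HL] := lip (t / 2) t t20 t2t.
  have N0 := L2norm_ge0 Om v.
  have cphi : continuous (fun s : R => ip Om (u (Num.max s 0)) v).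
    by have := past_ip_continuous a01 Lu Hu Lv; apply.
  have dphi s : 0 < s < t -> is_derive s 1 (fun s => ip Om (u s) v) (ip Om (V s) v).
    move=> /andP[s0 st]; apply: (curve_ip_derive mOm (T := t + 1)) => //.
    - by rewrite s0 (lt_trans st)// ltrDl.
    - by move=> x /andP[x0 _]; exact: Lu.
    - exact: solves_time_derivative S.
  have dist_ip s : 0 <= s -> `|ip Om (u t) v - ip Om (u s) v| <= L2dist Om (u t) (u s) * L2norm Om v.
    move=> s0; have Lt := Lu t (ltW t0); have Ls := Lu s s0.
    by rewrite -ipBl//; exact: (cauchy_schwarz mOm (L2_sub mOm Lt Ls) Lv).
  have phiB s : 0 <= s <= t -> `|ip Om (u t) v - ip Om (u s) v| <= K * t `^ a * L2norm Om v.
    move=> /andP[s0 st]; apply: le_trans (dist_ip s s0) _.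
    rewrite ler_wpM2r//; apply: le_trans (HK s t _ _) _; rewrite ?s0 ?st ?lexx ?(ltW t0)//.
    rewrite ler_wpM2l// ge0_ler_powR ?nnegrE ?(ltW a0) ?(ltW t0)//.
    by rewrite ger0_norm ?subr_ge0// gerBl.
  have phiL s : t / 2 <= s <= t ->
      `|ip Om (u t) v - ip Om (u s) v| <= L * L2norm Om v * (t - s).
    move=> /andP[s2 st]; apply: le_trans (dist_ip s (le_trans (ltW t20) s2)) _.
    by rewrite mulrAC ler_wpM2r// HL.
  have psiC s : 0 < s < t -> `|ip Om (V s) v| <= `|C| * L2norm Om v * s `^ (a - 1).
    move=> /andP[s0 st].
    have sT : 0 < s <= t + 1 by rewrite s0 ltW// (lt_trans st)// ltrDl.
    apply: le_trans (cauchy_schwarz mOm (LV s sT) Lv) _.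
    rewrite mulrAC ler_wpM2r//; apply: le_trans (HC s sT) _.
    by rewrite ler_wpM2r ?powR_ge0// ler_norm.
  have LN0 : 0 <= L * L2norm Om v by rewrite mulr_ge0.
  have KN0 : 0 <= K * t `^ a * L2norm Om v by rewrite !mulr_ge0// powR_ge0.
  have CN0 : 0 <= `|C| * L2norm Om v by rewrite mulr_ge0.
  have mint := marchaud_integrable a01 t0 CN0 cV psiC.
  have smar := scalar_marchaud a01 t0 LN0 KN0 CN0 cphi dphi cV phiB phiL psiC.
  have FE x : `]0, t[%classic x -> ip Om ((t - x) `^ (- a) *: V x) v = (t - x) `^ (- a) * ip Om (V x) v.
    by move=> /tin xt; rewrite ipZl//; exact: LV.
  rewrite GI ipZl// (bochner_pairing mOm _ _ _ Lv _ bI)//.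
  + rewrite (_ : Rintegral _ _ _ = \int[mu]_(s in `]0, t[) ((t - s) `^ (- a) * ip Om (V s) v)).
      rewrite smar mulrA [_^-1 * a]mulrC; congr (_ * _).
      apply: eq_memory => r r0.
      have rt : 0 <= Num.max (t - r) 0 by rewrite le_max lexx orbT.
      by rewrite /past (ipBl mOm (Lu t (ltW t0)) (Lu _ rt) Lv).
    by apply: eq_Rintegral => x /set_mem /FE.
  + by rewrite lebesgue_measure_itv/= lte_fin t0 -EFinB ltry.
  + by move=> x /tin xt; apply: L2_scale => //; exact: LV.
  + by apply: eq_integrable mint => // x /set_mem /FE /= ->.
- have [V [G S]] := sol _ ltr01.
  have cG := solves_continuous_caputo S.
  have D0 : `[0, 1]%classic (0 : R) by rewrite /= in_itv/= lexx ler01.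
  have [LG0 G0] := cG _ D0.
  have [del d0 H] := cvg_within_eps G0 (fun s => L2dist_ge0 _ _ _) ltr01.
  exists (gamma^-1 * (L2norm Om (G 0) + 1)), (Num.min 1 del); first by rewrite lt_min ltr01.
  move=> t /andP[t0]; rewrite lt_min => /andP[t1 td].
  have tT : 0 < t <= 1 by rewrite t0 ltW.
  have Dt : `[0, 1]%classic t by rewrite /= in_itv/= !ltW.
  have [LG _] := cG _ Dt.
  have [H2t H10t] := uX t (ltW t0).
  have Lm := chemical_potential_L2 Om_open Om_bounded eps H2t (bM t (ltW t0)).
  have E : L2norm Om (- gamma *: chemical_potential Om eps (u t)) = L2norm Om (G t).
    apply: (eq_L2norm_ae mOm) => //; first exact: L2_scale.
    by apply: filterS (solves_eq S tT) => x + Ox => /(_ Ox) ->; exact: potential_arith.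
  rewrite mulrC ler_pdivlMr// mulrC.
  rewrite (L2normZ mOm) // normrN (gtr0_norm gamma_gt0) in E; rewrite E.
  have := H t Dt; rewrite subr0 gtr0_norm// => /(_ td) h.
  have -> : G t = (G t - G 0) + G 0 by rewrite subrK.
  apply: le_trans (L2normD mOm (L2_sub mOm LG LG0) LG0) _.
  by rewrite addrC lerD2l ltW.
Qed.

End evolution.

(** * Estimates of memory integrals *)

Section memory_estimates.
Context {R : realType}.
Local Notation mu := (@lebesgue_measure R).
Variable a : R.
Hypothesis a01 : 0 < a < 1.
Let a0 : 0 < a. Proof. by case/andP: a01. Qed.

Lemma tame_le (h k : R -> R) : measurable_fun setT h -> tame k ->
  (forall r, 0 < r -> `|h r| <= k r) -> tame h.
Proof.
move=> mh [_ [C kC]] hk; split => //; exists C => r r0.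
by apply: le_trans (hk _ r0) _; apply: le_trans (kC _ r0); exact: ler_norm.
Qed.

(** The kernel is decreasing, so an increment weighs less once it is pushed
    further into the past. *)
Lemma memory_shift_le (h : R -> R) (eta : R) : 0 <= eta ->
  tame h -> (forall r, 0 < r -> 0 <= h r) ->
  tame (fun r => if eta < r then h (r - eta) else 0) ->
  memory a (fun r => if eta < r then h (r - eta) else 0) <= memory a h.
Proof.
move=> e0 th h0 tk; have [mh _] := th; have [mk _] := tk.
set k := fun r => _ in tk mk *.
have ih := tame_integrable a a01 h th; have ik := tame_integrable a a01 k tk.
rewrite -lee_fin /memory /Rintegral !fineK; try exact: integrable_fin_num.
have mF : measurable_fun setT (fun r : R => (h r * ker a r)%:E).
  by apply/measurable_EFinP; apply: measurable_funM => //; exact: measurable_ker.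
have mT (t : R) (f : R -> \bar R) : measurable_fun setT f -> measurable_fun setT (fun r : R => f (t - r)).
  by move=> mf; apply: measurableT_comp => //; exact: measurable_funB.
have mD0 : measurable [set r : R | `]0, +oo[%classic (0 - r)].
  have -> : [set r : R | `]0, +oo[%classic (0 - r)] = `]-oo, 0[%classic.
    by apply/seteqP; split=> r; rewrite /= !in_itv/= ?andbT; lra.
  exact: measurable_itv.
have -> : (\int[mu]_(x in `]0%R, +oo[) (h x * ker a x)%:E =
    \int[mu]_(x in `]eta, +oo[) (h (x - eta) * ker a (x - eta))%:E)%E.
  have E x : 0 - (eta - x) = x - eta by ring.
  rewrite (integral_reflect 0 _ _ (measurable_itv `]0%R, +oo[) (measurable_funTS mF)).
  rewrite (integral_reflect eta _ _ mD0 (measurable_funTS (mT 0 _ mF))).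
  have -> : [set r : R | [set r0 : R | `]0, +oo[%classic (0 - r0)] (eta - r)] = `]eta, +oo[%classic.
    by apply/seteqP; split=> r; rewrite /= !in_itv/= ?andbT; lra.
  by apply: eq_integral => r _; rewrite E.
rewrite (_ : \int[mu]_(x in `]0%R, +oo[) (k x * ker a x)%:E =
   \int[mu]_(x in `]eta, +oo[) (k x * ker a x)%:E)%E; last first.
  rewrite [LHS]integral_mkcond [RHS]integral_mkcond; apply: eq_integral => r _.
  rewrite !patchE; have [er|re] := ltP eta r.
    by rewrite !mem_set//= in_itv/= andbT// (le_lt_trans e0).
  rewrite [in RHS]memNset; last by rewrite /= in_itv/= andbT ltNge re.
  by case: ifP => // _; rewrite /k ltNge re mul0r.
apply: ge0_le_integral_any => r; rewrite /= in_itv/= andbT => er.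
  by rewrite lee_fin mulr_ge0 ?ker_ge0// /k er h0// subr_gt0.
rewrite lee_fin /k er.
rewrite ler_wpM2l ?h0 ?subr_gt0//; apply: ker_anti => //; first by rewrite subr_gt0.
by rewrite gerBl.
Qed.

(** The exponent 2 a is that of the square of an increment of Hölder exponent a.
    Against the kernel, r^(2 a) leaves the integrable power r^(a - 1). *)
Lemma memory_le_power (h : R -> R) (k t : R) : 0 < t -> 0 <= k -> tame h ->
  (forall r, 0 < r -> 0 <= h r) ->
  (forall r, 0 < r -> r <= t -> h r <= k * r `^ (2 * a)) ->
  (forall r, t < r -> h r <= k * t `^ (2 * a)) ->
  memory a h <= 2 * k * t `^ a / a.
Proof.
move=> t0 k0 th h0 h1 h2; have [mh _] := th.
have ih := tame_integrable a a01 h th.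
rewrite -lee_fin /memory /Rintegral fineK; last exact: integrable_fin_num.
rewrite (memory_split a h t t0 mh h0).
have -> : 2 * k * t `^ a / a = k * (t `^ a / a) + (k * t `^ (2 * a)) * (t `^ (- a) / a).
  have -> : t `^ a = t `^ (2 * a) * t `^ (- a).
    by rewrite -powRD ?(gt_eqF t0) ?implybT//; congr (_ `^ _); ring.
  by field; rewrite gt_eqF.
rewrite EFinD; apply: leeD.
  rewrite [leRHS]EFinM -(integral_powR_0 a t a0 t0) -ge0_integralZl ?lee_fin//; last 2 first.
  - exact: measurable_powR_EFin.
  - by move=> x _; rewrite lee_fin powR_ge0.
  apply: ge0_le_integral_any => r; rewrite /= in_itv/= => /andP[r0 rt].
    by rewrite lee_fin mulr_ge0 ?ker_ge0// h0.
  rewrite -EFinM lee_fin; apply: le_trans (ler_wpM2r (ker_ge0 _ _) (h1 _ r0 (ltW rt))) _.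
  rewrite -mulrA ler_wpM2l// /ker -powRD ?(gt_eqF r0) ?implybT//.
  by rewrite le_eqVlt; apply/orP; left; apply/eqP; congr (_ `^ _); ring.
have kt0 : 0 <= k * t `^ (2 * a) by rewrite mulr_ge0 ?powR_ge0.
rewrite -(integral_const_ker a a01 (k * t `^ (2 * a)) t kt0 t0).
apply: ge0_le_integral_any => r; rewrite /= in_itv/= andbT => tr.
  by rewrite lee_fin mulr_ge0 ?ker_ge0// h0// (lt_trans t0).
by rewrite lee_fin ler_wpM2r ?ker_ge0// h2.
Qed.

End memory_estimates.

(** Cut [p, q] into short equal steps: the total increase is at most e times the
    length. *)
Lemma superlinear_nonincreasing (R : realType) (f : R -> R) (p q : R) : p <= q ->
  (forall e, 0 < e -> exists2 del, 0 < del & forall s t, p <= s -> s <= t -> t <= q ->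
     t - s < del -> f t - f s <= e * (t - s)) ->
  f q <= f p.
Proof.
move=> pq H.
have [->//|pnq] := eqVneq p q.
have pq0 : 0 < q - p by rewrite subr_gt0 lt_neqAle pnq.
apply/ler_addgt0Pr => e e0.
have e'0 : 0 < e / (q - p) by rewrite divr_gt0.
have [del d0 Hd] := H _ e'0.
have [N HN] : exists N : nat, (q - p) / del < N%:R.
  by exists (Num.Def.truncn ((q - p) / del)).+1; exact: truncnS_gt.
have N0 : 0 < N%:R :> R by apply: le_lt_trans HN; rewrite divr_ge0 ?ltW.
pose eta := (q - p) / N%:R.
have eta0 : 0 < eta by rewrite divr_gt0.
have etad : eta < del by rewrite /eta ltr_pdivrMr// mulrC -ltr_pdivrMr.
have etaN : eta * N%:R = q - p by rewrite /eta divfK// gt_eqF.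
have key k : (k <= N)%N -> f (p + eta * k%:R) - f p <= e / (q - p) * (eta * k%:R).
  elim: k => [|k IH] kN; first by rewrite mulr0 addr0 subrr mulr0.
  have k0 : 0 <= eta * k%:R by rewrite mulr_ge0// ltW.
  have kE : eta * k.+1%:R = eta * k%:R + eta by rewrite -natr1 mulrDr mulr1.
  have kNle : eta * k.+1%:R <= q - p by rewrite -etaN ler_wpM2l ?(ltW eta0)// ler_nat.
  have step : f (p + eta * k.+1%:R) - f (p + eta * k%:R) <= e / (q - p) * eta.
    have E : p + eta * k.+1%:R - (p + eta * k%:R) = eta by rewrite kE; ring.
    by have := Hd (p + eta * k%:R) (p + eta * k.+1%:R); rewrite E; apply; rewrite ?kE; lra.
  have := IH (ltnW kN); rewrite kE in step *; rewrite mulrDr; lra.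
have E2 : p + (q - p) = q by ring.
by have := key N (leqnn N); rewrite etaN E2 divfK ?(gt_eqF pq0)//; lra.
Qed.

(** * Dissipation and the evolution variational inequality *)

Section evolution_memory.
Context {R : realType} {d : nat}.
Variable Om : set 'rV[R]_d.
Hypotheses (Om_open : open Om) (Om_bounded : bounded_set Om).
Variables (gamma eps : R) (u0 : 'rV[R]_d -> R).
Hypothesis gamma_gt0 : 0 < gamma.
Variables (a : R) (u : R -> 'rV[R]_d -> R).
Hypotheses (a01 : 0 < a < 1) (ev : evolution Om gamma eps u0 a u).
Local Notation mu := (@lebesgue_measure R).
Local Notation fct := ('rV[R]_d -> R).
Implicit Types (v w : fct) (t : R).

Let mOm : measurable Om. Proof. exact: measurable_open_rV. Qed.
Let a0 : 0 < a. Proof. by case/andP: a01. Qed.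

Definition jump t r : R := L2dist Om (u t) (past u (t - r)).

Definition sqdist w s : R := L2dist Om (past u s) w ^+ 2.

Lemma evo_L2 t : 0 <= t -> L2 Om (u t).
Proof. by move=> t0; apply: H1_L2; apply: H2_H1; exact: evo_H2 ev _ t0. Qed.

Lemma evo_past_L2 s : L2 Om (past u s).
Proof. by apply: evo_L2; rewrite le_max lexx orbT. Qed.

Lemma evo_dist_continuous v : L2 Om v -> continuous (fun s : R => L2dist Om (past u s) v).
Proof.
by move=> Lv; have := past_dist_continuous Om_open a01 evo_L2 (evo_holder ev) Lv.
Qed.

Lemma evo_ip_continuous v : L2 Om v -> continuous (fun s : R => ip Om (past u s) v).
Proof.
by move=> Lv; have := past_ip_continuous Om_open a01 evo_L2 (evo_holder ev) Lv.
Qed.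

Lemma jump_ge0 t r : 0 <= jump t r.
Proof. exact: L2dist_ge0. Qed.

Lemma measurable_jump t : 0 <= t -> measurable_fun setT (jump t).
Proof.
move=> t0; rewrite (_ : jump t = fun r => L2dist Om (past u (t - r)) (u t)); last first.
  by apply/funext => r; rewrite /jump L2distC.
apply: (@measurable_reflect_fun _ (fun s => L2dist Om (past u s) (u t))).
by apply: continuous_measurable_fun; apply: evo_dist_continuous; exact: evo_L2.
Qed.

Lemma clamp_range t r : 0 <= t -> 0 < r -> 0 <= Num.max (t - r) 0 <= t.
Proof.
by move=> t0 r0; rewrite le_max lexx orbT/= ge_max t0 andbT gerBl ltW.
Qed.

Lemma jump_bounded t : 0 < t -> exists2 B, 0 <= B & forall r, 0 < r -> jump t r <= B.
Proof.
move=> t0; have [K K0 HK] := evo_holder ev t0.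
exists (K * t `^ a); first by rewrite mulr_ge0 ?powR_ge0.
move=> r r0; have rg := clamp_range (ltW t0) r0.
apply: le_trans (HK _ t rg _) _; first by rewrite lexx (ltW t0).
rewrite ler_wpM2l// ge0_ler_powR ?nnegrE ?(ltW a0) ?(ltW t0)//.
case/andP: rg => r1 r2; rewrite ger0_norm ?subr_ge0//.
by rewrite gerBl.
Qed.

Lemma tame_jump t : 0 < t -> tame (jump t).
Proof.
move=> t0; have [B B0 HB] := jump_bounded t0.
have t20 : 0 < t / 2 by rewrite divr_gt0.
have t2t : t / 2 <= t by rewrite ler_pdivrMr// ler_pMr// ler1n.
have [L L0 HL] := evo_lipschitz ev t20 t2t.
apply: (@tame_near_far _ (jump t) L B (t / 2)) => //.
- by apply: measurable_jump; exact: ltW.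
- move=> r r0 rt; rewrite ger0_norm ?jump_ge0//.
  have tr : t / 2 <= t - r.
    by lra.
  rewrite /jump past_nonneg; last exact: le_trans (ltW t20) tr.
  apply: le_trans (HL _ _ tr _ _) _ => //; first by rewrite gerBl ltW.
  by rewrite subKr.
- by move=> r r0; rewrite ger0_norm ?jump_ge0// HB.
Qed.

Lemma tame_sqr_jump t : 0 < t -> tame (fun r => jump t r ^+ 2).
Proof.
move=> t0; have [B B0 HB] := jump_bounded t0.
apply: (tame_le (k := fun r => B * jump t r)).
- by apply: measurable_funX; apply: measurable_jump; exact: ltW.
- by apply: tameZ; exact: tame_jump.
- by move=> r r0; rewrite ger0_norm ?sqr_ge0// expr2 ler_wpM2r ?jump_ge0// HB.
Qed.

Lemma tame_ip t v : 0 < t -> L2 Om v -> tame (fun r => ip Om (u t - past u (t - r)) v).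
Proof.
move=> t0 Lv; have Lt := evo_L2 (ltW t0).
have E : (fun r => ip Om (u t - past u (t - r)) v) =
    (fun r => ip Om (u t) v - ip Om (past u (t - r)) v).
  by apply/funext => r; rewrite (ipBl mOm Lt (evo_past_L2 _) Lv).
apply: (tame_le (k := fun r => L2norm Om v * jump t r)).
- rewrite E; apply: measurable_funB => //.
  apply: (@measurable_reflect_fun _ (fun s => ip Om (past u s) v)).
  by apply: continuous_measurable_fun; exact: evo_ip_continuous.
- by apply: tameZ; exact: tame_jump.
- move=> r r0; rewrite [leRHS]mulrC /jump /L2dist.
  exact: (cauchy_schwarz mOm (L2_sub mOm Lt (evo_past_L2 _)) Lv).
Qed.

(** Polarization identity. *)
Lemma sqdist_diff t w r : 0 <= t -> L2 Om w ->
  ip Om (u t - past u (t - r)) (u t - w) =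
  2^-1 * jump t r ^+ 2 + 2^-1 * (sqdist w t - sqdist w (t - r)).
Proof.
move=> t0 Lw; have Lt := evo_L2 t0; have Lr := evo_past_L2 (t - r).
rewrite /jump /sqdist (past_nonneg _ t0) /L2dist.
rewrite !sqr_L2normB// ipBl//; last exact: L2_sub.
rewrite !(ipBr mOm) // !sqr_L2norm// (ipC _ (past u (t - r)) (u t)).
by field.
Qed.

Lemma tame_sqdist t w : 0 < t -> L2 Om w ->
  tame (fun r => sqdist w t - sqdist w (t - r)).
Proof.
move=> t0 Lw; have Lt := evo_L2 (ltW t0).
rewrite (_ : (fun r => _) = fun r =>
   2 * ip Om (u t - past u (t - r)) (u t - w) + (- 1) * jump t r ^+ 2); last first.
  by apply/funext => r; rewrite sqdist_diff ?(ltW t0)//; field.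
apply: tameD; apply: tameZ; last exact: tame_sqr_jump.
by apply: tame_ip => //; exact: L2_sub.
Qed.

Lemma sqdist_continuous w : L2 Om w -> continuous (sqdist w).
Proof.
move=> Lw; rewrite (_ : sqdist w = fun s => L2dist Om (past u s) w * L2dist Om (past u s) w); last first.
  by apply/funext => s; rewrite /sqdist expr2.
by move=> s; apply: cvgM; exact: evo_dist_continuous.
Qed.

Definition dissipation t : R := a / Gamma (1 - a) / 2 * memory a (fun r => jump t r ^+ 2).

Let rate := a / Gamma (1 - a).

Lemma rate_gt0 : 0 < rate.
Proof.
by rewrite divr_gt0// Gamma_gt0//; case/andP: a01 => h1 h2; rewrite subr_gt0 h2 ltrBlDr ltrDl.
Qed.

Lemma dissipation_ge0 t : 0 <= dissipation t.
Proof.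
have r0 := rate_gt0; rewrite /dissipation -/rate; apply: mulr_ge0.
  by rewrite divr_ge0// ltW.
by apply: memory_ge0 => r _; rewrite sqr_ge0.
Qed.

(** The boundary term at t of the modified energy is the tail of the memory
    integral over the times before 0. *)
Lemma modified_energyE t : 0 < t ->
  gamma * (modified_energy Om gamma eps a u t - energy Om eps u t) = dissipation t.
Proof.
move=> t0.
have th : tame (fun r => (fun s => L2dist Om (u t) (u s) ^+ 2) (Num.max (t - r) 0)).
  exact: tame_sqr_jump.
have [E _] := @memory_history _ a a01 (fun s => L2dist Om (u t) (u s) ^+ 2) t t0 th.
rewrite /dissipation {1}/modified_energy addrAC subrr add0r.
have -> : memory a (fun r => jump t r ^+ 2) =
   memory a (fun r => L2dist Om (u t) (u (Num.max (t - r) 0)) ^+ 2) by [].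
rewrite E.
have -> : \int[mu]_(tau in `]0, t[) (L2dist Om (u t) (u tau) ^+ 2 / (t - tau) `^ (a + 1)) =
    \int[mu]_(s in `]0, t[) (L2dist Om (u t) (u s) ^+ 2 * ker a (t - s)).
  by apply: eq_Rintegral => s _; rewrite /ker powRN.
rewrite powRN.
have t1 : t `^ a != 0 by rewrite gt_eqF// powR_gt0.
have G0 : Gamma (1 - a) != 0.
  by rewrite gt_eqF// Gamma_gt0//; case/andP: a01 => h1 h2; rewrite subr_gt0 h2 ltrBlDr ltrDl.
move: (Rintegral _ _ _) (L2dist _ _ _ ^+ 2) => I J.
have an : a != 0 by rewrite gt_eqF.
have gn : gamma != 0 by rewrite gt_eqF.
by field; rewrite t1 G0 an gn.
Qed.

(** Test the equation with u t - w and polarize. *)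
Lemma evolution_identity t w : 0 < t -> L2 Om w ->
  - gamma * ip Om (chemical_potential Om eps (u t)) (u t - w) =
  dissipation t + rate / 2 * marchaud a (sqdist w) t.
Proof.
move=> t0 Lw; have Lt := evo_L2 (ltW t0).
rewrite (evo_equation ev t0 (L2_sub mOm Lt Lw)).
rewrite (_ : memory a _ = 2^-1 * memory a (fun r => jump t r ^+ 2) +
   2^-1 * marchaud a (sqdist w) t).
  by rewrite /dissipation -/rate; field.
have T1 := tame_sqr_jump t0; have T2 := tame_sqdist t0 Lw.
rewrite /marchaud -!memoryZ// -memoryD//; try exact: tameZ.
by apply: eq_memory => r _; rewrite sqdist_diff// ltW.
Qed.

Lemma evo_chemical_L2 t : 0 <= t -> L2 Om (chemical_potential Om eps (u t)).
Proof.
move=> t0; have [M M0 bM] := evo_bounded ev.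
exact: (chemical_potential_L2 Om_open Om_bounded eps (evo_H2 ev t0) (bM t t0)).
Qed.

Lemma evi_arith (g D G E Ew y m : R) : 0 < g ->
  - g * G = D + m -> - G - 2^-1 * y <= Ew - E -> D + g * (E - Ew) <= g / 2 * y - m.
Proof. by move=> g0 h1 h2; have := ler_wpM2l (ltW g0) h2; nra. Qed.

(** [evolution_identity] combined with semiconvexity from u t to w. *)
Lemma evolution_variational_inequality M t w : 0 < t ->
  H2 Om w -> H10 Om w -> bounded_ae Om M w ->
  dissipation t + gamma * (energy Om eps u t - free_energy Om eps w) <=
  gamma / 2 * sqdist w t - rate / 2 * marchaud a (sqdist w) t.
Proof.
move=> t0 H2w H10w bw; have Lw := H1_L2 (H2_H1 H2w).
have Lt := evo_L2 (ltW t0).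
have [M' M0 bM] := evo_bounded ev.
pose N := Num.max M M'.
have bw' : bounded_ae Om N w.
  by apply: filterS bw => x h Ox; apply: le_trans (h Ox) _; rewrite le_max lexx.
have bu' : bounded_ae Om N (u t).
  by apply: filterS (bM t (ltW t0)) => x h Ox; apply: le_trans (h Ox) _; rewrite le_max lexx orbT.
have SC := free_energy_semiconvex Om_open Om_bounded eps
  (evo_H2 ev (ltW t0)) (evo_H10 ev (ltW t0)) bu' H2w H10w bw'.
have Id := evolution_identity t0 Lw.
have flip : ip Om (chemical_potential Om eps (u t)) (w - u t) =
    - ip Om (chemical_potential Om eps (u t)) (u t - w).
  by have LA := evo_chemical_L2 (ltW t0); rewrite !ipBr// opprB.
rewrite flip in SC.
have sq : sqdist w t = L2norm Om (w - u t) ^+ 2.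
  by rewrite /sqdist past_nonneg ?(ltW t0)// L2distC.
rewrite sq.
exact: (evi_arith gamma_gt0 Id SC).
Qed.

End evolution_memory.

(** * Monotonicity of the modified energy *)

Section step_arithmetic.
Variable R : realFieldType.
Lemma step_arith (g c E E' G y mt ms mk mi err D D' : R) : 0 < g -> 0 <= c ->
  - G - 2^-1 * y <= E' - E -> - g * G = c * mi -> mk <= ms ->
  mt - mk - 2 * mi <= err -> D = c / 2 * mt -> D' = c / 2 * ms ->
  (g * E + D) - (g * E' + D') <= g / 2 * y + c / 2 * err.
Proof.
move=> g0 c0 sc eq kle cap -> ->.
have h1 := ler_wpM2l (ltW g0) sc.
have h2 : c / 2 * (mt - mk - 2 * mi) <= c / 2 * err by rewrite ler_wpM2l// divr_ge0.
have h3 : c / 2 * mk <= c / 2 * ms by rewrite ler_wpM2l// divr_ge0.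
have h4 : c / 2 * (mt - mk - 2 * mi) = c / 2 * mt - c / 2 * mk - c * mi by field.
by rewrite h4 in h2; rewrite !mulrBr mulrN in h1; rewrite mulNr in eq; lra.
Qed.

Lemma near_step_arith (L eta r J p : R) : 0 <= J -> J <= L * r -> 0 <= r -> r <= eta ->
  - p <= J * (L * eta) -> 0 <= L -> J ^+ 2 - 0 - 2 * p <= 3 * L ^+ 2 * (eta * r).
Proof.
move=> J0 Jr r0 re hp L0.
have Lr : L * r <= L * eta by rewrite ler_wpM2l.
have h1 : J * (L * eta) <= (L * r) * (L * eta) by rewrite ler_wpM2r// mulr_ge0// (le_trans r0).
have h2 : J ^+ 2 <= (L * r) * (L * eta).
  by rewrite expr2; apply: ler_pM => //; exact: le_trans Lr.
have -> : 3 * L ^+ 2 * (eta * r) = 3 * ((L * r) * (L * eta)) by ring.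
lra.
Qed.

Lemma far_step_arith (x y z : R) : 0 <= z ->
  x + - 1 * (x - 2 * y + z) + - 2 * y <= 0.
Proof. by move=> z0; lra. Qed.

End step_arithmetic.

Section monotone.
Context {R : realType} {d : nat}.
Variable Om : set 'rV[R]_d.
Hypotheses (Om_open : open Om) (Om_bounded : bounded_set Om).
Variables (gamma eps : R) (u0 : 'rV[R]_d -> R).
Hypothesis gamma_gt0 : 0 < gamma.
Variables (a : R) (u : R -> 'rV[R]_d -> R).
Hypotheses (a01 : 0 < a < 1) (ev : evolution Om gamma eps u0 a u).

Let mOm : measurable Om. Proof. exact: measurable_open_rV. Qed.
Let a0 : 0 < a. Proof. by case/andP: a01. Qed.
Let a1 : 0 < 1 - a. Proof. by case/andP: a01; rewrite subr_gt0. Qed.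
Let rate := a / Gamma (1 - a).
Let kappa := (1 - a)^-1 + a^-1.
Local Notation jump := (jump Om u).
Local Notation dissipation := (dissipation Om a u).

(** The history seen from s, with time counted back from s + eta. *)
Lemma tame_shifted_jump s eta : 0 < s -> 0 < eta ->
  tame (fun r => if eta < r then jump s (r - eta) ^+ 2 else 0).
Proof.
move=> s0 e0.
have [B B0 HB] := jump_bounded a01 ev s0.
apply: (@tame_near_far _ _ 0 (B ^+ 2) eta) => //.
- apply: measurable_fun_ifT => //.
    exact: measurable_fun_ltr.
  apply: measurable_funX.
  have mj := measurable_jump Om_open a01 ev (ltW s0).
  apply: (measurableT_comp (f := jump s) (g := fun r : R => r - eta)) => //.
  exact: measurable_funB.
- by rewrite sqr_ge0.
- move=> r r0 re; have -> : (eta < r) = false by apply/negbTE; rewrite -leNgt ltW.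
  by rewrite mul0r normr0.
- move=> r r0; case: ifPn => [er|_]; last by rewrite normr0 sqr_ge0.
  rewrite ger0_norm ?sqr_ge0// lerXn2r ?nnegrE ?jump_ge0//.
  by apply: HB; rewrite subr_gt0.
Qed.

(** Test the equation with u t - u s. The history seen from s is the one seen
    from t delayed by eta = t - s, and by [memory_shift_le] the delay lowers the
    memory integral. For elapsed times r > eta the three terms that remain
    combine to - |u t - u s|^2; for r <= eta the Lipschitz bound leaves an error
    of order eta^2, which the cap turns into eta^(2 - a). *)
Lemma energy_step p q L s t : 0 < p -> p <= s -> s < t -> t <= q -> 0 <= L ->
  (forall s t, p <= s -> s <= t -> t <= q -> L2dist Om (u t) (u s) <= L * (t - s)) ->
  (gamma * energy Om eps u t + dissipation t) - (gamma * energy Om eps u s + dissipation s)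
  <= gamma / 2 * (L * (t - s)) ^+ 2 +
     rate / 2 * (3 * L ^+ 2 * (t - s) ^+ 2 * ((t - s) `^ (- a) * kappa)).
Proof.
move=> p0 ps st tq L0 HL.
have s0 := lt_le_trans p0 ps; have t0 := lt_trans s0 st.
pose eta := t - s; rewrite -/eta.
have e0 : 0 < eta by rewrite subr_gt0.
have Lt := evo_L2 ev (ltW t0); have Ls := evo_L2 ev (ltW s0).
have Lts := L2_sub mOm Lt Ls.
have [M M0 bM] := evo_bounded ev.
have SC := free_energy_semiconvex Om_open Om_bounded eps
  (evo_H2 ev (ltW t0)) (evo_H10 ev (ltW t0)) (bM t (ltW t0))
  (evo_H2 ev (ltW s0)) (evo_H10 ev (ltW s0)) (bM s (ltW s0)).
have flip : ip Om (chemical_potential Om eps (u t)) (u s - u t) =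
    - ip Om (chemical_potential Om eps (u t)) (u t - u s).
  by have LA := evo_chemical_L2 Om_open Om_bounded ev (ltW t0); rewrite !ipBr// opprB.
rewrite flip in SC.
have EQ := evo_equation ev t0 Lts.
have tk := tame_shifted_jump s0 e0.
have tjs := tame_sqr_jump Om_open a01 ev s0.
have tjt := tame_sqr_jump Om_open a01 ev t0.
have tip := tame_ip Om_open a01 ev t0 Lts.
have KL := memory_shift_le a01 (ltW e0) tjs (fun r _ => sqr_ge0 _) tk.
have near_eta : L2norm Om (u t - u s) <= L * eta by apply: HL => //; exact: ltW.
have dist : L2norm Om (u s - u t) ^+ 2 <= (L * eta) ^+ 2.
  rewrite -opprB L2normN lerXn2r ?nnegrE ?L2norm_ge0//.
  by rewrite mulr_ge0// ltW.
(* three terms of size (L r) (L eta), for r <= eta *)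
pose err r := 3 * L ^+ 2 * eta ^+ 2 * Num.min 1 (r / eta).
have terr : tame err by apply: tameZ; exact: tame_cap.
have cap : memory a (fun r => jump t r ^+ 2) -
    memory a (fun r => if eta < r then jump s (r - eta) ^+ 2 else 0) -
    2 * memory a (fun r => ip Om (u t - past u (t - r)) (u t - u s)) <=
    3 * L ^+ 2 * eta ^+ 2 * (eta `^ (- a) * kappa).
  rewrite -(memory_cap a a01 eta e0) -(memoryZ a a01 _ _ (tame_cap eta e0)).
  set k := (fun r => if _ then _ else _) in tk *.
  set w := (fun r => ip Om (u t - past u (t - r)) (u t - u s)) in tip *.
  have tk' : tame (fun r => - 1 * k r) by exact: tameZ.
  have tw' : tame (fun r => - 2 * w r) by exact: tameZ.
  have tjk : tame (fun r => jump t r ^+ 2 + - 1 * k r) by exact: tameD.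
  have -> : memory a (fun r => jump t r ^+ 2) - memory a k - 2 * memory a w =
      memory a (fun r => (jump t r ^+ 2 + - 1 * k r) + - 2 * w r).
    by rewrite !memoryD// !memoryZ//; ring.
  apply: le_memory => //; first exact: tameD.
  move=> r r0; rewrite /k.
  have Lr := evo_past_L2 ev (t - r).
  have Ltr := L2_sub mOm Lt Lr.
  case: ifPn => [er|]; last first.
    rewrite -leNgt => re.
    have tr : s <= t - r by rewrite lerBrDr -lerBrDl.
    have rE : r / eta <= 1 by rewrite ler_pdivrMr// mul1r.
    have cs : - w r <= jump t r * (L * eta).
      apply: (@le_trans _ _ `|w r|); first by rewrite -normrN ler_norm.
      apply: le_trans (cauchy_schwarz mOm Ltr Lts) _.
      by rewrite ler_wpM2l// L2norm_ge0.
    have Jr : jump t r <= L * r.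
      rewrite /jump past_nonneg; last by rewrite (le_trans (ltW s0)).
      apply: le_trans (HL _ _ (le_trans ps tr) _ tq) _; first by rewrite gerBl ltW.
      by rewrite subKr.
    rewrite (min_r rE) mulr0.
    have := near_step_arith (jump_ge0 Om u t r) Jr (ltW r0) re cs L0.
    rewrite subr0 addr0 mulNr => /le_trans; apply.
    have -> : eta * r = eta ^+ 2 * (r / eta) by field; rewrite gt_eqF.
    by rewrite mulrA.
  have -> : jump s (r - eta) = L2norm Om (u s - past u (t - r)).
    by rewrite /jump /L2dist; congr (L2norm _ (_ - past _ _)); rewrite /eta; ring.
  have rE : 1 <= r / eta by rewrite ler_pdivlMr// mul1r ltW.
  rewrite (min_l rE) mulr1.
  apply: (@le_trans _ _ 0); last first.
    by apply: mulr_ge0; [apply: mulr_ge0 => //; exact: sqr_ge0|exact: sqr_ge0].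
  rewrite /jump /L2dist /w.
  have LB := L2_sub mOm Ls Lr.
  have E : u s - past u (t - r) = (u t - past u (t - r)) - (u t - u s).
    by rewrite opprB [RHS]addrC addrA subrK.
  rewrite E (sqr_L2normB mOm Ltr Lts).
  exact: far_step_arith (sqr_ge0 _).
apply: le_trans (step_arith gamma_gt0 (ltW (rate_gt0 a01)) SC EQ KL cap _ _) _ => //.
by rewrite lerD2r ler_wpM2l// divr_ge0// ltW.
Qed.

(** On a short step the increase is of order (t - s)^(2 - a), hence superlinear.
    *)
Lemma modified_energy_nonincreasing p q : 0 < p -> p <= q ->
  gamma * energy Om eps u q + dissipation q <= gamma * energy Om eps u p + dissipation p.
Proof.
move=> p0 pq; have [L L0 HL] := evo_lipschitz ev p0 pq.
pose f t := gamma * energy Om eps u t + dissipation t.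
apply: (superlinear_nonincreasing (f := f) pq) => e e0.
pose C := gamma / 2 * L ^+ 2 + rate / 2 * (3 * L ^+ 2 * kappa).
have r0 := rate_gt0 a01.
have k0 : 0 <= kappa by rewrite addr_ge0 ?invr_ge0 ?ltW.
have g2 : 0 <= gamma / 2 by rewrite divr_ge0// ltW.
have C0 : 0 <= C.
  have r2 : 0 <= rate / 2 by rewrite divr_ge0// ltW.
  have L3 : 0 <= 3 * L ^+ 2 by apply: mulr_ge0 => //; exact: sqr_ge0.
  by rewrite /C addr_ge0// mulr_ge0 ?sqr_ge0// mulr_ge0.
have C1 : 0 < C + 1 by rewrite ltr_wpDl.
exists (Num.min 1 ((e / (C + 1)) `^ (1 - a)^-1)).
  by rewrite lt_min ltr01 powR_gt0// divr_gt0.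
move=> s t ps st tq; rewrite lt_min => /andP[d1 de].
have [->|sn] := eqVneq s t; first by rewrite !subrr mulr0.
have {}st : s < t by rewrite lt_neqAle sn.
apply: le_trans (energy_step p0 ps st tq L0 HL) _.
set eta := t - s in d1 de *; have h0 : 0 < eta by rewrite subr_gt0.
have small : eta `^ (1 - a) <= e / (C + 1).
  rewrite (_ : e / (C + 1) = ((e / (C + 1)) `^ (1 - a)^-1) `^ (1 - a)); last first.
    by rewrite -powRrM mulVf ?gt_eqF// powRr1// ltW// divr_gt0.
  by rewrite ge0_ler_powR ?nnegrE ?(ltW a1) ?(ltW h0) ?powR_ge0 ?(ltW de).
have etaE : eta ^+ 2 * eta `^ (- a) = eta * eta `^ (1 - a).
  by rewrite expr2 -mulrA -{2}[eta]powRr1 ?(ltW h0)// -powRD ?(gt_eqF h0) ?implybT.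
have eta1 : eta <= eta `^ (1 - a).
  rewrite -{1}[eta]powRr1 ?(ltW h0)//; apply: ger_powR; first by rewrite h0 ltW.
  by rewrite gerBl ltW.
have -> : 3 * L ^+ 2 * eta ^+ 2 * (eta `^ (- a) * kappa) =
   3 * L ^+ 2 * kappa * (eta * eta `^ (1 - a)) by rewrite -etaE; ring.
apply: (@le_trans _ _ (C * (eta * eta `^ (1 - a)))).
  rewrite /C [X in _ <= X]mulrDl; apply: lerD; last by rewrite !mulrA.
  have gL : 0 <= gamma / 2 * L ^+ 2 by apply: mulr_ge0 => //; exact: sqr_ge0.
  rewrite exprMn [X in X <= _]mulrA ler_wpM2l//.
  by rewrite expr2 ler_wpM2l// ltW.
apply: (@le_trans _ _ ((C + 1) * (eta * (e / (C + 1))))).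
  apply: ler_pM => //; first by rewrite mulr_ge0 ?powR_ge0 ?(ltW h0).
    by rewrite lerDl.
  by rewrite ler_wpM2l// ltW.
by rewrite mulrCA [(C + 1) * _]mulrC divfK ?gt_eqF// mulrC.
Qed.

End monotone.

(** * The modified energy at initial time *)

Lemma initial_arith (R : realFieldType) (e0 et i1 i2 dl N A B K p Dg Q : R) :
  0 <= N -> 0 <= B -> A <= B -> 0 <= K -> 0 <= p <= 1 -> 0 <= dl -> dl <= K * p ->
  0 <= Dg -> Dg <= Q * p -> `|i1| <= A * dl -> `|i2| <= N * dl ->
  i1 - 2^-1 * dl ^+ 2 <= e0 - et -> i2 - 2^-1 * dl ^+ 2 <= et - e0 ->
  `|e0 - (et + Dg)| <= (Q + ((N + B) * K + 2^-1 * K ^+ 2)) * p.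
Proof.
move=> N0 B0 AB K0 /andP[p0 p1] dl0 dlK D0 DQ.
rewrite ler_norml => /andP[h1 _]; rewrite ler_norml => /andP[h2 _] s1 s2.
have AB' : A * dl <= B * dl by rewrite ler_wpM2r.
have Kp0 : 0 <= K * p by rewrite mulr_ge0.
have Nd : N * dl <= N * (K * p) by rewrite ler_wpM2l.
have Bd : B * dl <= B * (K * p) by rewrite ler_wpM2l.
have d2 : dl ^+ 2 <= K ^+ 2 * p.
  apply: (@le_trans _ _ ((K * p) ^+ 2)); first by rewrite lerXn2r ?nnegrE.
  by rewrite exprMn ler_wpM2l ?sqr_ge0// expr2 ler_piMr.
have NK : 0 <= N * (K * p) by rewrite mulr_ge0.
have BK : 0 <= B * (K * p) by rewrite mulr_ge0.
have K2p : 0 <= K ^+ 2 * p by rewrite mulr_ge0 ?sqr_ge0.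
have -> : (Q + ((N + B) * K + 2^-1 * K ^+ 2)) * p =
   Q * p + (N * (K * p) + B * (K * p) + 2^-1 * (K ^+ 2 * p)) by ring.
by rewrite ler_norml; apply/andP; split; lra.
Qed.

Section limits.
Context {R : realType} {d : nat}.
Variable Om : set 'rV[R]_d.
Hypotheses (Om_open : open Om) (Om_bounded : bounded_set Om).
Variables (gamma eps : R) (u0 : 'rV[R]_d -> R).
Hypothesis gamma_gt0 : 0 < gamma.
Variables (a : R) (u : R -> 'rV[R]_d -> R).
Hypotheses (a01 : 0 < a < 1) (ev : evolution Om gamma eps u0 a u).

Let mOm : measurable Om. Proof. exact: measurable_open_rV. Qed.
Let a0 : 0 < a. Proof. by case/andP: a01. Qed.
Let a1 : 0 < 1 - a. Proof. by case/andP: a01; rewrite subr_gt0. Qed.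
Let Gamma0 : 0 < Gamma (1 - a).
Proof. by apply: Gamma_gt0; rewrite a1 ltrBlDr ltrDl. Qed.
Let rate := a / Gamma (1 - a).
Let kappa := (1 - a)^-1 + a^-1.
Local Notation jump := (jump Om u).
Local Notation dissipation := (dissipation Om a u).
Local Notation E := (energy Om eps u).
Local Notation Emod := (modified_energy Om gamma eps a u).

Lemma modified_energy_excess t : 0 < t -> Emod t - E t = dissipation t / gamma.
Proof.
move=> t0; rewrite -(modified_energyE Om_open gamma_gt0 a01 ev t0).
by rewrite mulrC mulKf// gt_eqF.
Qed.

(** The bound of [memory_le_power] for the square of a Hölder increment; before
    time 0 the increment is that from the initial value. *)
Lemma dissipation_holder K t : 0 < t -> 0 <= K ->
  (forall s, 0 <= s <= t -> L2dist Om (u t) (u s) <= K * (t - s) `^ a) ->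
  dissipation t <= K ^+ 2 * t `^ a / Gamma (1 - a).
Proof.
move=> t0 K0 HK.
have sq r x : 0 < x -> jump t r <= K * x `^ a -> jump t r ^+ 2 <= K ^+ 2 * x `^ (2 * a).
  move=> x0 h; have -> : x `^ (2 * a) = (x `^ a) ^+ 2.
    by rewrite mulrC powRrM powR_mulrn ?powR_ge0.
  by rewrite -exprMn lerXn2r ?nnegrE ?jump_ge0// mulr_ge0 ?powR_ge0.
have j r : 0 < r -> r <= t -> jump t r <= K * r `^ a.
  move=> r0 rt; rewrite /jump past_nonneg ?subr_ge0//.
  by have := HK (t - r); rewrite subKr; apply; rewrite subr_ge0 rt gerBl ltW.
have jt r : t < r -> jump t r <= K * t `^ a.
  move=> tr; rewrite /jump /past max_r ?subr_le0 ?(ltW tr)//.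
  by have := HK 0; rewrite subr0; apply; rewrite lexx ltW.
have K2 : 0 <= K ^+ 2 by exact: sqr_ge0.
have M := memory_le_power a01 t0 K2 (tame_sqr_jump Om_open a01 ev t0)
   (fun r _ => sqr_ge0 _) (fun r r0 rt => sq r r r0 (j r r0 rt))
   (fun r tr => sq r t t0 (jt r tr)).
rewrite /dissipation.
have c0 : 0 <= a / Gamma (1 - a) / 2 by rewrite !divr_ge0// ltW.
apply: le_trans (ler_wpM2l c0 M) _.
rewrite le_eqVlt; apply/orP; left; apply/eqP.
have G0 : Gamma (1 - a) != 0 by rewrite gt_eqF.
have an : a != 0 by rewrite gt_eqF.
by move: (t `^ a) => T; field; rewrite G0 an.
Qed.

(** Semiconvexity from u 0 to u t and back bounds the difference of the energies
    by the distance, because the chemical potentials are bounded in L2 near time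
    0. *)
Lemma initial_limit : Emod t @[t --> 0^'+] --> E 0.
Proof.
have [K K0 HK] := evo_holder ev (@ltr01 R).
have [B [del d0 HB]] := evo_potential0 ev.
have [M M0 bM] := evo_bounded ev.
pose N := L2norm Om (chemical_potential Om eps (u 0)).
pose B' := Num.max B 0.
have N0 : 0 <= N by exact: L2norm_ge0.
have B0 : 0 <= B' by rewrite le_max lexx orbT.
pose C := K ^+ 2 / Gamma (1 - a) / gamma + ((N + B') * K + 2^-1 * K ^+ 2).
have bound t : 0 < t -> t < Num.min 1 del -> `|E 0 - Emod t| <= C * t `^ a.
  move=> t0; rewrite lt_min => /andP[t1 td].
  have H01 : 0 <= t <= 1 by rewrite !ltW.
  have dK : L2dist Om (u t) (u 0) <= K * t `^ a.
    by apply: le_trans (HK 0 t _ H01) _; rewrite ?lexx ?ler01// subr0 gtr0_norm.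
  have dis : dissipation t <= K ^+ 2 * t `^ a / Gamma (1 - a).
    apply: dissipation_holder => // s /andP[s0 st].
    have -> : t - s = `|t - s| by rewrite ger0_norm ?subr_ge0.
    by apply: HK => //; rewrite s0 (le_trans st)// ltW.
  have L0 := evo_L2 ev (lexx (0 : R)); have Lt := evo_L2 ev (ltW t0).
  have LA0 := evo_chemical_L2 Om_open Om_bounded ev (lexx (0 : R)).
  have LAt := evo_chemical_L2 Om_open Om_bounded ev (ltW t0).
  have SC1 := free_energy_semiconvex Om_open Om_bounded eps
    (evo_H2 ev (ltW t0)) (evo_H10 ev (ltW t0)) (bM t (ltW t0))
    (evo_H2 ev (lexx 0)) (evo_H10 ev (lexx 0)) (bM 0 (lexx 0)).
  have SC2 := free_energy_semiconvex Om_open Om_bounded eps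
    (evo_H2 ev (lexx 0)) (evo_H10 ev (lexx 0)) (bM 0 (lexx 0))
    (evo_H2 ev (ltW t0)) (evo_H10 ev (ltW t0)) (bM t (ltW t0)).
  have CS1 := cauchy_schwarz mOm LAt (L2_sub mOm L0 Lt).
  have CS2 := cauchy_schwarz mOm LA0 (L2_sub mOm Lt L0).
  have hB : L2norm Om (chemical_potential Om eps (u t)) <= B'.
    by apply: le_trans (HB t _) _; rewrite ?t0// le_max lexx.
  have sym : L2norm Om (u 0 - u t) = L2dist Om (u t) (u 0) by rewrite L2distC.
  rewrite sym in SC1 CS1; rewrite -/(L2dist Om (u t) (u 0)) in SC2 CS2.
  have D0 : 0 <= dissipation t by exact: dissipation_ge0.
  have EM : Emod t = E t + dissipation t / gamma by rewrite -modified_energy_excess// addrC subrK.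
  rewrite EM; have p1 : 0 <= t `^ a <= 1.
    rewrite powR_ge0/= -(powRr0 t); apply: ger_powR; [by rewrite t0 ltW|exact: ltW].
  apply: (initial_arith N0 B0 hB K0 p1 (L2dist_ge0 Om (u t) (u 0)) dK _ _ CS1 CS2 SC1 SC2).
    by rewrite divr_ge0// ltW.
  by rewrite ler_pdivrMr//; apply: le_trans dis _; rewrite mulrAC [X in _ <= X]mulrAC divfK ?gt_eqF.
apply/cvgrPdist_lt => e e0.
have C0 : 0 <= C.
  have h1 : 0 <= K ^+ 2 / Gamma (1 - a) / gamma.
    by apply: divr_ge0; [apply: divr_ge0; [exact: sqr_ge0|exact: ltW]|exact: ltW].
  have h2 : 0 <= (N + B') * K by rewrite mulr_ge0// addr_ge0.
  have h3 : 0 <= 2^-1 * K ^+ 2 by apply: mulr_ge0; [rewrite invr_ge0|exact: sqr_ge0].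
  by rewrite /C !addr_ge0.
have C1 : 0 < C + 1 by rewrite ltr_wpDl.
have /cvgrPdist_lt/(_ _ (divr_gt0 e0 C1)) := powR_cvg0 a0.
move=> H; near=> t.
have t0 : 0 < t by near: t; exact: nbhs_right_gt.
have tm : t < Num.min 1 del by near: t; apply: nbhs_right_lt; rewrite lt_min ltr01.
apply: le_lt_trans (bound t t0 tm) _.
apply: (@le_lt_trans _ _ ((C + 1) * t `^ a)); first by rewrite ler_wpM2r ?powR_ge0// lerDl.
rewrite mulrC -ltr_pdivlMr//.
have : `|0 - t `^ a| < e / (C + 1) by near: t.
by rewrite sub0r normrN ger0_norm ?powR_ge0.
Unshelve. all: by end_near. Qed.

End limits.

(** * Relaxation to a steady state *)

Lemma relaxation_arith (R : realFieldType) (g E Eo D D' E' y' y m q eta : R) :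
  0 < g -> 0 <= eta -> D + g * (E - Eo) <= g / 2 * y - m -> - m <= g / 2 * eta -> y <= eta ->
  g * E' + D' <= g * E + D -> - 2^-1 * y' <= E' - Eo -> y' <= eta ->
  D' <= g * (2 * eta).
Proof.
move=> g0 eta0 evi mle ye mono low y'e.
have h1 : g * (- 2^-1 * y') <= g * (E' - Eo) by rewrite ler_wpM2l// ltW.
have h2 : g / 2 * y <= g / 2 * eta by rewrite ler_wpM2l// divr_ge0// ltW.
have h3 : g / 2 * y' <= g / 2 * eta by rewrite ler_wpM2l// divr_ge0// ltW.
have h4 : g * (- 2^-1 * y') = - (g / 2 * y') by field.
have h5 : g * (2 * eta) = 4 * (g / 2 * eta) by field.
have h6 : 0 <= g / 2 * eta by rewrite mulr_ge0// divr_ge0// ltW.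
rewrite !mulrBr in evi h1; lra.
Qed.

Section relaxation.
Context {R : realType} {d : nat}.
Variable Om : set 'rV[R]_d.
Hypotheses (Om_open : open Om) (Om_bounded : bounded_set Om).
Variables (gamma eps : R) (u0 : 'rV[R]_d -> R).
Hypothesis gamma_gt0 : 0 < gamma.
Variables (a : R) (u : R -> 'rV[R]_d -> R).
Hypotheses (a01 : 0 < a < 1) (ev : evolution Om gamma eps u0 a u).
Variable w : 'rV[R]_d -> R.
Hypotheses (w_steady : steady_state Om gamma eps w)
  (uw : L2dist Om (u t) w @[t --> +oo] --> (0 : R)).

Let mOm : measurable Om. Proof. exact: measurable_open_rV. Qed.
Let a0 : 0 < a. Proof. by case/andP: a01. Qed.
Let a1 : 0 < 1 - a. Proof. by case/andP: a01; rewrite subr_gt0. Qed.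
Let rate := a / Gamma (1 - a).
Let kappa := (1 - a)^-1 + a^-1.
Local Notation dissipation := (dissipation Om a u).
Local Notation E := (energy Om eps u).
Local Notation Emod := (modified_energy Om gamma eps a u).
Local Notation y := (sqdist Om u w).

Let H2w : H2 Om w. Proof. by case: w_steady. Qed.
Let H10w : H10 Om w. Proof. by case: w_steady. Qed.
Let Lw : L2 Om w. Proof. exact: (H1_L2 (H2_H1 H2w)). Qed.

Lemma eventually_close e : 0 < e ->
  exists2 S, 0 < S & forall t, S <= t -> L2dist Om (u t) w < e.
Proof.
move=> e0; have /cvgrPdist_lt/(_ _ e0)[S [_ HS]] := uw.
exists (Num.max (S + 1) 1) => [|t]; first by rewrite lt_max ltr01 orbT.
rewrite ge_max => /andP[St _].
have := HS t; rewrite sub0r normrN ger0_norm ?L2dist_ge0//; apply.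
by apply: lt_le_trans St; rewrite ltrDl.
Qed.

(** The bound of the solution passes to its limit. *)
Lemma limit_bounded_ae : exists2 M, 0 <= M & bounded_ae Om M w.
Proof.
have [M M0 bM] := evo_bounded ev; exists M => //.
apply: (bounded_ae_closed mOm M0 Lw) => e e0.
have [S S0 HS] := eventually_close e0.
exists (u S); split; [exact: (evo_L2 ev (ltW S0))|exact: (bM _ (ltW S0))|].
by rewrite L2distC; apply: HS.
Qed.

Lemma sqdist_bounded : exists2 A, 0 < A & forall t, 0 <= y t < A.
Proof.
have [S S0 HS] := eventually_close ltr01.
have [c /andP[c0 cS] cmax] := exists_argmax y 0 S (ltW S0)
  (sqdist_continuous Om_open a01 ev Lw).
exists (y c + 2) => [|t]; first by rewrite ltr_wpDl// sqr_ge0.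
rewrite sqr_ge0/=.
have yc0 : 0 <= y c by rewrite sqr_ge0.
have [t0|t0] := leP t 0.
  have -> : y t = y 0 by rewrite /sqdist /past (max_r t0) maxxx.
  by apply: le_lt_trans (cmax 0 _) _; rewrite ?lexx ?(ltW S0)// ltrDl.
have [tS|tS] := leP t S.
  by apply: le_lt_trans (cmax t _) _; rewrite ?(ltW t0)// ltrDl.
apply: (@lt_le_trans _ _ 2); last by rewrite lerDr.
rewrite /sqdist past_nonneg ?(ltW t0)//.
have h := HS t (ltW tS); have h0 := L2dist_ge0 Om (u t) w.
apply: (@le_lt_trans _ _ 1); last by rewrite ltr1n.
by rewrite expr_le1// ltW.
Qed.

Lemma steady_potential0 v : L2 Om v -> ip Om (chemical_potential Om eps w) v = 0.
Proof.
move=> Lv; have [M M0 bM] := limit_bounded_ae.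
have LA := chemical_potential_L2 Om_open Om_bounded eps H2w bM.
rewrite (@eq_ip_ae _ _ Om mOm _ 0 v LA (L2_0 _) Lv).
  by rewrite /ip; under eq_Rintegral do rewrite mul0r; rewrite Rintegral_cst// mul0r.
  exact: mOm.
have [_ _ ws] := w_steady; apply: filterS ws => x h Ox; have := h Ox => /eqP.
rewrite mulf_eq0 gt_eqF//= subr_eq0 => /eqP hx.
change (- eps ^+ 2 * laplacian Om w x + reaction (w x) = 0); by rewrite mulNr hx addNr.
Qed.

(** Semiconvexity from w, at which the first-order term vanishes. *)
Lemma energy_lower_bound t : 0 <= t -> - 2^-1 * y t <= E t - free_energy Om eps w.
Proof.
move=> t0; have [M M0 bM] := evo_bounded ev; have [M' M'0 bM'] := limit_bounded_ae.
have bw : bounded_ae Om (Num.max M M') w.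
  by apply: filterS bM' => x h Ox; apply: le_trans (h Ox) _; rewrite le_max lexx orbT.
have bu : bounded_ae Om (Num.max M M') (u t).
  by apply: filterS (bM t t0) => x h Ox; apply: le_trans (h Ox) _; rewrite le_max lexx.
have Lt := evo_L2 ev t0.
have := free_energy_semiconvex Om_open Om_bounded eps H2w H10w bw
  (evo_H2 ev t0) (evo_H10 ev t0) bu.
rewrite steady_potential0; last exact: L2_sub.
by rewrite sub0r /sqdist past_nonneg// mulNr.
Qed.

(** The ramp length L is chosen so long that the Marchaud derivative at the
    point s of [sloped_argmax] is at least - eta up to constants. The
    variational inequality at s, monotonicity from s to t and the lower bound of
    the energy at t then leave only squared distances to w, all at most eta. *)
Lemma dissipation_vanishes eta : 0 < eta ->
  exists2 S, 0 < S & forall t, S <= t -> dissipation t <= gamma * (2 * eta).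
Proof.
move=> e0.
have se0 : 0 < Num.sqrt eta by rewrite sqrtr_gt0.
have [S S0 HS] := eventually_close se0.
have yS t : S <= t -> y t <= eta.
  move=> St; rewrite /sqdist past_nonneg ?(le_trans (ltW S0))//.
  rewrite -[leRHS](sqr_sqrtr (ltW e0)) lerXn2r ?nnegrE ?L2dist_ge0 ?sqrtr_ge0//.
  by rewrite ltW// HS.
have [A A0 HA] := sqdist_bounded.
have r0 : 0 < rate by exact: (rate_gt0 a01).
have k0 : 0 < kappa by rewrite addr_gt0 ?invr_gt0.
pose X := rate / 2 * (A * kappa) / (gamma / 2 * eta).
have r2 : 0 < rate / 2 by apply: divr_gt0.
have X0 : 0 < X.
  by apply: divr_gt0; [exact: (mulr_gt0 r2 (mulr_gt0 A0 k0))|apply: mulr_gt0; [apply: divr_gt0|]].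
pose L := X `^ a^-1.
have L0 : 0 < L by rewrite powR_gt0.
have LX : L `^ (- a) = X^-1 by rewrite /L -powRrM mulrN mulVf ?gt_eqF// powRN powRr1// ltW.
have [s /andP[Ss sS] Hs] := sloped_argmax y S L A
  (sqdist_continuous Om_open a01 ev Lw) L0 (fun t => (andP (HA t)).1) (fun t => (andP (HA t)).2).
have s0 : 0 < s := lt_trans S0 Ss.
have Ms : - (rate / 2 * marchaud a y s) <= gamma / 2 * eta.
  have tc := tame_cap L L0.
  have h := le_memory a a01 _ _ (tameZ (- A) _ tc) (tame_sqdist Om_open a01 ev s0 Lw) Hs.
  rewrite (memoryZ a a01 _ _ tc) (memory_cap a a01 L L0) -/kappa LX in h.
  have h2 : rate / 2 * (- A * (X^-1 * kappa)) <= rate / 2 * marchaud a y s.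
    by rewrite ler_wpM2l// divr_ge0// ltW.
  rewrite lerNl; apply: le_trans h2.
  rewrite le_eqVlt; apply/orP; left; apply/eqP; rewrite /X.
  by field; rewrite !gt_eqF.
have [M M0 bM] := limit_bounded_ae.
have EVI := evolution_variational_inequality Om_open Om_bounded gamma_gt0 a01 ev s0 H2w H10w bM.
exists s => // t st.
have t0 := lt_le_trans s0 st.
have mono := modified_energy_nonincreasing Om_open Om_bounded gamma_gt0 a01 ev s0 st.
apply: (relaxation_arith (y := y s) (y' := y t) 0 gamma_gt0 (ltW e0) EVI Ms (yS s (ltW Ss)) mono).
  exact: (energy_lower_bound (ltW t0)).
by apply: yS; apply: le_trans st; exact: ltW.
Qed.

Lemma relaxation_limit : Emod t - E t @[t --> +oo] --> (0 : R).
Proof.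
apply/cvgrPdist_lt => e e0.
have e4 : 0 < e / 4 by rewrite divr_gt0.
have [S S0 HS] := dissipation_vanishes e4.
near=> t.
have St : S <= t by near: t; apply: nbhs_pinfty_ge; exact: num_real.
have t0 := lt_le_trans S0 St.
rewrite sub0r normrN (modified_energy_excess Om_open gamma_gt0 a01 ev t0).
rewrite ger0_norm; last by rewrite divr_ge0 ?dissipation_ge0// ltW.
rewrite ltr_pdivrMr// mulrC; apply: le_lt_trans (HS t St) _.
rewrite ltr_pM2l//; lra.
Unshelve. all: by end_near. Qed.

End relaxation.

(** * Hölder bounds uniform in the order *)

Section rate_bounds.
Variables (R : realType) (gamma a : R).
Hypotheses (gamma_gt0 : 0 < gamma) (a_half : 2^-1 <= a) (a_lt1 : a < 1).

Let a_gt0 : 0 < a. Proof. by apply: lt_le_trans a_half; rewrite invr_gt0. Qed.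

(** Gamma (1 - a) is at most 1 / (1 - a) + 4, so (1 - a) / rate is bounded for a
    >= 1 / 2. This makes all the constants of the barriers independent of the
    order. *)
Lemma rate_inv_le : (1 - a) * (gamma / (a / Gamma (1 - a))) <= 10 * gamma.
Proof.
have s01 : 0 < 1 - a < 1 by rewrite subr_gt0 a_lt1 ltrBlDr ltrDl.
have G1 := Gamma_le _ s01; have G0 := Gamma_gt0 _ s01.
have s0 : 0 < 1 - a by case/andP: s01.
have h : (1 - a) * Gamma (1 - a) <= 10 * a.
  apply: le_trans (ler_wpM2l (ltW s0) G1) _.
  by rewrite mulrDr divff ?gt_eqF//; move: a_half; lra.
have -> : (1 - a) * (gamma / (a / Gamma (1 - a))) = (1 - a) * Gamma (1 - a) / a * gamma.
  by field; rewrite !gt_eqF.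
by rewrite ler_wpM2r ?(ltW gamma_gt0)// ler_pdivrMr.
Qed.

(** The growth rate is a square because a is only known to be at least 1 / 2. *)
Lemma exp_rate_lt :
  2 * (1 - a) * (gamma / (a / Gamma (1 - a))) < ((20 * gamma + 1) ^+ 2) `^ a.
Proof.
rewrite -mulrA; apply: (@le_lt_trans _ _ (20 * gamma)).
  by apply: le_trans (ler_wpM2l _ rate_inv_le) _ => //; rewrite mulrA -natrM.
apply: (@lt_le_trans _ _ (20 * gamma + 1)); first by rewrite ltrDl.
have b0 : 0 <= 20 * gamma by rewrite mulr_ge0// ltW.
set X := 20 * gamma + 1.
have X0 : 0 <= X by rewrite addr_ge0.
have e : X = (X ^+ 2) `^ 2^-1 by rewrite powR12_sqrt ?sqr_ge0// sqrtr_sqr ger0_norm.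
rewrite {1}e; apply: ler_powR => //.
by rewrite -[leLHS](expr1n _ 2) lerXn2r ?nnegrE// lerDr.
Qed.

End rate_bounds.

Section weak_monotonicity.
Context {R : realType} {d : nat}.
Variable Om : set 'rV[R]_d.
Hypotheses (Om_open : open Om) (Om_bounded : bounded_set Om).
Variables (gamma eps : R).

Let mOm : measurable Om. Proof. exact: measurable_open_rV. Qed.

Lemma weak_monotone_arith (R' : realFieldType) (p q y E E' : R') :
  - p - 2^-1 * y <= E' - E -> q - 2^-1 * y <= E - E' -> q - p <= y.
Proof. by lra. Qed.

(** Sum of the semiconvexity inequalities from u to w and from w to u. *)
Lemma chemical_potential_weakly_monotone M u w :
  H2 Om u -> H10 Om u -> bounded_ae Om M u ->
  H2 Om w -> H10 Om w -> bounded_ae Om M w ->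
  ip Om (chemical_potential Om eps w) (u - w)
  - ip Om (chemical_potential Om eps u) (u - w) <= L2norm Om (u - w) ^+ 2.
Proof.
move=> H2u H10u bu H2w H10w bw.
have Lu := H1_L2 (H2_H1 H2u); have Lw := H1_L2 (H2_H1 H2w).
have S1 := free_energy_semiconvex Om_open Om_bounded eps H2u H10u bu H2w H10w bw.
have S2 := free_energy_semiconvex Om_open Om_bounded eps H2w H10w bw H2u H10u bu.
have LA := chemical_potential_L2 Om_open Om_bounded eps H2u bu.
have flip : ip Om (chemical_potential Om eps u) (w - u) =
    - ip Om (chemical_potential Om eps u) (u - w).
  by rewrite !ipBr// opprB.
rewrite flip -/(L2dist Om w u) L2distC in S1.
exact: weak_monotone_arith S1 S2.
Qed.

End weak_monotonicity.

Section norm_of_curve.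
Context {R : realType} {d : nat}.
Variable Om : set 'rV[R]_d.
Hypothesis Om_open : open Om.
Variables (a : R) (F : R -> 'rV[R]_d -> R) (s : R).
Hypotheses (a01 : 0 < a < 1) (LF : forall r, L2 Om (F r)).

Let mOm : measurable Om. Proof. exact: measurable_open_rV. Qed.
Local Notation z := (fun r => L2norm Om (F r)).

Lemma L2norm_diff_le r : `|z s - z (s - r)| <= L2norm Om (F s - F (s - r)).
Proof.
have Fr := LF (s - r); have Fs := LF s.
have h1 := L2normD mOm (L2_sub mOm Fs Fr) Fr.
have h2 := L2normD mOm (L2_sub mOm Fr Fs) Fs.
rewrite !subrK in h1 h2.
rewrite -/(L2dist Om (F (s - r)) (F s)) L2distC /L2dist in h2.
move: h1 h2; move: (L2norm _ _) (L2norm _ _) (L2norm _ _) => x y w h1 h2.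
by rewrite ler_norml; apply/andP; split; lra.
Qed.

(** By the Cauchy-Schwarz inequality, (F s - F (s - r), F s) is at least |F s|
    (|F s| - |F (s - r)|); then divide by |F s|. *)
Lemma marchaud_norm_le (rate g B : R) : 0 < rate -> 0 <= g -> 0 <= B ->
  tame (fun r => z s - z (s - r)) ->
  tame (fun r => ip Om (F s - F (s - r)) (F s)) ->
  rate * memory a (fun r => ip Om (F s - F (s - r)) (F s)) <= g * (z s + B) * z s ->
  rate * marchaud a z s <= g * (z s + B).
Proof.
move=> r0 g0 B0 tz tip H.
have zs0 : 0 <= z s by exact: L2norm_ge0.
have [zs|zs] := eqVneq (z s) 0.
  apply: (@le_trans _ _ 0); last by rewrite mulr_ge0// addr_ge0.
  rewrite pmulr_rle0//.
  have := memory_ge0 a (fun r => (- 1) * (z s - z (s - r))).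
  rewrite memoryZ// mulN1r oppr_ge0; apply => r _.
  by rewrite zs sub0r mulN1r opprK L2norm_ge0.
have zp : 0 < z s by rewrite lt_neqAle eq_sym zs.
rewrite -(ler_pM2r zp); apply: le_trans H.
rewrite -mulrA ler_pM2l// mulrC -memoryZ//.
apply: le_memory => //; first exact: tameZ.
move=> r _; rewrite mulrBr ipBl// -sqr_L2norm// -expr2 lerD2l lerN2 mulrC.
exact: ip_le.
Qed.

End norm_of_curve.

Section uniform_holder.
Context {R : realType} {d : nat}.
Variable Om : set 'rV[R]_d.
Hypotheses (Om_open : open Om) (Om_bounded : bounded_set Om).
Variables (gamma eps : R) (u0 : 'rV[R]_d -> R).
Hypotheses (gamma_gt0 : 0 < gamma) (u0_H2 : H2 Om u0) (u0_H10 : H10 Om u0).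
Variable T : R.
Hypothesis T_gt0 : 0 < T.

Let mOm : measurable Om. Proof. exact: measurable_open_rV. Qed.
Let Lu0 : L2 Om u0. Proof. exact: (H1_L2 (H2_H1 u0_H2)). Qed.

Let B := L2norm Om (chemical_potential Om eps u0).
Let e := expR ((20 * gamma + 1) ^+ 2 * T).
Let C := 40 * gamma * B * e + 1.

(** C is the constant of [power_barrier] for the distance to the initial value,
    and 2 e the growth factor of [exp_barrier] over a time T. *)
Definition holder_const : R := 2 * C * e.

Let B0 : 0 <= B. Proof. exact: L2norm_ge0. Qed.
Let e0 : 0 < e. Proof. exact: expR_gt0. Qed.
Let lam0 : 0 < (20 * gamma + 1) ^+ 2.
Proof. by rewrite exprn_gt0// ltr_wpDl// mulr_ge0// ltW. Qed.
Let e1 : 1 <= e.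
Proof. by rewrite -expR0 ler_expR mulr_ge0// ltW. Qed.
Let C0 : 0 <= C.
Proof. by rewrite addr_ge0// !mulr_ge0// ltW. Qed.

Lemma holder_const_ge0 : 0 <= holder_const.
Proof. by rewrite !mulr_ge0// ltW. Qed.

Section one_solution.
Variables (a : R) (u : R -> 'rV[R]_d -> R).
Hypotheses (a_half : 2^-1 <= a) (a_lt1 : a < 1).
Hypothesis ev : evolution Om gamma eps u0 a u.

Let a0 : 0 < a. Proof. by apply: lt_le_trans a_half; rewrite invr_gt0. Qed.
Let a01 : 0 < a < 1. Proof. by rewrite a0. Qed.
Let rate := a / Gamma (1 - a).
Let rate0 : 0 < rate. Proof. exact: (rate_gt0 a01). Qed.
Let g := gamma / rate.
Let g0 : 0 < g. Proof. exact: divr_gt0. Qed.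
Let Lp s : L2 Om (past u s). Proof. exact: (evo_past_L2 ev). Qed.

Let expT t0 t (q c : R) : 0 <= t0 -> t <= T -> 0 <= c ->
  q <= 2 * c * expR ((20 * gamma + 1) ^+ 2 * (t - t0)) -> q <= 2 * c * e.
Proof.
move=> h0 tT c0 /le_trans; apply; rewrite ler_wpM2l ?mulr_ge0// ler_expR.
by rewrite ler_wpM2l ?(ltW lam0)// lerBlDr; apply: le_trans tT _; rewrite lerDl.
Qed.

Let z s := L2norm Om (past u s - u0).

Lemma initial_bounded : exists2 M, 0 <= M &
  bounded_ae Om M u0 /\ forall t, 0 <= t -> bounded_ae Om M (u t).
Proof.
have [M M0 bM] := evo_bounded ev; exists M => //; split => //.
have h := bM 0 (lexx 0); have h' := evo_init ev.
by apply: filterS2 h h' => x + + Ox => /(_ Ox) + /(_ Ox) <-.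
Qed.

Lemma dist_initial_eq v : L2 Om v -> L2dist Om v (u 0) = L2dist Om v u0.
Proof.
move=> Lv; have Lu := evo_L2 ev (lexx 0).
apply: (eq_L2norm_ae mOm); try exact: L2_sub.
by apply: filterS (evo_init ev) => x + Ox => /(_ Ox) h; rewrite !fctE h.
Qed.

Lemma dist_initial0 s : s <= 0 -> z s = 0.
Proof.
move=> s0; rewrite /z /past (max_r s0) -/(L2dist Om (u 0) u0).
by rewrite -dist_initial_eq ?L2distxx//; exact: (evo_L2 ev).
Qed.

(** Weak monotonicity between u s and u0, with the chemical potential of u0 as a
    source of norm B. *)
Lemma initial_marchaud s : 0 < s -> tame (fun r => z s - z (s - r)) /\
  rate * marchaud a z s <= gamma * (z s + B).
Proof.
move=> s0; have Ls := evo_L2 ev (ltW s0).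
have LF r : L2 Om (past u r - u0) by exact: L2_sub.
have diff r : (past u s - u0) - (past u r - u0) = u s - past u r.
  by rewrite past_nonneg ?(ltW s0)// opprB addrA subrK.
have tz : tame (fun r => z s - z (s - r)).
  apply: (tame_le (k := jump Om u s)).
  - apply: measurable_funB => //; apply: (@measurable_reflect_fun _ z).
    by apply: continuous_measurable_fun; exact: (evo_dist_continuous Om_open a01 ev Lu0).
  - exact: (tame_jump Om_open a01 ev s0).
  - move=> r r0; have := L2norm_diff_le Om_open s LF r; rewrite diff.
    by [].
split=> //.
apply: (marchaud_norm_le Om_open (F := fun r => past u r - u0)) => //; first exact: ltW.
  rewrite (_ : (fun r => _) = fun r => ip Om (u s - past u (s - r)) (past u s - u0)).
    exact: (tame_ip Om_open a01 ev s0 (LF s)).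
  by apply/funext => r; rewrite diff.
rewrite (_ : (fun r => _) = fun r => ip Om (u s - past u (s - r)) (past u s - u0)); last first.
  by apply/funext => r; rewrite diff.
rewrite -(evo_equation ev s0 (LF s)) past_nonneg ?(ltW s0)//.
have [M M0 [bu0 bM]] := initial_bounded.
have W := chemical_potential_weakly_monotone Om_open Om_bounded eps
  (evo_H2 ev (ltW s0)) (evo_H10 ev (ltW s0)) (bM s (ltW s0)) u0_H2 u0_H10 bu0.
have LA := chemical_potential_L2 Om_open Om_bounded eps u0_H2 bu0.
have Ld := L2_sub mOm Ls Lu0.
have := cauchy_schwarz mOm LA Ld; rewrite ler_norml => /andP[cs _].
rewrite mulNr -mulrN -mulrA ler_wpM2l ?(ltW gamma_gt0)//.
rewrite mulrDl -expr2 -/B in cs *.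
move: W cs.
move: (ip _ _ _) (ip _ _ _) (L2norm _ _ ^+ 2) (B * _) => x y w v; lra.
Qed.

(** With B added, the inequality of [initial_marchaud] becomes homogeneous. *)
Lemma dist_initial_growth s : s <= T -> z s + B <= 2 * B * e.
Proof.
move=> sT; have [s0|s0] := leP s 0.
  by rewrite dist_initial0// add0r mulrAC ler_peMl// mulr_ege1// ler1n.
apply: (expT (t0 := 0) (t := s)) => //.
have mar t : marchaud a (fun x => z x + B) t = marchaud a z t.
  by apply: eq_memory => r _; rewrite opprD addrACA subrr addr0.
refine (exp_barrier a a01 (fun x => z x + B) 0 T B g _ _ _ _ _ _ _ _ s _).
- by move=> x; apply: cvgD; [exact: (evo_dist_continuous Om_open a01 ev Lu0)|exact: cvg_cst].
- exact: B0.
- exact: lam0.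
- exact: exp_rate_lt.
- by move=> t t0; rewrite dist_initial0// add0r.
- move=> t /andP[t0 tT]; have [h _] := initial_marchaud t0.
  by rewrite (_ : (fun r => _) = fun r => z t - z (t - r))//; apply/funext => r; rewrite opprD addrACA subrr addr0.
- move=> t /andP[t0 tT]; have [_ h] := initial_marchaud t0.
  by rewrite mar /g mulrAC ler_pdivlMr// mulrC.
- by rewrite s0.
Qed.

(** By [dist_initial_growth] the Marchaud derivative is bounded. *)
Lemma dist_initial_holder s : 0 < s <= T -> z s <= C * s `^ a.
Proof.
move=> sT; refine (power_barrier a a01 z T (g * (2 * B * e)) C _ C0 _ _ _ _ s sT).
- exact: (evo_dist_continuous Om_open a01 ev Lu0).
- rewrite (mulrA (1 - a)); have h : (1 - a) * g <= 10 * gamma := rate_inv_le gamma_gt0 a_half a_lt1.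
  have Be : 0 <= 2 * B * e by rewrite !mulr_ge0// ltW.
  have {}h := ler_wpM2r Be h; apply: (le_lt_trans h).
  have h2 : C * 2^-1 <= C * a by rewrite ler_wpM2l.
  apply: lt_le_trans h2; rewrite /C.
  have -> : 10 * gamma * (2 * B * e) = 40 * gamma * B * e * 2^-1 by field.
  by rewrite ltr_pM2r ?invr_gt0// ltrDl.
- exact: dist_initial0.
- by move=> t /andP[t0 tT]; have [] := initial_marchaud t0.
- move=> t /andP[t0 tT]; have [_ h] := initial_marchaud t0.
  have h2 := dist_initial_growth tT.
  apply: le_trans (ler_wpM2l (ltW g0) h2).
  by rewrite /g mulrAC ler_pdivlMr// mulrC.
Qed.

Section increments.
Variable h : R.
Hypothesis h0 : 0 < h.

Let y s := L2norm Om (past u s - past u (s - h)).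

Lemma increment_continuous : continuous y.
Proof.
move=> s; apply/cvgrPdist_lt => eta eta0.
have eta2 : 0 < eta / 2 by rewrite divr_gt0.
have Lu t : 0 <= t -> L2 Om (u t) := evo_L2 ev (t := t).
have [d1 d10 H1] := past_eps a01 (evo_holder ev) s eta2.
have [d2 d20 H2] := past_eps a01 (evo_holder ev) (s - h) eta2.
near=> s'.
have s1 : `|s' - s| < d1.
  by rewrite distrC; near: s'; exact: (@nbhsx_ballx _ _ s d1).
have s2 : `|s' - s| < d2.
  by rewrite distrC; near: s'; exact: (@nbhsx_ballx _ _ s d2).
have k1 := H1 _ s1.
have k2 := H2 (s' - h); rewrite opprB addrA subrK in k2; have {}k2 := k2 s2.
have t1 := L2dist_triangle mOm (Lp s) (Lp s') (Lp (s - h)).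
have t2 := L2dist_triangle mOm (Lp s') (Lp (s' - h)) (Lp (s - h)).
have t3 := L2dist_triangle mOm (Lp s') (Lp s) (Lp (s' - h)).
have t4 := L2dist_triangle mOm (Lp s) (Lp (s - h)) (Lp (s' - h)).
rewrite (L2distC _ (past u s) (past u s')) in t1.
rewrite (L2distC _ (past u (s - h)) (past u (s' - h))) in t4.
change (`|L2dist Om (past u s) (past u (s - h)) - L2dist Om (past u s') (past u (s' - h))| < eta).
move: k1 k2 t1 t2 t3 t4.
move: (L2dist _ _ _) (L2dist _ _ _)
  (L2dist _ (past u s') (past u s)) (L2dist _ (past u (s' - h)) (past u (s - h)))
  (L2dist _ (past u s) (past u (s - h))) (L2dist _ (past u s') (past u (s' - h)))
  => x1 x2 x3 x4 x5 x6 k1 k2 t1 t2 t3 t4.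
rewrite ltr_norml; apply/andP; split; lra.
Unshelve. all: by end_near. Qed.

(** The equation is autonomous, so that its Marchaud form at s and at s - h can
    be subtracted; both times are positive, and there is no source. *)
Lemma increment_marchaud s : h < s -> tame (fun r => y s - y (s - r)) /\
  rate * marchaud a y s <= gamma * y s.
Proof.
move=> hs; have s0 := lt_trans h0 hs; have sh0 : 0 < s - h by rewrite subr_gt0.
have Ls := evo_L2 ev (ltW s0); have Lsh := evo_L2 ev (ltW sh0).
have LF r : L2 Om (past u r - past u (r - h)) by exact: L2_sub.
have diff r : (past u s - past u (s - h)) - (past u (s - r) - past u (s - r - h)) =
    (u s - past u (s - r)) - (u (s - h) - past u (s - h - r)).
  rewrite (past_nonneg u (ltW s0)) (past_nonneg u (ltW sh0)).
  by rewrite (addrAC s (- h) (- r)) !opprB addrACA [RHS]addrACA; congr (_ + _); rewrite addrC.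
have Lr r : L2 Om (u s - past u (s - r)) by exact: L2_sub.
have Lr' r : L2 Om (u (s - h) - past u (s - h - r)) by exact: L2_sub.
have tz : tame (fun r => y s - y (s - r)).
  apply: (tame_le (k := fun r => jump Om u s r + jump Om u (s - h) r)).
  - apply: measurable_funB => //; apply: (@measurable_reflect_fun _ y).
    by apply: continuous_measurable_fun; exact: increment_continuous.
  - by apply: tameD; exact: (tame_jump Om_open a01 ev).
  - move=> r r0; apply: le_trans (L2norm_diff_le Om_open s LF r) _; rewrite diff.
    by apply: le_trans (L2normD mOm (Lr r) _) _; rewrite ?L2normN// -scaleN1r; exact: (L2_scale mOm).
split=> //; rewrite -[y s in leRHS]addr0.
have t1 := tame_ip Om_open a01 ev s0 (LF s).
have t2 := tame_ip Om_open a01 ev sh0 (LF s).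
have ipE : (fun r => ip Om ((past u s - past u (s - h)) - (past u (s - r) - past u (s - r - h)))
     (past u s - past u (s - h))) =
   (fun r => ip Om (u s - past u (s - r)) (past u s - past u (s - h)) +
     (-1) * ip Om (u (s - h) - past u (s - h - r)) (past u s - past u (s - h))).
  by apply/funext => r; rewrite diff ipBl// mulN1r.
apply: (marchaud_norm_le Om_open (F := fun r => past u r - past u (r - h))) => //; rewrite ?ipE.
- exact: ltW.
- by apply: tameD => //; exact: tameZ.
rewrite memoryD//; last exact: tameZ.
rewrite memoryZ// mulrDr mulrCA -(evo_equation ev s0 (LF s)) -(evo_equation ev sh0 (LF s)).
rewrite !past_nonneg ?(ltW s0) ?(ltW sh0)// addr0.
have [M M0 [_ bM]] := initial_bounded.
have W := chemical_potential_weakly_monotone Om_open Om_bounded eps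
  (evo_H2 ev (ltW s0)) (evo_H10 ev (ltW s0)) (bM s (ltW s0))
  (evo_H2 ev (ltW sh0)) (evo_H10 ev (ltW sh0)) (bM _ (ltW sh0)).
rewrite mulN1r !mulNr opprK addrC -mulrBr -mulrA -expr2 ler_wpM2l// ?ltW//.
Qed.

(** Up to time h the increment is the distance to the initial value, which is
    O(h^a); from then on it grows at most exponentially. *)
Lemma increment_holder s : h <= s <= T -> y s <= holder_const * h `^ a.
Proof.
move=> /andP[hs sT].
have Ch : 0 <= C * h `^ a by rewrite mulr_ge0 ?powR_ge0.
have early t : t <= h -> h <= T -> y t <= C * h `^ a.
  move=> th hT; have -> : y t = z t.
    rewrite /y {2}/past max_r ?subr_le0//; exact: (dist_initial_eq (Lp t)).
  have [t0|t0] := leP t 0; first by rewrite dist_initial0.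
  apply: le_trans (dist_initial_holder _) _; first by rewrite t0 (le_trans th).
  by rewrite ler_wpM2l// ge0_ler_powR ?nnegrE ?(ltW a0) ?(ltW t0) ?(ltW h0).
have hT := le_trans hs sT.
have -> : holder_const * h `^ a = 2 * (C * h `^ a) * e by rewrite /holder_const; ring.
move: hs; rewrite le_eqVlt => /orP[/eqP <-|hs].
  apply: le_trans (early h (lexx h) hT) _.
  by rewrite mulrAC ler_peMl// mulr_ege1// ler1n.
apply: (expT (t0 := h) (t := s)) => //; first exact: ltW.
refine (exp_barrier a a01 y h T (C * h `^ a) g _ _ Ch lam0 _ _ _ _ s _).
- exact: increment_continuous.
- exact: exp_rate_lt.
- by move=> t th; exact: early.
- by move=> t /andP[ht tT]; have [] := increment_marchaud ht.
- move=> t /andP[ht tT]; have [_ k] := increment_marchaud ht.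
  by rewrite /g mulrAC ler_pdivlMr// mulrC.
- by rewrite hs.
Qed.

End increments.

Lemma dissipation_le : dissipation Om a u T <=
  holder_const ^+ 2 * (Num.max 1 T * expR 1) * (1 - a).
Proof.
have K0 := holder_const_ge0.
have s01 : 0 < 1 - a < 1 by rewrite subr_gt0 a_lt1 ltrBlDr ltrDl.
apply: le_trans (dissipation_holder Om_open a01 ev T_gt0 K0 _) _.
  move=> s /andP[s0]; rewrite le_eqVlt => /orP[/eqP ->|sT].
    by rewrite L2distxx// mulr_ge0 ?powR_ge0.
  have h0 : 0 < T - s by rewrite subr_gt0.
  have := @increment_holder _ h0 T; rewrite lexx andbT gerBl => /(_ s0).
  by rewrite subKr !past_nonneg// ltW.
have G0 := Gamma_gt0 _ s01; have G1 := Gamma_ge _ s01.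
have p : 0 < expR (-1) / (1 - a) :> R by rewrite divr_gt0 ?expR_gt0//; case/andP: s01.
have Gi : (Gamma (1 - a))^-1 <= expR 1 * (1 - a).
  have : (Gamma (1 - a))^-1 <= (expR (-1) / (1 - a))^-1 by rewrite lef_pV2 ?posrE.
  by rewrite invf_div expRN invrK mulrC.
have Ta : T `^ a <= Num.max 1 T.
  have [T1|T1] := leP 1 T.
    by have := ler_powR T1 (ltW a_lt1); rewrite powRr1// ltW.
  by rewrite -(powRr0 T); apply: ger_powR; rewrite ?T_gt0 ?(ltW T1)// ltW.
move: K0; move: holder_const => K K0.
have key : T `^ a / Gamma (1 - a) <= Num.max 1 T * (expR 1 * (1 - a)).
  by apply: ler_pM; rewrite ?powR_ge0 ?invr_ge0 ?(ltW G0).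
by have := ler_wpM2l (sqr_ge0 K) key; rewrite !mulrA.
Qed.

End one_solution.
End uniform_holder.

(** * The limits of the modified energy *)

Lemma cvg_to0_at_left1 (R : realType) (f : R -> R) (W : R) : 0 <= W ->
  (forall a, 2^-1 <= a -> a < 1 -> 0 <= f a <= W * (1 - a)) ->
  f a @[a --> 1^'-] --> (0 : R).
Proof.
move=> W0 H; apply/cvgrPdist_lt => e e0.
have W1 : 0 < W + 1 by rewrite ltr_wpDl.
near=> a.
have a1 : a < 1 by near: a; exact: nbhs_left_lt.
have ah : 2^-1 <= a by near: a; apply: nbhs_left_ge; rewrite invf_lt1// ltr1n.
have /andP[f0 fW] := H a ah a1.
have da : 1 - a < e / (W + 1).
  rewrite ltrBlDr -ltrBlDl; near: a; apply: nbhs_left_gt.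
  by rewrite ltrBlDr ltrDl divr_gt0.
rewrite sub0r normrN ger0_norm//; apply: le_lt_trans fW _.
have a1' : 0 <= 1 - a by rewrite subr_ge0 ltW.
apply: (@le_lt_trans _ _ ((W + 1) * (1 - a))); first by rewrite ler_wpM2r// lerDl.
by rewrite mulrC -ltr_pdivlMr.
Unshelve. all: by end_near. Qed.

Unset Implicit Arguments.
Set Strict Implicit.
Set Printing Implicit Defensive.

Theorem proposition3p1 (R : realType) (d : nat) (Om : set 'rV[R]_d)
    (gamma eps : R) (u0 : 'rV[R]_d -> R)
    (d_gt0 : (0 < d)%N)
    (Om_neq0 : Om !=set0) (Om_open : open Om) (Om_connected : connected Om)
    (Om_bounded : bounded_set Om) (Om_regular : C11_boundary Om)
    (gamma_gt0 : 0 < gamma) (eps_gt0 : 0 < eps)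
    (u0_H2 : H2 Om u0) (u0_H10 : H10 Om u0) :
  [/\ forall (alpha : R) (u : R -> 'rV[R]_d -> R), 0 < alpha < 1 ->
        global_bounded_solution Om gamma eps u0 alpha u ->
        modified_energy Om gamma eps alpha u t @[t --> 0^'+]
          --> energy Om eps u 0,
      forall (alpha : R) (u : R -> 'rV[R]_d -> R), 0 < alpha < 1 ->
        global_bounded_solution Om gamma eps u0 alpha u ->
        forall uoo : 'rV[R]_d -> R, steady_state Om gamma eps uoo ->
        L2dist Om (u t) uoo @[t --> +oo] --> 0 ->
        modified_energy Om gamma eps alpha u t - energy Om eps u t
          @[t --> +oo] --> 0
    & forall u : R -> R -> 'rV[R]_d -> R,
        (forall alpha, 0 < alpha < 1 ->
          global_bounded_solution Om gamma eps u0 alpha (u alpha)) ->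
        forall t : R, 0 < t ->
        modified_energy Om gamma eps alpha (u alpha) t
          - energy Om eps (u alpha) t @[alpha --> 1^'-] --> 0].
Proof.
have evol a u a01 := @solution_evolution R d Om Om_open Om_bounded gamma eps u0 gamma_gt0 a u a01.
split.
- move=> a u a01 /(evol _ _ a01) ev.
  exact: (initial_limit Om_open Om_bounded gamma_gt0 a01 ev).
- move=> a u a01 /(evol _ _ a01) ev w sw uw.
  exact: (relaxation_limit Om_open Om_bounded gamma_gt0 a01 ev sw uw).
- move=> u gb t t0.
  pose K := holder_const Om gamma eps u0 t.
  pose W := K ^+ 2 * (Num.max 1 t * expR 1) / gamma.
  apply: (@cvg_to0_at_left1 _ _ W).
    rewrite divr_ge0 ?(ltW gamma_gt0)// mulr_ge0 ?sqr_ge0// mulr_ge0 ?expR_ge0//.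
    by rewrite le_max ler01.
  move=> a ah a1.
  have a01 : 0 < a < 1 by rewrite a1 andbT; apply: lt_le_trans ah; rewrite invr_gt0.
  have ev := evol _ _ a01 (gb a a01).
  rewrite (modified_energy_excess Om_open gamma_gt0 a01 ev t0) divr_ge0 ?(ltW gamma_gt0) ?dissipation_ge0//=.
  rewrite ler_pdivrMr// /W mulrAC divfK ?gt_eqF//.
  exact: (dissipation_le Om_open Om_bounded gamma_gt0 u0_H2 u0_H10 t0 ah a1 ev).
Qed.
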